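(* Let $\beta>0$, $\beta'=\beta/2$, and let $(a_n)_n,(b_n)_n$ be positive parameters with $$\frac{\beta' n}{a_n}\xrightarrow[n\to\infty]{}\tau\in(0,1],\qquad \frac{b_n}{n}\xrightarrow[n\to\infty]{}\infty .$$ For each $n$ let $(\lambda_1,\dots,\lambda_n;w_1,\dots,w_n)\sim\mathcal{J}\beta\mathcal{E}(a_n,b_n)$ (all on one probability space). Then the spectral measure $\sum_i w_i\delta_{(b_n/a_n)\lambda_i}$ and the empirical measure $\frac1n\sum_i\delta_{(b_n/a_n)\lambda_i}$ of the rescaled eigenvalues $\frac{b_n}{a_n}\lambda_i$ converge weakly, almost surely, to the Marchenko–Pastur law $\mathrm{MP}(\tau)$.
   Context: Jacobi ensemble $\mathcal{J}\beta\mathcal{E}(a,b)$ in dimension $n$ (with $\beta>0$, $\beta'=\beta/2$, parameters $a,b>\beta'(n-1)$): the joint law of a random eigenvalue vector $(\lambda_1,\dots,\lambda_n)$ with Lebesgue density $$c_{a,b,\beta}\prod_{i<j}|\lambda_i-\lambda_j|^\beta\prod_{i=1}^n\lambda_i^{a-e_\beta}(1-\lambda_i)^{b-e_\beta}\mathbb{1}_{\{0<\lambda_i<1\}},\qquad e_\beta=\tfrac{\beta}{2}(n-1)+1,$$ ($c_{a,b,\beta}$ the normalising constant), together with an independent weight vector $(w_1,\dots,w_n)$ having the Dirichlet distribution with all $n$ parameters equal to $\beta'$. The spectral measure is $\mu_n=\sum_i w_i\delta_{\lambda_i}$; when eigenvalues are rescaled the weights are kept. The Marchenko–Pastur law $\mathrm{MP}(\tau)$,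 $\tau\in(0,1]$, has density $\frac{1}{2\pi\tau x}\sqrt{(x-\tau^-)(\tau^+-x)}\,\mathbb{1}_{\{\tau^-<x<\tau^+\}}$ with $\tau^\pm=(\sqrt\tau\pm1)^2$. *)

(* Defs.v *)
From HB Require Import structures.
From mathcomp Require Import all_boot all_order all_algebra.
From mathcomp Require Import all_classical all_reals all_analysis.
Set Implicit Arguments.
Unset Strict Implicit.
Unset Printing Implicit Defensive.
Import Order.TTheory GRing.Theory Num.Theory.
Import numFieldNormedType.Exports.
Local Open Scope classical_set_scope.
Local Open Scope ring_scope.

Section Defs.
Variable R : realType.

(* Iterated Lebesgue integral over R^n of a nonnegative function of the
   coordinate list s = [:: x_0; ...; x_(n-1)]:
   iint n F = \int dx_0 \int dx_1 ... \int dx_(n-1) F [:: x_0; ...; x_(n-1)].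
   (By Tonelli this is the integral w.r.t. n-dimensional Lebesgue measure.) *)
Fixpoint iint (n : nat) (F : seq R -> \bar R) : \bar R :=
  match n with
  | 0 => F [::]
  | n'.+1 => (\int[@lebesgue_measure R]_x iint n' (fun s => F (x :: s)))%E
  end.

Definition jac_dens (beta a b : R) (s : seq R) : R :=
  let n := size s in
  let e := beta / 2 * (n.-1)%:R + 1 in
  (\prod_(i < n) \prod_(j < n | (i < j)%N) (`|s`_i - s`_j| `^ beta)) *
  (\prod_(i < n) (s`_i `^ (a - e) * (1 - s`_i) `^ (b - e) *
                   \1_[set x : R | 0 < x < 1] s`_i)).

Definition jac_prob (beta a b : R) (n : nat) (A : 'I_n -> set R) : \bar R :=
  (iint n (fun s => (jac_dens beta a b s *
                     \1_[set s : seq R | forall i : 'I_n, A i s`_i] s)%:E) *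
   ((fine (iint n (fun s => (jac_dens beta a b s)%:E)))^-1)%:E)%E.

(* Unnormalised Dirichlet(c,...,c) density (n parameters) expressed in the
   first n-1 coordinates u = [:: w_0; ...; w_(n-2)], w_(n-1) = 1 - sum u. *)
Definition dir_dens (c : R) (u : seq R) : R :=
  (\prod_(i < size u) (u`_i `^ (c - 1))) *
  ((1 - \sum_(i < size u) u`_i) `^ (c - 1)) *
  \1_[set v : seq R | (forall i : 'I_(size v), 0 < v`_i) /\
                      \sum_(i < size v) v`_i < 1] u.

Definition dir_ext (n : nat) (u : seq R) (i : 'I_n) : R :=
  if (i < n.-1)%N then u`_i else 1 - \sum_(k < n.-1) u`_k.

Definition dir_prob (c : R) (n : nat) (B : 'I_n -> set R) : \bar R :=
  (iint n.-1 (fun u => (dir_dens c u *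
                  \1_[set v : seq R | forall i : 'I_n, B i (dir_ext v i)] u)%:E) *
   ((fine (iint n.-1 (fun u => (dir_dens c u)%:E)))^-1)%:E)%E.

Definition mp_minus (tau : R) : R := (Num.sqrt tau - 1) ^+ 2.
Definition mp_plus (tau : R) : R := (Num.sqrt tau + 1) ^+ 2.
Definition mp_dens (tau : R) (x : R) : R :=
  Num.sqrt ((x - mp_minus tau) * (mp_plus tau - x)) / (2 * pi * tau * x) *
  \1_`]mp_minus tau, mp_plus tau[ x.

Definition mp_int (tau : R) (f : R -> R) : R :=
  Rintegral (@lebesgue_measure R) setT (fun x => f x * mp_dens tau x).

(* weak convergence of a sequence of (finite, atomic) measures
   mu_n = sum_(i < n) m n i delta_(x n i) to MP(tau):
   int f d mu_n -> int f dMP(tau) for every bounded continuous f *)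
Definition weak_cvg_MP (m x : forall n, 'I_n -> R) (tau : R) : Prop :=
  forall f : R -> R, continuous f -> (exists M, forall y, `|f y| <= M) ->
    (fun n => \sum_(i < n) m n i * f (x n i)) @ \oo --> mp_int tau f.

End Defs.

(* Main.v *)
(* Deform the Jacobi density by the maps x |-> x + e x^(k+1) (1 - x) of (0, 1) applied to every
   eigenvalue. The total mass does not depend on e, and the second order expansion in e gives
   E[L_k] = 0 and an exact formula for E[L_k^2], where the loop function L_k is a quadratic
   polynomial in the power sums p_j of the eigenvalues. Writing theta = a_n / b_n, the first
   identity bounds E[p_k] by C n theta^k, after which the second one bounds the second moment of
   L_k / (n^2 theta^k) by C / n^2; by Borel-Cantelli this quantity tends to 0 almost surely.
   Hence the moments p_k / (n theta^k) of the rescaled empirical measure converge to the solution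
   of m_0 = 1, m_(k+1) = (1 - tau) m_k + tau sum_(p <= k) m_p m_(k-p).

   Conditionally on the eigenvalues, the moments of the spectral measure are Dirichlet averages;
   their fourth centred moment is explicit, of order p_(4k) / n^3, so that almost surely the two
   measures have the same limiting moments.

   With x = 1 + tau - 2 sqrt(tau) cos t the moments of MP(tau) become trigonometric integrals, for
   which integration by parts gives a three-term linear recursion; a generating function argument
   turns it into the quadratic recursion above. Since MP(tau) has compact support, convergence of
   all moments implies weak convergence, by Bernstein approximation. *)

Require Import Defs.
From HB Require Import structures.
From mathcomp Require Import all_boot all_order all_algebra.
From mathcomp Require Import all_classical all_reals all_analysis.
From mathcomp Require Import measurable_realfun ring lra.
Set Implicit Arguments.
Unset Strict Implicit.
Unset Printing Implicit Defensive.
Import Order.TTheory GRing.Theory Num.Theory.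
Import numFieldNormedType.Exports.
Local Open Scope classical_set_scope.
Local Open Scope ring_scope.


(** * Positive functionals and iterated integrals *)

(** The law is known only through probabilities of rectangles, written as quotients of iterated
    integrals. Expectations are reached by turning each iterated integral into a measure (a positive
    functional with monotone convergence is one) and comparing it with the law of the sample on
    rectangles, which generate the sigma-algebra.

    The field [x^(k+1) (1 - x)] vanishes at 0 and at 1. The deformation therefore maps the cube to
    itself without boundary terms, and each factor of the density, however singular at the
    endpoints, is only multiplied by [1 + e t] with [t] bounded. Thus [E[prod (1 + e t_i)^(c_i)] =
    1] is expanded pointwise, with a uniform remainder. The [e^2] coefficient expresses [E[L_k^2]]
    by [sum c_i E[t_i^2]], which is bounded linearly in mean power sums: first moment bounds alone
    yield concentration.

    The weights call for a fourth moment because the second centred moment is only of order [1 / n]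
    after rescaling, which is not summable. *)

Lemma eq_limn (R : realType) (u v : nat -> \bar R) :
  (forall n, u n = v n) -> limn u = limn v.
Proof. by move=> /funext ->. Qed.

Section positive_functional.
Local Open Scope ereal_scope.
Context (R : realType) (d : measure_display) (X : measurableType d).

(** A Daniell integral on nonnegative functions. Additivity, homogeneity and limits are asked for
    measurable functions only, the setting in which iterated integrals have these properties. *)
Record pos_functional (L : (X -> \bar R) -> \bar R) : Prop := PosFunctional {
  pf_0 : L (cst 0) = 0;
  pf_ge0 : forall f : X -> \bar R, (forall x, 0 <= f x) -> 0 <= L f;
  pf_D : forall f g : X -> \bar R, (forall x, 0 <= f x) -> (forall x, 0 <= g x) ->
    measurable_fun setT f -> measurable_fun setT g ->
    L (fun x => f x + g x) = L f + L g;
  pf_Z : forall (k : R) (f : X -> \bar R), (0 <= k)%R -> (forall x, 0 <= f x) ->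
    measurable_fun setT f -> L (fun x => k%:E * f x) = k%:E * L f;
  pf_lim : forall f : nat -> X -> \bar R, (forall n x, 0 <= f n x) ->
    (forall n, measurable_fun setT (f n)) ->
    (forall x, nondecreasing_seq (f ^~ x)) ->
    L (fun x => limn (f ^~ x)) = limn (fun n => L (f n)) }.

Variables (L : (X -> \bar R) -> \bar R) (pL : pos_functional L).

Lemma pf_sum (I : Type) (s : seq I) (f : I -> X -> \bar R) :
  (forall i x, 0 <= f i x) -> (forall i, measurable_fun setT (f i)) ->
  L (fun x => \sum_(i <- s) f i x) = \sum_(i <- s) L (f i).
Proof.
move=> f0 mf; elim: s => [|i s IH].
  rewrite big_nil -[RHS](pf_0 pL); congr L; apply/funext => x.
  by rewrite big_nil.
rewrite big_cons -IH -pf_D//.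
- by congr L; apply/funext => x; rewrite big_cons.
- by move=> x; apply: sume_ge0.
- exact: emeasurable_sum.
Qed.

Definition pf_measure_fun of pos_functional L :=
  fun A : set X => L (EFin \o \1_A : X -> \bar R).
Let mu := pf_measure_fun pL.

Let mu0 : mu set0 = 0.
Proof.
rewrite /mu /pf_measure_fun -[RHS](pf_0 pL); congr L; apply/funext => x /=.
by rewrite indicE in_set0.
Qed.

Let mu_ge0 A : 0 <= mu A.
Proof. by apply: (pf_ge0 pL) => x; rewrite lee_fin. Qed.

Let mu_sigma : semi_sigma_additive mu.
Proof.
move=> F mF tF mUF.
have Fnn n x : 0 <= (\sum_(0 <= i < n) (\1_(F i) x)%:E : \bar R).
  by apply: sume_ge0 => i _; rewrite lee_fin.
have mFn n : measurable_fun setT (fun x => \sum_(0 <= i < n) (\1_(F i) x)%:E : \bar R).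
  by apply: emeasurable_sum => i; exact/measurable_EFinP/measurable_indic.
have Fnd x : nondecreasing_seq (fun n => \sum_(0 <= i < n) (\1_(F i) x)%:E : \bar R).
  by apply: ereal_nondecreasing_series => i _ _; rewrite lee_fin.
have E : mu (\bigcup_n F n) = limn (fun n => \sum_(0 <= i < n) mu (F i)).
  transitivity (L (fun x => limn (fun n => \sum_(0 <= i < n) (\1_(F i) x)%:E))).
    congr L; apply/funext => x /=.
    by rewrite indic_bigcup.
  rewrite (pf_lim pL Fnn mFn Fnd); apply: eq_limn => n.
  rewrite (@pf_sum _ _ (fun i x => (\1_(F i) x)%:E))//.
  move=> i; exact/measurable_EFinP/measurable_indic.
rewrite E; apply: is_cvg_ereal_nneg_natsum => i _; exact: mu_ge0.
Qed.

HB.instance Definition _ :=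
  isMeasure.Build d X R (pf_measure_fun pL) mu0 mu_ge0 mu_sigma.

Import HBNNSimple.

(** Both sides agree on indicators by definition of the measure, hence on simple functions, and both
    commute with increasing limits. *)
Lemma pf_integral (f : X -> \bar R) : (forall x, 0 <= f x) ->
  measurable_fun setT f -> \int[pf_measure_fun pL]_x f x = L f.
Proof.
move=> f0 mf.
pose g := nnsfun_approx measurableT mf.
have gnd x : nondecreasing_seq (fun n => (g n x)%:E).
  by move=> m n mn; rewrite lee_fin; exact/lefP/nd_nnsfun_approx.
have mg n : measurable_fun setT (fun x => (g n x)%:E).
  exact/measurable_EFinP/measurable_funP.
have fE : f = fun x => limn (fun n => (g n x)%:E).
  apply/funext => x; apply/esym/cvg_lim => //.
  exact: cvg_nnsfun_approx.
have g0 n x : 0 <= (g n x)%:E by rewrite lee_fin.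
rewrite fE monotone_convergence//.
rewrite (pf_lim pL)//; apply: eq_limn => n.
rewrite integralT_nnsfun sintegralE.
(* [pf_sum] wants every term nonnegative whatever the index; [|r|] equals [r] on the values actually
   taken. *)
have -> : (fun x => (g n x)%:E) =
   (fun x => \sum_(r <- finmap.enum_fset (fset_set (range (g n))))
     (`|r|%:E * (\1_(g n @^-1` [set r]) x)%:E)).
  apply/funext => x; rewrite fimfunE -fsumEFin// fsbig_finite//=.
  rewrite big_seq [RHS]big_seq; apply: eq_bigr => r.
  rewrite in_fset_set// inE => -[y _ <-].
  by rewrite EFinM ger0_norm.
rewrite (@pf_sum _ _ (fun r x => `|r|%:E * (\1_(g n @^-1` [set r]) x)%:E)); last 2 first.
- by move=> r x; rewrite mule_ge0 ?lee_fin.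
- move=> r; apply: emeasurable_funM => //.
  exact/measurable_EFinP/measurable_indic.
rewrite fsbig_finite//= big_seq [RHS]big_seq; apply: eq_bigr => r.
rewrite in_fset_set// inE => -[y _ <-].
rewrite (pf_Z pL)//.
- by rewrite ger0_norm.
- exact/measurable_EFinP/measurable_indic.
Qed.

End positive_functional.

Section iint_theory.
Local Open Scope ereal_scope.
Context (R : realType).
Implicit Types (F G : seq R -> \bar R).

Definition measurable_at n F := measurable_fun setT (fun t : n.-tuple R => F t).

Lemma eq_iint n F G : (forall s, size s = n -> F s = G s) -> iint n F = iint n G.
Proof.
elim: n F G => [|n IH] F G FG /=; first exact: FG.
by apply: eq_integral => x _; apply: IH => s sn; apply: FG; rewrite /= sn.
Qed.

Lemma iint_ge0 n F : (forall s, 0 <= F s) -> 0 <= iint n F.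
Proof.
elim: n F => [|n IH] F F0 /=; first exact: F0.
by apply: integral_ge0 => x _; apply: IH => s.
Qed.

(** The parameter space [X] is arbitrary so that the induction can absorb the outer variable into
    it: one Tonelli step replaces [X] by [X * R]. *)
Lemma iint_measurable n d (X : measurableType d) (F : X -> seq R -> \bar R) :
  (forall x s, 0 <= F x s) ->
  measurable_fun setT (fun p : X * n.-tuple R => F p.1 p.2) ->
  measurable_fun setT (fun x => iint n (F x)).
Proof.
elim: n d X F => [|n IH] d X F F0 mF /=.
  rewrite (_ : (fun x => _) =
      (fun p : X * 0.-tuple R => F p.1 p.2) \o (fun x => (x, [tuple])))//.
  by apply: measurableT_comp => //; apply: measurable_fun_pair.
pose G := fun (q : X * R) s => F q.1 (q.2 :: s).
have := IH _ (X * R)%type G (fun _ _ => F0 _ _).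
move=> /(_ _)/[dup] mG {mG} mG.
apply: (@measurable_fun_fubini_tonelli_F _ _ _ _ _ (@lebesgue_measure R)
    (fun q : X * R => iint n (G q))) => //.
  apply: mG.
  rewrite (_ : (fun p => _) = (fun p : X * n.+1.-tuple R => F p.1 p.2) \o
      (fun p : (X * R) * n.-tuple R => (p.1.1, [tuple of p.1.2 :: p.2])))//.
  apply: measurableT_comp => //; apply: measurable_fun_pair => //=.
    exact: measurableT_comp.
  by apply: measurable_cons => //; exact: measurableT_comp.
by move=> q; apply: iint_ge0 => s; exact: F0.
Qed.

Lemma measurable_at_cons n F x : measurable_at n.+1 F ->
  measurable_at n (fun s => F (x :: s)).
Proof.
move=> mF; rewrite /measurable_at (_ : (fun t => _) =
  (fun t : n.+1.-tuple R => F t) \o (fun t : n.-tuple R => [tuple of x :: t]))//.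
by apply: measurableT_comp => //; exact: measurable_cons.
Qed.

Lemma iint_cons_measurable n F : (forall s, 0 <= F s) -> measurable_at n.+1 F ->
  measurable_fun setT (fun x => iint n (fun s => F (x :: s))).
Proof.
move=> F0 mF; apply: (@iint_measurable n _ _ (fun x s => F (x :: s))) => //.
rewrite (_ : (fun p => _) = (fun t : n.+1.-tuple R => F t) \o
   (fun p : R * n.-tuple R => [tuple of p.1 :: p.2]))//.
by apply: measurableT_comp => //; exact: measurable_cons.
Qed.

Lemma iintD n F G : (forall s, 0 <= F s) -> (forall s, 0 <= G s) ->
  measurable_at n F -> measurable_at n G ->
  iint n (fun s => F s + G s) = iint n F + iint n G.
Proof.
elim: n F G => [|n IH] F G F0 G0 mF mG //=.
rewrite -ge0_integralD//; first last.
- exact: iint_cons_measurable.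
- by move=> x _; exact: iint_ge0.
- exact: iint_cons_measurable.
- by move=> x _; exact: iint_ge0.
by apply: eq_integral => x _; apply: IH => //; exact: measurable_at_cons.
Qed.

Lemma iintZl n F (k : R) : (0 <= k)%R -> (forall s, 0 <= F s) ->
  measurable_at n F -> iint n (fun s => k%:E * F s) = k%:E * iint n F.
Proof.
move=> k0; elim: n F => [|n IH] F F0 mF //=.
rewrite -ge0_integralZl_EFin//; first last.
- exact: iint_cons_measurable.
- by move=> x _; exact: iint_ge0.
by apply: eq_integral => x _; apply: IH => //; exact: measurable_at_cons.
Qed.

Lemma iint_le n F G : (forall s, 0 <= F s) -> (forall s, size s = n -> F s <= G s) ->
  (forall s, 0 <= G s) ->
  measurable_at n F -> measurable_at n G -> iint n F <= iint n G.
Proof.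
elim: n F G => [|n IH] F G F0 FG G0 mF mG /=; first exact: FG.
apply: ge0_le_integral => //.
- by move=> x _; exact: iint_ge0.
- exact: iint_cons_measurable.
- exact: iint_cons_measurable.
- move=> x _; apply: IH => //; try exact: measurable_at_cons.
  by move=> s sn; apply: FG; rewrite /= sn.
Qed.

Lemma iint_lim n (f : nat -> seq R -> \bar R) : (forall k s, 0 <= f k s) ->
  (forall k, measurable_at n (f k)) ->
  (forall s, nondecreasing_seq (f ^~ s)) ->
  iint n (fun s => limn (f ^~ s)) = limn (fun k => iint n (f k)).
Proof.
elim: n f => [|n IH] f f0 mf ndf //=.
rewrite -monotone_convergence//; first last.
- move=> x _ k l kl; apply: iint_le => //; try exact: measurable_at_cons.
  by move=> s _; exact: ndf.
- by move=> k x _; exact: iint_ge0.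
- by move=> k; exact: iint_cons_measurable.
apply: eq_integral => x _; apply: (IH (fun k s => f k (x :: s))) => //.
by move=> k; exact: measurable_at_cons.
Qed.

Lemma iint_cat n m (F : seq R -> seq R -> \bar R) :
  iint n (fun s => iint m (F s)) =
  iint (n + m) (fun v => F (take n v) (drop n v)).
Proof.
elim: n F => [|n IH] F /=.
  by apply: eq_iint => s _; rewrite take0 drop0.
by apply: eq_integral => x _; rewrite IH.
Qed.

Lemma iint0 n : iint n (fun=> 0 : \bar R) = 0.
Proof. by elim: n => //= n ->; rewrite integral0. Qed.

Lemma measurable_nth n j : measurable_fun setT (fun t : n.-tuple R => (t`_j)%R).
Proof.
have [jn|jn] := ltnP j n.
  rewrite (_ : (fun t => _) = (fun t : n.-tuple R => tnth t (Ordinal jn))).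
    exact: measurable_tnth.
  by apply/funext => t; rewrite (tnth_nth 0%R).
rewrite (_ : (fun t => _) = cst 0%R)//.
by apply/funext => t; rewrite nth_default// size_tuple.
Qed.

Section with_density.
Context (n : nat) (d : measure_display) (X : measurableType d).
Variables (phi : seq R -> X) (h : seq R -> R).
Hypothesis mphi : measurable_fun setT (fun t : n.-tuple R => phi t).
Hypothesis h0 : forall s, (0 <= h s)%R.
Hypothesis mh : measurable_fun setT (fun t : n.-tuple R => h t).

(** Serves twice: with one variable for the change of variables formula, and with [n + n.-1]
    variables for the joint law of eigenvalues and weights. *)
Lemma pos_functional_iint :
  pos_functional (fun f : X -> \bar R => iint n (fun s => f (phi s) * (h s)%:E)).
Proof.
have mfh (f : X -> \bar R) : measurable_fun setT f ->
    measurable_at n (fun s => f (phi s) * (h s)%:E).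
  move=> mf; apply: emeasurable_funM; first exact: measurableT_comp.
  exact/measurable_EFinP.
have fh0 (f : X -> \bar R) s : (forall x, 0 <= f x) -> 0 <= f (phi s) * (h s)%:E.
  by move=> f0; rewrite mule_ge0// lee_fin.
split.
- by rewrite -[RHS](iint0 n); apply: eq_iint => s _; rewrite mul0e.
- by move=> f f0; apply: iint_ge0 => s; exact: fh0.
- move=> f g f0 g0 mf mg; rewrite -iintD; try by move=> s; exact: fh0.
  + by apply: eq_iint => s _; rewrite ge0_muleDl.
  + exact: mfh.
  + exact: mfh.
- move=> k f k0 f0 mf; rewrite -iintZl//; try by move=> s; exact: fh0.
  + by apply: eq_iint => s _; rewrite muleA.
  + exact: mfh.
- move=> f f0 mf ndf; rewrite -iint_lim//; first last.
  + by move=> s k l kl; apply: lee_wpmul2r; [rewrite lee_fin|exact: ndf].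
  + by move=> k; exact: mfh.
  + by move=> k s; exact: fh0.
  apply: eq_iint => s _.
  have cf : cvgn (f ^~ (phi s)) by exact: ereal_nondecreasing_is_cvgn.
  by rewrite -limeMr.
Qed.

End with_density.

(* [j] is the Jacobian, extended by 0 outside the support of [F]. *)
Lemma iint_change (psi j : R -> R) (D : set R) :
  measurable_fun setT psi -> measurable_fun setT j -> (forall x, (0 <= j x)%R) ->
  (forall h : R -> \bar R, (forall x, 0 <= h x) -> measurable_fun setT h ->
    (forall x, ~ D x -> h x = 0) ->
    \int[@lebesgue_measure R]_x h x =
    \int[@lebesgue_measure R]_x (h (psi x) * (j x)%:E)) ->
  forall n F, (forall s, 0 <= F s) -> measurable_at n F ->
    (forall s x, x \in s -> ~ D x -> F s = 0) ->
  iint n F = iint n (fun s => F (map psi s) * (\prod_(x <- s) j x)%:E).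
Proof.
move=> mpsi mj j0 H; elim=> [|n IH] F F0 mF FD /=.
  by rewrite big_nil mule1.
have mh := iint_cons_measurable F0 mF.
rewrite H//; last 2 first.
- by move=> x; exact: iint_ge0.
- move=> x Dx; rewrite -[RHS](iint0 n); apply: eq_iint => s _.
  by apply: (FD _ x) => //; rewrite mem_head.
have mFpsi x : measurable_at n
    (fun s : seq R => F (psi x :: map psi s) * (\prod_(y <- s) j y)%:E).
  apply: emeasurable_funM.
    rewrite (_ : (fun t => _) = (fun t : n.+1.-tuple R => F t) \o
      (fun t : n.-tuple R => [tuple of psi x :: [tuple of map psi t]]))//.
    apply: measurableT_comp => //; apply: measurable_cons => //.
    apply/measurable_fun_tnthP => i.
    rewrite (_ : _ \o _ = fun t : n.-tuple R => psi (tnth t i)).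
      by apply: measurableT_comp => //; exact: measurable_tnth.
    by apply/funext => t /=; rewrite tnth_map.
  apply/measurable_EFinP.
  rewrite (_ : (fun t => _) = fun t : n.-tuple R => \prod_(i < n) j (tnth t i))%R.
    apply: measurable_prod => i _; apply: measurableT_comp => //.
    exact: measurable_tnth.
  by apply/funext => t; rewrite big_tuple.
apply: eq_integral => x _.
rewrite (IH (fun s => F (psi x :: s)))//; last 2 first.
- exact: measurable_at_cons.
- by move=> s y ys Dy; apply: (FD _ y) => //; rewrite inE ys orbT.
rewrite muleC -iintZl//.
- by apply: eq_iint => s _; rewrite big_cons EFinM muleCA.
- by move=> s; rewrite mule_ge0// lee_fin prodr_ge0.
Qed.

End iint_theory.

(** * Integration on open intervals *)

Section calculus.
Context (R : realType).
Notation mu := (@lebesgue_measure R).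

(** The integrand may blow up at either end, so only one-sided limits of [F] are available there;
    nonnegativity lets compact subintervals exhaust the interval. *)
Lemma ge0_FTC2_oo (f F : R -> R) (a b la lb : R) : a < b ->
  (forall x, a < x < b -> 0 <= f x) ->
  (forall x, a < x < b -> {for x, continuous f}) ->
  (forall x, a < x < b -> is_derive x (1 : R) F (f x)) ->
  F x @[x --> a^'+] --> la -> F x @[x --> b^'-] --> lb ->
  (\int[mu]_(x in `]a, b[) (f x)%:E = (lb - la)%:E)%E.
Proof.
move=> ab f0 cf dF Fa Fb.
(* The margin is at most a third of the length, so [an n < bn n] already at [n = 0]. *)
pose an (n : nat) := a + (b - a) / n.+3%:R.
pose bn (n : nat) := b - (b - a) / n.+3%:R.
have n3 (n : nat) : (b - a) / n.+3%:R < (b - a) / 2.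
  by rewrite ltr_pM2l ?subr_gt0// ltf_pV2 ?posrE// ltr_nat.
have n0 (n : nat) : 0 < (b - a) / n.+3%:R by rewrite divr_gt0 ?subr_gt0.
have aan n : a < an n by rewrite /an ltrDl.
have bnb n : bn n < b by rewrite /bn ltrBlDr ltrDl.
have anbn n : an n < bn n.
  by rewrite /an /bn ltrBrDr -addrA -ltrBrDl (lt_le_trans (ltrD (n3 n) (n3 n)))// -splitr.
pose A n : set R := `[an n, bn n]%classic.
have Aab n x : A n x -> a < x < b.
  rewrite /A/= in_itv/= => /andP[xa xb].
  by rewrite (lt_le_trans (aan n))//= (le_lt_trans xb).
have cvgh : (b - a) / n.+3%:R @[n --> \oo] --> (0 : R).
  rewrite -[X in _ --> X](mulr0 (b - a)); apply: cvgM; first exact: cvg_cst.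
  have := @cvg_harmonic R; rewrite -(cvg_shiftn 2) => H.
  rewrite (_ : (fun x => _) = [sequence harmonic (n + 2)%N]_n)//.
  by apply/funext => n; rewrite /= addn2.
have ndA : nondecreasing_seq A.
  move=> m n mn; apply/subsetPset => x; rewrite /A/= !in_itv/= => /andP[xa xb].
  have h : (b - a) / n.+3%:R <= (b - a) / m.+3%:R.
    by rewrite ler_pM2l ?subr_gt0// lef_pV2 ?posrE// ler_nat !ltnS.
  by rewrite (le_trans _ xa) ?(le_trans xb)// ?lerD2l// lerN2.
have UA : \bigcup_n A n = `]a, b[%classic.
  apply/seteqP; split => [x|x]; first by case=> n _ /Aab.
  rewrite /= in_itv/= => /andP[ax xb].
  have : \forall n \near \oo, (b - a) / n.+3%:R < Num.min (x - a) (b - x).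
    apply: (cvgr_lt (0 : R)) => //.
    by rewrite lt_min !subr_gt0 ax xb.
  case=> N _ /(_ N (leqnn N)) /=; rewrite lt_min => /andP[h1 h2].
  exists N => //; rewrite /A/= in_itv/= /an /bn.
  by move: (_ / _) h1 h2 => q h1 h2; apply/andP; split; lra.
have mfab : measurable_fun `]a, b[ f.
  apply: open_continuous_measurable_fun => // x.
  by rewrite mem_setE in_itv/= => /cf.
have mfA n : measurable_fun (A n) (EFin \o f).
  apply/measurable_EFinP; apply: measurable_funS mfab => //.
  by move=> x /Aab.
have H : (\int[mu]_(x in A i) (f x)%:E @[i --> \oo] -->
    \int[mu]_(x in `]a, b[) (f x)%:E)%E.
  rewrite -UA; apply: ge0_nondecreasing_set_cvg_integral => //.
    by move=> n; exact: measurable_itv.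
  by move=> n x Ax; rewrite lee_fin; exact/f0/(Aab n).
have IA n : (\int[mu]_(x in A n) (f x)%:E = (F (bn n) - F (an n))%:E)%E.
  rewrite (@continuous_FTC2 _ f F (an n) (bn n))//.
  - apply: continuous_in_subspaceT => x; rewrite inE => /Aab.
    exact: cf.
  - split.
    + move=> x; rewrite in_itv/= => /andP[x1 x2].
      have xab : a < x < b by rewrite (lt_trans (aan n) x1) (lt_trans x2).
      by have := dF x xab; case.
    + apply: cvg_at_right_filter.
      have xab : a < an n < b by rewrite aan (lt_trans (anbn n)).
      apply/differentiable_continuous/derivable1_diffP.
      by have := dF _ xab; case.
    + apply: cvg_at_left_filter.
      have xab : a < bn n < b by rewrite bnb andbT (lt_trans _ (anbn n)).
      apply/differentiable_continuous/derivable1_diffP.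
      by have := dF _ xab; case.
  - move=> x; rewrite in_itv/= => /andP[x1 x2].
    have xab : a < x < b by rewrite (lt_trans (aan n) x1) (lt_trans x2).
    by rewrite derive1E; have := dF x xab => ?; rewrite derive_val.
have L : (F (bn n) - F (an n))%:E @[n --> \oo] --> ((lb - la)%:E : \bar R).
  apply: cvg_EFin; first exact: nearW.
  apply: cvgB.
  - move/cvg_at_leftP: Fb; apply; split => //.
    rewrite -[X in _ --> X]subr0; apply: cvgB => //; exact: cvg_cst.
  - move/cvg_at_rightP: Fa; apply; split => //.
    rewrite -[X in _ --> X]addr0; apply: cvgD => //; exact: cvg_cst.
have EA : (fun n => \int[mu]_(x in A n) (f x)%:E)%E =
    (fun n => (F (bn n) - F (an n))%:E) by apply/funext.
by rewrite EA in H; exact: (cvg_unique _ H L).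
Qed.

(** As functionals of [h] both sides are integrals against measures on the line, so it suffices to
    compare them on open rays, where one gives a length and the other an increment of [F]. *)
Lemma change_of_variables (F f : R -> R) (a b : R) (h : R -> \bar R) : a < b ->
  continuous F -> continuous f -> (forall x, is_derive x (1 : R) F (f x)) ->
  (forall x, a < x < b -> 0 <= f x) ->
  (forall x y, a <= x -> y <= b -> x < y -> F x < F y) ->
  (forall x, 0 <= h x)%E -> measurable_fun setT h ->
  (\int[mu]_(y in `]F a, F b[) h y = \int[mu]_(x in `]a, b[) (h (F x) * (f x)%:E))%E.
Proof.
move=> ab cF cf dF f0 Finc h0 mh.
have mF : measurable_fun setT F by exact: continuous_measurable_fun.
have mf : measurable_fun setT f by exact: continuous_measurable_fun.
pose d1 (s : seq R) : R := \1_(`]F a, F b[%classic : set R) s`_0.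
pose d2 (s : seq R) : R := f s`_0 * \1_(`]a, b[%classic : set R) s`_0.
have d20 s : 0 <= d2 s.
  rewrite /d2 indicE; case: (boolP (_ \in _)); last by rewrite mulr0.
  by rewrite inE/= in_itv/= => /f0; rewrite mulr1.
have d10 s : 0 <= d1 s by [].
have md1 : measurable_fun setT (fun t : 1.-tuple R => d1 t).
  by apply: measurableT_comp; [exact: measurable_indic|exact: measurable_nth].
have md2 : measurable_fun setT (fun t : 1.-tuple R => d2 t).
  apply: measurable_funM; first by apply: measurableT_comp => //; exact: measurable_nth.
  by apply: measurableT_comp; [exact: measurable_indic|exact: measurable_nth].
have p1 := @pos_functional_iint R 1 _ _ (fun s => s`_0) d1
  (@measurable_nth R 1 0) d10 md1.
have mF0 : measurable_fun setT (fun t : 1.-tuple R => F t`_0).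
  by apply: measurableT_comp => //; exact: measurable_nth.
have p2 := @pos_functional_iint R 1 _ _ (fun s => F s`_0) d2 mF0 d20 md2.
transitivity (\int[pf_measure_fun p1]_x h x)%E.
  rewrite pf_integral//= integral_mkcond; apply: eq_integral => x _.
  rewrite patchE /d1 indicE/=.
  by case: ifPn; rewrite ?mule1 ?mule0.
transitivity (\int[pf_measure_fun p2]_x h x)%E; last first.
  rewrite pf_integral//= [RHS]integral_mkcond; apply: eq_integral => x _.
  rewrite patchE /d2 indicE/=.
  by case: ifPn => _; rewrite ?mulr1 ?mulr0 ?mule0.
apply: eq_measure_integral => A mA _.
have FTC u : a <= u <= b ->
    (\int[mu]_(x in `]u, b[) (f x)%:E = (F b - F u)%:E)%E.
  move=> /andP[au]; rewrite le_eqVlt => /predU1P[->|ub].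
    by rewrite set_itvoo0 integral_set0 subrr.
  apply: (@ge0_FTC2_oo f F) => //.
  - by move=> x /andP[ux xb]; apply: f0; rewrite (le_lt_trans au).
  - by move=> x _; exact: cf.
  - by apply: cvg_at_right_filter; exact: cF.
  - by apply: cvg_at_left_filter; exact: cF.
have Fle x y : a <= x -> y <= b -> x <= y -> F x <= F y.
  move=> ax yb; rewrite le_eqVlt => /predU1P[->//|xy].
  by apply: ltW; exact: Finc.
apply: (@measure_unique _ R _ (@RGenOInfty.G R) (fun k => `]- k%:R, +oo[%classic)).
- exact: RGenOInfty.measurableE.
- move=> _ _ [x ->] [y ->]; exists (Num.max x y).
  apply/seteqP; split => z /=; rewrite !in_itv/= !andbT gt_max.
    by case=> -> ->.
  by move=> /andP[].
- by move=> k; exists (- k%:R).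
- apply/seteqP; split => // x _.
  exists (Num.truncn `|x|).+1 => //=; rewrite in_itv/= andbT ltrNl.
  by rewrite (le_lt_trans (ler_norm _))// normrN truncnS_gt.
- move=> _ [u ->].
  (* [x0] is the preimage of [u] under [F], moved to [a] or [b] when [u] lies outside the range;
     both masses of the ray will equal [F b - F x0]. *)
  have [x0 x0ab [E1 E2]] : exists2 x0, a <= x0 <= b &
     (forall x, a < x < b -> (u < F x) = (x0 < x)) /\
     (forall y, F a < y < F b -> (u < y) = (F x0 < y)).
    have [uFa|Fau] := leP u (F a).
      exists a; first by rewrite lexx ltW.
      split=> [x /andP[ax xb]|y /andP[ay yb]].
        by rewrite ax (le_lt_trans uFa)// Finc// ltW.
      by rewrite ay (le_lt_trans uFa).
    have [Fbu|uFb] := leP (F b) u.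
      exists b; first by rewrite lexx ltW.
      split=> [x /andP[ax xb]|y /andP[ay yb]].
        by rewrite !ltNge (ltW xb) (le_trans _ Fbu)// Fle// ltW.
      by rewrite !ltNge (ltW yb) (le_trans (ltW yb)).
    have [] := @IVT R F a b u (ltW ab).
    - exact: continuous_subspaceT.
    - by rewrite ge_min le_max (ltW Fau) (ltW uFb) orbT.
    move=> c; rewrite in_itv/= => /andP[ac cb] Fc.
    exists c; first by rewrite ac.
    split=> [x /andP[ax xb]|y _]; last by rewrite Fc.
    rewrite -Fc; have [cx|xc] := ltP c x; first by rewrite Finc// ltW.
    by apply/negbTE; rewrite -leNgt Fle// ltW.
  transitivity ((F b - F x0)%:E)%E.
    have /andP[ax0 x0b] := x0ab.
    rewrite /= /pf_measure_fun/=.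
    transitivity (\int[mu]_x (\1_(`]F x0, F b[%classic : set R) x)%:E)%E.
      apply: eq_integral => x _; rewrite -EFinM /d1/= !indicE -natrM mulnb; congr (_%:R%:E).
      rewrite !mem_setE !in_itv/= andbT.
      congr nat_of_bool; apply/idP/idP => [/andP[ux xab]|/andP[xx0 xb]].
        by rewrite -E2// ux; case/andP: xab.
      have xab : F a < x < F b by rewrite xb (le_lt_trans _ xx0)// Fle.
      by rewrite E2// xx0.
    rewrite integral_indic//= setIT lebesgue_measure_itv/= lte_fin.
    case: ifPn => //; rewrite -leNgt => h'; congr EFin.
    by apply/esym/eqP; rewrite subr_eq0 eq_le h' Fle.
  rewrite -FTC// /pf_measure_fun/= integral_mkcond; apply: eq_integral => x _.
  rewrite patchE /d2/= mulrC indicE -EFinM !mulrA -natrM mulnb.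
  have -> : (F x \in `]u, +oo[%classic) && (x \in `]a, b[%classic) = (x \in `]x0, b[%classic).
    have /andP[ax0 x0b] := x0ab.
    rewrite !mem_setE !in_itv/= andbT.
    apply/idP/idP => [/andP[ux xab]|/andP[xx0 xb]].
      by rewrite -E1// ux; case/andP: xab.
    have xab : a < x < b by rewrite xb (le_lt_trans _ xx0).
    by rewrite E1// xx0.
  by case: ifPn => _; rewrite ?mul1r ?mul0r.
- move=> k; rewrite /= /pf_measure_fun/=.
  apply: (@le_lt_trans _ _ (\int[mu]_x (\1_(`]F a, F b[%classic : set R) x)%:E)%E).
    apply: ge0_le_integral => //.
    + move=> x _; rewrite -EFinM lee_fin mulr_ge0//.
    + apply: emeasurable_funM; apply/measurable_EFinP; exact: measurable_indic.
    + apply/measurable_EFinP; exact: measurable_indic.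
    + move=> x _; rewrite /d1/= -EFinM lee_fin ler_piMl//.
  rewrite integral_indic//= setIT lebesgue_measure_itv/=.
  by case: ifP => _; rewrite -?EFinB ltry.
- exact: mA.
Qed.

End calculus.

(** * The law of eigenvalues and weights *)

Lemma measurable_prod_cond (R : realType) d (T : measurableType d) (I : Type)
    (s : seq I) (Q : pred I) (h : I -> T -> R) :
  (forall i, measurable_fun setT (h i)) ->
  measurable_fun setT (fun x => \prod_(i <- s | Q i) h i x).
Proof.
move=> mh; elim: s => [|i s IH].
  rewrite (_ : (fun x => _) = cst 1)//.
  by apply/funext => x; rewrite big_nil.
under eq_fun do rewrite big_cons.
by case: (Q i) => //; exact: measurable_funM.
Qed.

Section densities.
Context (R : realType).
Implicit Types (beta a b c : R) (n m : nat).

(** [iint] evaluates functions of lists while the sigma-algebra lives on tuples; [tup] passes from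
    the former to the latter, padding with 0. *)
Definition tup n (s : seq R) : n.-tuple R := [tuple s`_i | i < n].

Lemma measurable_at_tup n m : measurable_fun setT (fun t : m.-tuple R => tup n t).
Proof.
apply/measurable_fun_tnthP => i.
rewrite (_ : _ \o _ = fun t : m.-tuple R => t`_i); first exact: measurable_nth.
by apply/funext => t /=; rewrite tnth_mktuple.
Qed.

Lemma tup_take n m (t : (n + m).-tuple R) : tup n t = take n t :> seq R.
Proof.
apply: (@eq_from_nth _ 0).
  by rewrite size_tuple size_takel// size_tuple leq_addr.
move=> i; rewrite size_tuple => i_n.
by rewrite -[i]/(val (Ordinal i_n)) -tnth_nth tnth_mktuple nth_take.
Qed.

Lemma tup_drop n m (t : (n + m).-tuple R) :
  [tuple t`_(n + i) | i < m] = drop n t :> seq R.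
Proof.
apply: (@eq_from_nth _ 0).
  by rewrite size_tuple size_drop size_tuple addKn.
move=> i; rewrite size_tuple => i_m.
by rewrite -[i]/(val (Ordinal i_m)) -tnth_nth tnth_mktuple nth_drop.
Qed.

Lemma measurable_take d (Y : measurableType d) n m (F : seq R -> Y) :
  measurable_fun setT (fun t : n.-tuple R => F t) ->
  measurable_fun setT (fun t : (n + m).-tuple R => F (take n t)).
Proof.
move=> mF.
rewrite (_ : (fun t => _) = (fun t : n.-tuple R => F t) \o
    (fun t : (n + m).-tuple R => tup n t)).
  by apply: measurableT_comp => //; exact: measurable_at_tup.
by apply/funext => t /=; rewrite tup_take.
Qed.

Lemma measurable_drop d (Y : measurableType d) n m (F : seq R -> Y) :
  measurable_fun setT (fun t : m.-tuple R => F t) ->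
  measurable_fun setT (fun t : (n + m).-tuple R => F (drop n t)).
Proof.
move=> mF.
rewrite (_ : (fun t => _) = (fun t : m.-tuple R => F t) \o
    (fun t : (n + m).-tuple R => [tuple t`_(n + i) | i < m])).
  apply: measurableT_comp => //; apply/measurable_fun_tnthP => i.
  rewrite (_ : _ \o _ = fun t : (n + m).-tuple R => t`_(n + i)).
    exact: measurable_nth.
  by apply/funext => t /=; rewrite tnth_mktuple.
by apply/funext => t /=; rewrite tup_drop.
Qed.

Lemma jac_densE n beta a b (s : seq R) : size s = n ->
  jac_dens beta a b s =
  (\prod_(i < n) \prod_(j < n | (i < j)%N) (`|s`_i - s`_j| `^ beta)) *
  (\prod_(i < n) (s`_i `^ (a - (beta / 2 * (n.-1)%:R + 1)) *
     (1 - s`_i) `^ (b - (beta / 2 * (n.-1)%:R + 1)) *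
     \1_[set x : R | 0 < x < 1] s`_i)).
Proof. by move=> <-. Qed.

Lemma jac_dens_ge0 beta a b (s : seq R) : 0 <= jac_dens beta a b s.
Proof.
apply: mulr_ge0; apply: prodr_ge0 => i _.
  by apply: prodr_ge0 => j _; exact: powR_ge0.
by rewrite !mulr_ge0 ?powR_ge0.
Qed.

Lemma measurable_jac_dens n beta a b :
  measurable_fun setT (fun t : n.-tuple R => jac_dens beta a b t).
Proof.
under eq_fun => t do rewrite (jac_densE beta a b (size_tuple t)).
apply: measurable_funM.
  apply: measurable_prod => i _; apply: measurable_prod_cond => j.
  apply: (measurableT_comp (measurable_powR _)); apply: measurableT_comp => //.
  by apply: measurable_funB; exact: measurable_nth.
apply: measurable_prod => i _; apply: measurable_funM; first apply: measurable_funM.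
- by apply: (measurableT_comp (measurable_powR _)); exact: measurable_nth.
- apply: (measurableT_comp (measurable_powR _)).
  by apply: measurable_funB => //; exact: measurable_nth.
- apply: measurableT_comp; last exact: measurable_nth.
  apply: measurable_indic.
  rewrite (_ : [set x : R | _] = `]0, 1[%classic); first exact: measurable_itv.
  by apply/seteqP; split => x /=; rewrite in_itv.
Qed.

(** Splitting the indicator of the simplex into indicators of half-lines makes measurability visible
    factor by factor. *)
Lemma dir_densE m c (u : seq R) : size u = m ->
  dir_dens c u = (\prod_(i < m) (u`_i `^ (c - 1))) *
  ((1 - \sum_(i < m) u`_i) `^ (c - 1)) *
  ((\prod_(i < m) \1_(`]0, +oo[%classic : set R) u`_i) *
   \1_(`]-oo, 1[%classic : set R) (\sum_(i < m) u`_i)).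
Proof.
move=> <-; rewrite /dir_dens; congr (_ * _).
rewrite [LHS]indicE; case: (boolP (u \in _)).
  rewrite inE/= => -[u0 u1].
  rewrite big1 ?mul1r; last first.
    by move=> i _; rewrite indicE mem_setE in_itv/= u0.
  by rewrite indicE mem_setE in_itv/= u1.
rewrite notin_setE/=.
have [u1 /not_andP[|//]|u1 _] := ltP (\sum_(i < size u) u`_i) 1; last first.
  by rewrite [X in _ * X]indicE mem_setE in_itv/= ltNge u1/= mulr0.
move=> /existsNP[i /negP ui].
by rewrite (bigD1 i)//= indicE mem_setE in_itv/= andbT (negbTE ui) !mul0r.
Qed.

Lemma dir_dens_ge0 c (u : seq R) : 0 <= dir_dens c u.
Proof.
rewrite /dir_dens !mulr_ge0 ?powR_ge0//.
by apply: prodr_ge0 => i _; exact: powR_ge0.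
Qed.

Lemma measurable_dir_dens m c :
  measurable_fun setT (fun t : m.-tuple R => dir_dens c t).
Proof.
under eq_fun => t do rewrite (dir_densE c (size_tuple t)).
have ms : measurable_fun setT (fun t : m.-tuple R => \sum_(i < m) t`_i).
  by apply: measurable_sum => i; exact: measurable_nth.
apply: measurable_funM; first apply: measurable_funM.
- apply: measurable_prod => i _.
  by apply: (measurableT_comp (measurable_powR _)); exact: measurable_nth.
- apply: (measurableT_comp (measurable_powR _)).
  exact: measurable_funB.
- apply: measurable_funM; last first.
    by apply: measurableT_comp => //; exact: measurable_indic.
  apply: measurable_prod => i _; apply: measurableT_comp; last exact: measurable_nth.
  exact: measurable_indic.
Qed.

Lemma measurable_dir_ext n (i : 'I_n) :
  measurable_fun setT (fun t : n.-1.-tuple R => dir_ext t i).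
Proof.
have [h|h] := boolP (i < n.-1)%N.
  rewrite (_ : (fun t => _) = fun t : n.-1.-tuple R => t`_i).
    exact: measurable_nth.
  by apply/funext => t; rewrite /dir_ext h.
rewrite (_ : (fun t => _) = fun t : n.-1.-tuple R => 1 - \sum_(k < n.-1) t`_k).
  2: by apply/funext => t; rewrite /dir_ext (negbTE h).
by apply: measurable_funB => //; apply: measurable_sum => j; exact: measurable_nth.
Qed.

Definition dir_tup n (u : seq R) : n.-tuple R := [tuple dir_ext u i | i < n].

Lemma measurable_dir_tup n : measurable_fun setT (fun t : n.-1.-tuple R => dir_tup n t).
Proof.
apply/measurable_fun_tnthP => i.
rewrite (_ : _ \o _ = fun t : n.-1.-tuple R => dir_ext t i).
  exact: measurable_dir_ext.
by apply/funext => t /=; rewrite tnth_mktuple.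
Qed.

Lemma indic_rect n (A : 'I_n -> set R) (x : seq R -> 'I_n -> R) s :
  \1_[set s | forall i, A i (x s i)] s = \prod_(i < n) \1_(A i) (x s i) :> R.
Proof.
rewrite indicE; case: (boolP (s \in _)).
  by rewrite inE/= => H; rewrite big1// => i _; rewrite indicE mem_set.
rewrite notin_setE/= => /existsNP[i /= Ai].
by rewrite (bigD1 i)//= indicE memNset// mul0r.
Qed.

Lemma jac_dens_out beta a b (s : seq R) (x : R) :
  x \in s -> ~~ (0 < x < 1) -> jac_dens beta a b s = 0.
Proof.
move=> xs x01; rewrite /jac_dens; apply/eqP; rewrite mulf_eq0; apply/orP; right.
have ix : (index x s < size s)%N by rewrite index_mem.
rewrite (bigD1 (Ordinal ix))//= nth_index//.
have -> : \1_[set x : R | 0 < x < 1] x = 0 :> R by rewrite indicE memNset//; apply/negP.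
by rewrite mulr0 mul0r.
Qed.

Lemma dir_dens_out m c (u : seq R) : size u = m ->
  ~ ((forall i : 'I_m, 0 < u`_i) /\ \sum_(i < m) u`_i < 1) -> dir_dens c u = 0.
Proof. by move=> <- h; rewrite /dir_dens indicE memNset// mulr0. Qed.

End densities.

Section law.
Local Open Scope ereal_scope.
Context (R : realType) (d : measure_display) (T : measurableType d).
Variables (P : probability T R) (n : nat) (lam w : T -> 'I_n -> R).
Variables (beta a b c : R).
Hypothesis mlam : forall i, measurable_fun setT (fun t => lam t i).
Hypothesis mw : forall i, measurable_fun setT (fun t => w t i).
Hypothesis rect : forall A B : 'I_n -> set R,
  (forall i, measurable (A i)) -> (forall i, measurable (B i)) ->
  P [set t | forall i : 'I_n, A i (lam t i) /\ B i (w t i)] =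
  jac_prob beta a b A * dir_prob c B.

Let Z1 := iint n (fun s => (jac_dens beta a b s)%:E).
Let Z2 := iint n.-1 (fun s => (dir_dens c s)%:E).

(** The conventions [fine +oo = 0] and [0^-1 = 0] turn both degenerate values of [x] into total mass
    0, which contradicts mass 1. Integrability of the densities is thus read off from the assumed
    law instead of being computed. *)
Let Zpos (x y : \bar R) : 0 <= x ->
  1 = (x * ((fine x)^-1)%:E) * y -> exists2 z : R, (0 < z)%R & x = z%:E.
Proof.
case: x => [z| |]//.
- rewrite lee_fin le_eqVlt => /predU1P[<-|z0 _]; last by exists z.
  by rewrite /= mul0e mul0e => /eqP; rewrite onee_eq0.
- by move=> _ /eqP; rewrite /= invr0 mule0 mul0e onee_eq0.
Qed.

Let rectT : 1 = (Z1 * ((fine Z1)^-1)%:E) * (Z2 * ((fine Z2)^-1)%:E).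
Proof.
have := @rect (fun=> setT) (fun=> setT) (fun=> measurableT) (fun=> measurableT).
rewrite (_ : [set t | _] = setT); last by apply/seteqP; split.
rewrite probability_setT => ->; rewrite /jac_prob /dir_prob.
by congr (_ * _ * (_ * _)); apply: eq_iint => s _;
  rewrite indicE mem_set ?mulr1.
Qed.

Lemma jac_norm : exists2 z : R, (0 < z)%R &
  iint n (fun s => (jac_dens beta a b s)%:E) = z%:E.
Proof.
apply: Zpos rectT; apply: iint_ge0 => s; rewrite lee_fin.
exact: jac_dens_ge0.
Qed.

Lemma dir_norm : exists2 z : R, (0 < z)%R &
  iint n.-1 (fun s => (dir_dens c s)%:E) = z%:E.
Proof.
move: rectT; rewrite muleC; apply: Zpos; apply: iint_ge0 => s; rewrite lee_fin.
exact: dir_dens_ge0.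
Qed.

Let X : measurableType _ := (n.-tuple R * n.-tuple R)%type.
Let k : R := ((fine Z1)^-1 * (fine Z2)^-1)%R.
(** The first [n] entries are the eigenvalues, the other [n.-1] the free weights; [dir_tup] restores
    the last weight as the missing mass. *)
Let phi (v : seq R) : X := (tup n (take n v), dir_tup n (drop n v)).
Let h (v : seq R) : R :=
  (k * (jac_dens beta a b (take n v) * dir_dens c (drop n v)))%R.

Let k0 : (0 <= k)%R.
Proof.
by rewrite /k mulr_ge0// invr_ge0 fine_ge0//; apply: iint_ge0 => s;
  rewrite lee_fin ?jac_dens_ge0 ?dir_dens_ge0.
Qed.

Let h0 v : (0 <= h v)%R.
Proof. by rewrite /h mulr_ge0// mulr_ge0 ?jac_dens_ge0 ?dir_dens_ge0. Qed.

Let mphi : measurable_fun setT (fun t : (n + n.-1).-tuple R => phi t).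
Proof.
apply: measurable_fun_pair.
  by apply: (measurable_take (F := tup n)); exact: measurable_at_tup.
by apply: (measurable_drop (F := dir_tup n)); exact: measurable_dir_tup.
Qed.

Let mh : measurable_fun setT (fun t : (n + n.-1).-tuple R => h t).
Proof.
apply: measurable_funM => //; apply: measurable_funM.
  by apply: (measurable_take (F := jac_dens beta a b)); exact: measurable_jac_dens.
by apply: (measurable_drop (F := dir_dens c)); exact: measurable_dir_dens.
Qed.

Let pL := pos_functional_iint mphi h0 mh.

Let LE (f : X -> \bar R) : (forall x, 0 <= f x) -> measurable_fun setT f ->
  iint (n + n.-1) (fun v => f (phi v) * (h v)%:E) =
  k%:E * iint n (fun s => iint n.-1 (fun u =>
    f (tup n s, dir_tup n u) * (jac_dens beta a b s * dir_dens c u)%:E)).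
Proof.
move=> f0 mf; rewrite iint_cat -iintZl//; first last.
- apply: emeasurable_funM; first exact: measurableT_comp.
  apply/measurable_EFinP; apply: measurable_funM.
    by apply: (measurable_take (F := jac_dens beta a b)); exact: measurable_jac_dens.
  by apply: (measurable_drop (F := dir_dens c)); exact: measurable_dir_dens.
- by move=> s; rewrite mule_ge0// lee_fin mulr_ge0 ?jac_dens_ge0 ?dir_dens_ge0.
by apply: eq_iint => v _; rewrite /h [in LHS]EFinM muleCA.
Qed.

Definition rv_pair t : n.-tuple R * n.-tuple R :=
  ([tuple lam t i | i < n], [tuple w t i | i < n]).

Lemma measurable_rv_pair : measurable_fun setT rv_pair.
Proof.
apply: measurable_fun_pair; apply/measurable_fun_tnthP => i.
  rewrite (_ : _ \o _ = lam ^~ i)//.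
  by apply/funext => t /=; rewrite tnth_mktuple.
rewrite (_ : _ \o _ = w ^~ i)//.
by apply/funext => t /=; rewrite tnth_mktuple.
Qed.

Let G : set (set X) := [set C | exists A B : 'I_n -> set R,
  [/\ forall i, measurable (A i), forall i, measurable (B i) &
   C = [set x | forall i, A i (tnth x.1 i) /\ B i (tnth x.2 i)]]].

Let mG C : G C -> measurable C.
Proof.
move=> [A [B [mA mB ->]]].
rewrite (_ : [set x | _] = \bigcap_(i in setT)
   ([set x : X | A i (tnth x.1 i)] `&` [set x : X | B i (tnth x.2 i)])); last first.
  by apply/seteqP; split=> [x /= H i _|x /= H i]; have := H i => //=; apply.
apply: fin_bigcap_measurable => // i _; apply: measurableI.
  have m : measurable_fun setT (fun x : X => tnth x.1 i).
    apply: (measurableT_comp (f := fun y : n.-tuple R => tnth y i)) => //.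
    exact: measurable_tnth.
  by have := m measurableT (A i) (mA i); rewrite setTI.
have m : measurable_fun setT (fun x : X => tnth x.2 i).
  apply: (measurableT_comp (f := fun y : n.-tuple R => tnth y i)) => //.
  exact: measurable_tnth.
by have := m measurableT (B i) (mB i); rewrite setTI.
Qed.

(** A coordinate projection pulls a measurable set back to a rectangle with a single constrained
    side, so both tuple projections are measurable for the sigma-algebra generated by rectangles. *)
Let genG : @measurable _ X = <<s G >>.
Proof.
apply/seteqP; split; last first.
  apply: smallest_sub; last exact: mG.
  exact: sigma_algebra_measurable.
have m1 : @measurable_fun _ _ (g_sigma_algebraType G) (n.-tuple R) setT
    (fun x : X => x.1).
  apply/measurable_fun_tnthP => i _ A mA; apply: sub_sigma_algebra.
  exists (fun j => if j == i then A else setT), (fun=> setT); split => //.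
    by move=> j; case: ifP.
  apply/seteqP; split=> x /=.
    by move=> [_ Ax] j; split => //; case: eqP => [->|].
  by move=> /(_ i)[]; rewrite eqxx.
have m2 : @measurable_fun _ _ (g_sigma_algebraType G) (n.-tuple R) setT
    (fun x : X => x.2).
  apply/measurable_fun_tnthP => i _ A mA; apply: sub_sigma_algebra.
  exists (fun=> setT), (fun j => if j == i then A else setT); split => //.
    by move=> j; case: ifP.
  apply/seteqP; split=> x /=.
    by move=> [_ Ax] j; split => //; case: eqP => [->|].
  by move=> /(_ i)[]; rewrite eqxx.
have m : @measurable_fun _ _ (g_sigma_algebraType G) X setT
    (fun x : X => (x.1, x.2)) by apply: measurable_fun_pair.
move=> C mC; have := m measurableT C mC; rewrite setTI.
rewrite (_ : _ @^-1` C = C)//.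
by apply/seteqP; split => -[x1 x2].
Qed.

(** Rectangles are stable under intersection and generate, so equality of the two measures on them
    extends from probabilities to all nonnegative expectations. *)
Lemma law_integral (f : n.-tuple R * n.-tuple R -> \bar R) :
  (forall x, 0 <= f x) -> measurable_fun setT f ->
  \int[P]_t f (rv_pair t) =
  k%:E * iint n (fun s => iint n.-1 (fun u =>
    f (tup n s, dir_tup n u) * (jac_dens beta a b s * dir_dens c u)%:E)).
Proof.
move=> f0 mf; rewrite -LE// -(pf_integral pL)//.
rewrite -(@ge0_integral_pushforward _ _ _ _ _ rv_pair measurable_rv_pair P setT f)//.
apply: eq_measure_integral; first exact: measurable_rv_pair.
move=> mrv C mC _; apply: (@measure_unique _ R _ G (fun=> setT)) => //.
- move=> C1 C2 [A1 [B1 [mA1 mB1 ->]]] [A2 [B2 [mA2 mB2 ->]]].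
  exists (fun i => A1 i `&` A2 i), (fun i => B1 i `&` B2 i); split.
  + by move=> i; exact: measurableI.
  + by move=> i; exact: measurableI.
  apply/seteqP; split => x /=.
    by move=> [H1 H2] i; have [? ?] := H1 i; have [? ?] := H2 i.
  by move=> H; split => i; have [[? ?] [? ?]] := H i.
- move=> _; exists (fun=> setT), (fun=> setT); split => //.
  by apply/seteqP; split.
- by apply/seteqP; split => // x _; exists 0%N.
- move=> C' [A [B [mA mB ->]]].
  rewrite /= /pushforward/= (_ : rv_pair @^-1` _ =
      [set t | forall i, A i (lam t i) /\ B i (w t i)]); last first.
    by apply/seteqP; split => t /= H i; have := H i; rewrite !tnth_mktuple.
  rewrite rect// /pf_measure_fun LE; last 2 first.
  + by move=> x; rewrite lee_fin.
  + by apply/measurable_EFinP; apply: measurable_indic; apply: mG; exists A, B.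
  have [z1 z10 E1] := jac_norm; have [z2 z20 E2] := dir_norm.
  have mjA : measurable_at n (fun s => (jac_dens beta a b s *
      \1_[set s : seq R | forall i : 'I_n, A i (s`_i)%R] s)%:E).
    apply/measurable_EFinP; apply: measurable_funM; first exact: measurable_jac_dens.
    under eq_fun do rewrite (indic_rect A (fun s i => s`_i)%R).
    apply: measurable_prod => i _; apply: measurableT_comp; last exact: measurable_nth.
    exact: measurable_indic.
  have mdB : measurable_at n.-1 (fun s => (dir_dens c s *
      \1_[set v : seq R | forall i : 'I_n, B i (dir_ext v i)] s)%:E).
    apply/measurable_EFinP; apply: measurable_funM; first exact: measurable_dir_dens.
    under eq_fun do rewrite (indic_rect B (fun s i => dir_ext s i)).
    apply: measurable_prod => i _; apply: measurableT_comp; last exact: measurable_dir_ext.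
    exact: measurable_indic.
  have JB : iint n.-1 (fun s => (dir_dens c s *
      \1_[set v : seq R | forall i : 'I_n, B i (dir_ext v i)] s)%:E) \is a fin_num.
    rewrite ge0_fin_numE; last first.
      by apply: iint_ge0 => s; rewrite lee_fin mulr_ge0// dir_dens_ge0.
    apply: (@le_lt_trans _ _ z2%:E); last exact: ltry.
    rewrite -E2; apply: iint_le => //.
    + by move=> s; rewrite lee_fin mulr_ge0// dir_dens_ge0.
    + move=> s _; rewrite lee_fin ler_piMr ?dir_dens_ge0//.
    + by move=> s; rewrite lee_fin dir_dens_ge0.
    + by apply/measurable_EFinP; exact: measurable_dir_dens.
  rewrite /jac_prob /dir_prob -/Z1 -/Z2.
  set J := iint n.-1 _ in JB *.
  (* The indicator of a rectangle separates the variables, so the weight integral [J], a finite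
     scalar by [JB], leaves the outer integral. *)
  rewrite (_ : iint n (fun s : seq R => iint n.-1 (fun u => _)) = J * iint n (fun s => (jac_dens beta a b s *
      \1_[set s : seq R | forall i : 'I_n, A i (s`_i)%R] s)%:E)); last first.
    rewrite -(fineK JB) -iintZl//; last 2 first.
    + by rewrite fine_ge0//; apply: iint_ge0 => s; rewrite lee_fin mulr_ge0// dir_dens_ge0.
    + by move=> s; rewrite lee_fin mulr_ge0// jac_dens_ge0.
    apply: eq_iint => s _; rewrite (fineK JB) muleC /J -iintZl//; last 2 first.
    + by rewrite mulr_ge0// jac_dens_ge0.
    + by move=> u; rewrite lee_fin mulr_ge0// dir_dens_ge0.
    apply: eq_iint => u _; rewrite -!EFinM; congr EFin.
    rewrite (_ : \1_[set x | _] (tup n s, dir_tup n u) =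
       \1_[set s : seq R | forall i : 'I_n, A i (s`_i)%R] s *
       \1_[set v : seq R | forall i : 'I_n, B i (dir_ext v i)] u)%R.
      by ring.
    rewrite !indicE -natrM mulnb; congr (_%:R); congr nat_of_bool.
    apply/idP/andP.
      rewrite inE/= => H; split; rewrite inE/= => i.
        by have [] := H i; rewrite !tnth_mktuple.
      by have [] := H i; rewrite !tnth_mktuple.
    by case; rewrite !inE/= => HA HB i; rewrite !tnth_mktuple.
  by rewrite muleACA muleC [in RHS](muleC J) /k EFinM.
- by move=> _; rewrite /= /pushforward/= preimage_setT probability_setT ltry.
Qed.

(** Plays the part of conditioning on the eigenvalues: a bound for the Dirichlet average at frozen
    [s] is integrated against the Jacobi density. Only [s] in the open cube matters, the density
    being 0 elsewhere. *)
Lemma law_le (g : n.-tuple R * n.-tuple R -> R) (B : n.-tuple R -> R) :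
  (forall x, 0 <= g x)%R -> (forall x, 0 <= B x)%R ->
  measurable_fun setT g -> measurable_fun setT B ->
  (forall s : n.-tuple R, (forall i, 0 < tnth s i < 1)%R ->
    iint n.-1 (fun u => (g (s, dir_tup n u) * dir_dens c u)%:E) <=
    (B s)%:E * iint n.-1 (fun u => (dir_dens c u)%:E)) ->
  \int[P]_t (g (rv_pair t))%:E <= \int[P]_t (B (rv_pair t).1)%:E.
Proof.
move=> g0 B0 mg mB gB.
rewrite (law_integral (f := EFin \o g))//=; last exact/measurable_EFinP.
rewrite (law_integral (f := fun x => (B x.1)%:E))//=; last 2 first.
- by move=> x; rewrite lee_fin.
- by apply/measurable_EFinP; exact: measurableT_comp.
apply: lee_wpmul2l; first by rewrite lee_fin.
have mgd (s : n.-tuple R) : measurable_at n.-1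
    (fun u => (g (s, dir_tup n u) * dir_dens c u)%:E).
  apply/measurable_EFinP; apply: measurable_funM; last exact: measurable_dir_dens.
  apply: measurableT_comp => //; apply: measurable_fun_pair => //.
  exact: measurable_dir_tup.
have mm (f : X -> R) : measurable_fun setT f -> (forall x, 0 <= f x)%R ->
  measurable_at n (fun s => iint n.-1 (fun u =>
   (f (tup n s, dir_tup n u))%:E * (jac_dens beta a b s * dir_dens c u)%:E)).
  move=> mf f0; apply: (iint_measurable (X := n.-tuple R)
    (F := fun s u => (f (tup n s, dir_tup n u))%:E * (jac_dens beta a b s * dir_dens c u)%:E)).
    by move=> s u; rewrite mule_ge0// lee_fin// mulr_ge0 ?jac_dens_ge0 ?dir_dens_ge0.
  apply: emeasurable_funM; apply/measurable_EFinP.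
    apply: measurableT_comp => //; apply: measurable_fun_pair.
      by apply: (measurableT_comp (f := fun s : n.-tuple R => tup n s)) => //;
        exact: measurable_at_tup.
    by apply: (measurableT_comp (f := fun u : n.-1.-tuple R => dir_tup n u)) => //;
      exact: measurable_dir_tup.
  apply: measurable_funM.
    by apply: (measurableT_comp (f := fun s : n.-tuple R => jac_dens beta a b s)) => //;
      exact: measurable_jac_dens.
  by apply: (measurableT_comp (f := fun u : n.-1.-tuple R => dir_dens c u)) => //;
    exact: measurable_dir_dens.
have ge0 (f : X -> R) s : (forall x, 0 <= f x)%R -> 0 <= iint n.-1 (fun u =>
   (f (tup n s, dir_tup n u))%:E * (jac_dens beta a b s * dir_dens c u)%:E).
  move=> f0; apply: iint_ge0 => u.
  by rewrite mule_ge0// lee_fin// mulr_ge0 ?jac_dens_ge0 ?dir_dens_ge0.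
apply: iint_le.
- by move=> s; exact: ge0.
- move=> s sn.
  have [s01|] := pselect (forall i, 0 < tnth (tup n s) i < 1)%R; last first.
    move=> /existsNP[i]; rewrite tnth_mktuple => /negP si.
    have js : jac_dens beta a b s = 0%R.
      by apply: jac_dens_out si; rewrite mem_nth// sn.
    rewrite le_eqVlt; apply/orP; left; apply/eqP; apply: eq_iint => u _.
    by rewrite js !mul0r !mule0.
  have E1 : iint n.-1 (fun u => (g (tup n s, dir_tup n u))%:E *
      (jac_dens beta a b s * dir_dens c u)%:E) = (jac_dens beta a b s)%:E *
      iint n.-1 (fun u => (g (tup n s, dir_tup n u) * dir_dens c u)%:E).
    rewrite -iintZl; [|exact: jac_dens_ge0| |exact: mgd].
      by apply: eq_iint => u _; rewrite -!EFinM; congr EFin; ring.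
    by move=> u; rewrite lee_fin mulr_ge0 ?dir_dens_ge0.
  have E2 : iint n.-1 (fun u => (B (tup n s))%:E *
      (jac_dens beta a b s * dir_dens c u)%:E) = (jac_dens beta a b s)%:E *
      ((B (tup n s))%:E * iint n.-1 (fun u => (dir_dens c u)%:E)).
    rewrite muleA -EFinM -iintZl.
    + by apply: eq_iint => u _; rewrite -!EFinM; congr EFin; ring.
    + by rewrite mulr_ge0 ?jac_dens_ge0.
    + by move=> u; rewrite lee_fin dir_dens_ge0.
    + by apply/measurable_EFinP; exact: measurable_dir_dens.
  rewrite E1 E2; apply: lee_wpmul2l; last exact: gB.
  by rewrite lee_fin jac_dens_ge0.
- by move=> s; apply: (ge0 (fun x => B x.1)).
- exact: mm.
- by apply: (mm (fun x => B x.1)) => //; exact: measurableT_comp.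
Qed.

(** The Dirichlet integral factors out and cancels its own normalising constant. *)
Lemma law_lam (f : n.-tuple R -> R) : (forall x, 0 <= f x)%R ->
  measurable_fun setT f ->
  \int[P]_t (f (rv_pair t).1)%:E = ((fine Z1)^-1)%:E *
  iint n (fun s => (f (tup n s) * jac_dens beta a b s)%:E).
Proof.
move=> f0 mf; rewrite (law_integral (f := fun x => (f x.1)%:E))//=; last 2 first.
- by move=> x; rewrite lee_fin.
- by apply/measurable_EFinP; exact: measurableT_comp.
have [z2 z20 E2] := dir_norm.
have mfj : measurable_at n (fun s => (f (tup n s) * jac_dens beta a b s)%:E).
  apply/measurable_EFinP; apply: measurable_funM; last exact: measurable_jac_dens.
  by apply: measurableT_comp => //; exact: measurable_at_tup.
rewrite (_ : iint n (fun s : seq R => iint n.-1 (fun u => _)) = z2%:E *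
  iint n (fun s => (f (tup n s) * jac_dens beta a b s)%:E)); last first.
  rewrite -iintZl ?(ltW z20)//; last first.
    by move=> s; rewrite lee_fin mulr_ge0 ?jac_dens_ge0.
  apply: eq_iint => s _; rewrite -E2 muleC -iintZl.
  + by apply: eq_iint => u _; rewrite -!EFinM; congr EFin; ring.
  + by rewrite mulr_ge0 ?jac_dens_ge0.
  + by move=> u; rewrite lee_fin dir_dens_ge0.
  + by apply/measurable_EFinP; exact: measurable_dir_dens.
rewrite muleA -EFinM /k /Z2 E2 -mulrA mulVf ?mulr1//.
by rewrite gt_eqF.
Qed.

(** The rectangle of admissible values does not cut the densities, so its probability is the total
    mass 1. *)
Lemma support_ae :
  {ae P, forall t, forall i, (0 < lam t i < 1)%R /\ (0 < w t i)%R}.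
Proof.
pose A := fun i : 'I_n => `]0%R, 1%R[%classic : set R.
pose B := fun i : 'I_n => `]0%R, +oo[%classic : set R.
have := @rect A B (fun=> measurable_itv _) (fun=> measurable_itv _).
have -> : jac_prob beta a b A * dir_prob c B = 1.
  rewrite [RHS]rectT /jac_prob /dir_prob.
  congr (_ * _ * (_ * _)); apply: eq_iint => s sn.
    congr EFin; have [H|] := pselect (forall i : 'I_n, A i (s`_i)%R).
      by rewrite indicE mem_set ?mulr1.
    move=> /existsNP[i]; rewrite /A/= in_itv/= => /negP si.
    by rewrite (jac_dens_out beta a b _ si) ?mul0r// mem_nth// sn.
  congr EFin.
  have [[u0 u1]|] := pselect ((forall i : 'I_n.-1, 0 < s`_i)%R /\ (\sum_(i < n.-1) s`_i < 1)%R); last first.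
    by move=> H; rewrite (dir_dens_out c sn H) mul0r.
  rewrite indicE mem_set ?mulr1// => i /=; rewrite /B/= in_itv/= andbT /dir_ext.
  case: ifPn => [ii|_]; last by rewrite subr_gt0.
  exact: (u0 (Ordinal ii)).
have mC : measurable [set t | forall i, A i (lam t i) /\ B i (w t i)].
  have := measurable_rv_pair measurableT (mG (C := [set x : X | forall i, A i (tnth x.1 i) /\ B i (tnth x.2 i)]) _).
  rewrite setTI (_ : rv_pair @^-1` _ =
      [set t | forall i, A i (lam t i) /\ B i (w t i)]); last first.
    by apply/seteqP; split => t /= H i; have := H i; rewrite !tnth_mktuple.
  apply; exists A, B; split => //; move=> i; exact: measurable_itv.
move=> P1; exists (~` [set t | forall i, A i (lam t i) /\ B i (w t i)]); split.
- exact: measurableC.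
- by rewrite probability_setC// P1 subee.
- move=> t /= H1 H2; apply: H1 => i.
  by have [] := H2 i; rewrite /A /B/= !in_itv/= andbT.
Qed.

End law.

(** * Second order expansions *)

Section taylor.
Context (R : realType).

(** One integration of a remainder by the mean value theorem, giving up the factor [1 / (m + 1)].
    The radius 1/2 keeps [1 + y] away from 0 in the application. *)
Lemma mvt_bound (f df : R -> R) (A : R) (m : nat) (y : R) :
  (forall x, `|x| <= 2^-1 -> is_derive x (1 : R) f (df x)) ->
  f 0 = 0 -> (forall x, `|x| <= 2^-1 -> `|df x| <= A * `|x| ^+ m) ->
  `|y| <= 2^-1 -> `|f y| <= A * `|y| ^+ m.+1.
Proof.
move=> Df f0 dfA y12.
have A0 : 0 <= A * `|y| ^+ m by apply: le_trans (dfA _ y12).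
have cf x : `|x| <= 2^-1 -> {for x, continuous f}.
  move=> x12; apply/differentiable_continuous/derivable1_diffP.
  by have := Df x x12; case.
have key z : `|z| <= `|y| -> `|df z * y| <= A * `|y| ^+ m.+1.
  move=> zy; rewrite normrM exprSr mulrA ler_wpM2r//.
  apply: le_trans (dfA z (le_trans zy y12)) _.
  have [y0|y0] := eqVneq y 0.
    by move: zy; rewrite y0 normr0 normr_le0 => /eqP ->; rewrite normr0.
  have An : 0 <= A by move: A0; rewrite pmulr_lge0// exprn_gt0// normr_gt0.
  by rewrite ler_wpM2l// lerXn2r// nnegrE.
have [y0|y0|->] := ltgtP y 0; last by rewrite f0 normr0 expr0n mulr0.
- have [] := @MVT R f df y 0 y0.
  + move=> x; rewrite in_itv/= => /andP[yx x0]; apply: Df.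
    by rewrite (le_trans _ y12)// !ltr0_norm// lerN2 ltW.
  + apply: continuous_in_subspaceT => x; rewrite inE/= in_itv/= => /andP[yx x0].
    by apply: cf; rewrite (le_trans _ y12)// ler0_norm// ltr0_norm// lerN2.
  move=> z; rewrite in_itv/= => /andP[yz z0]; rewrite f0 !sub0r mulrN.
  move=> /oppr_inj ->; apply: key; by rewrite !ltr0_norm// lerN2 ltW.
- have [] := @MVT R f df 0 y y0.
  + move=> x; rewrite in_itv/= => /andP[x0 xy]; apply: Df.
    by rewrite (le_trans _ y12)// !gtr0_norm// ltW.
  + apply: continuous_in_subspaceT => x; rewrite inE/= in_itv/= => /andP[x0 xy].
    by apply: cf; rewrite (le_trans _ y12)// ger0_norm// gtr0_norm.
  move=> z; rewrite in_itv/= => /andP[z0 zy]; rewrite f0 !subr0.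
  by move=> ->; apply: key; rewrite !gtr0_norm// ltW.
Qed.

Lemma is_derive_powR1p (c y : R) : -1 < y ->
  is_derive y (1 : R) (fun x => (1 + x) `^ c) (c * (1 + y) `^ (c - 1)).
Proof.
move=> y1; have y0 : 0 < 1 + y by rewrite addrC -ltrBlDr sub0r.
have d1 : is_derive (1 + y) (1 : R) (fun x : R => x `^ c) (c * (1 + y) `^ (c - 1)).
  apply: DeriveDef; first by apply: derivable_powR; rewrite in_itv/= andbT.
  by rewrite -derive1E powR_derive1// in_itv/= andbT.
have d2 : is_derive y (1 : R) (fun x : R => 1 + x) (0 + 1) by apply: is_deriveD.
have := is_derive1_comp d1 d2.
by rewrite add0r mulr1.
Qed.

Lemma is_derive_mull (k x : R) : is_derive x (1 : R) (fun y : R => k * y) k.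
Proof.
have h : is_derive x (1 : R) (k *: (@id R)) (k *: (1 : R)) by apply: is_deriveZ.
by move: h; rewrite {2}/GRing.scale/= mulr1.
Qed.

Lemma is_derive_monom (k x : R) (n : nat) :
  is_derive x (1 : R) (fun y : R => k * y ^+ n.+1) (k * (n.+1%:R * x ^+ n)).
Proof.
have h : is_derive x (1 : R) (k *: ((@id R) ^+ n.+1))
    (k *: ((n.+1%:R * x ^+ n) *: (1 : R))) by apply: is_deriveZ.
move: h; rewrite /GRing.scale/= mulr1.
have -> // : (fun y : R => k * y ^+ n.+1) = k \*: (@id R) ^+ n.+1.
by apply/funext => y; rewrite /= exprfctE.
Qed.

Lemma powR_bounded (p : R) : exists2 C : R, 0 <= C &
  forall x : R, 2^-1 <= x <= 3 / 2 -> x `^ p <= C.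
Proof.
exists (`|(3 / 2) `^ p| + `|2^-1 `^ p|); first by rewrite addr_ge0.
move=> x /andP[x1 x2].
have x0 : 0 < x by rewrite (lt_le_trans _ x1).
have [p0|p0] := leP 0 p.
  apply: (@le_trans _ _ ((3 / 2) `^ p)).
    by rewrite ge0_ler_powR// nnegrE ltW// divr_gt0.
  by rewrite ger0_norm ?powR_ge0// lerDl.
apply: (@le_trans _ _ (2^-1 `^ p)); last first.
  by rewrite [X in _ <= _ + X]ger0_norm ?powR_ge0// lerDr.
have E z : z `^ p = (z `^ (- p))^-1 by rewrite -powRN opprK.
rewrite !E lef_pV2 ?posrE ?powR_gt0//.
by rewrite ge0_ler_powR ?nnegrE// ?oppr_ge0 ltW.
Qed.

(** The third derivative is bounded while [1 + y] stays between 1/2 and 3/2; three uses of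
    [mvt_bound] climb back to the function. *)
Lemma powR_taylor2 (c : R) : exists2 C : R, 0 <= C & forall y : R, `|y| <= 2^-1 ->
  `|(1 + y) `^ c - 1 - c * y - c * (c - 1) / 2 * y ^+ 2| <= C * `|y| ^+ 3.
Proof.
have [C0 C00 HC] := powR_bounded (c - 3).
pose C : R := `|c * (c - 1) * (c - 2)| * C0.
exists C; first by rewrite mulr_ge0.
have yN1 (y : R) : `|y| <= 2^-1 -> -1 < y.
  by rewrite ler_norml => /andP[+ _]; apply: lt_le_trans; rewrite ltrN2 invf_lt1// ltr1n.
have D2 (y : R) : `|y| <= 2^-1 ->
    `|c * (c - 1) * ((1 + y) `^ (c - 2) - 1)| <= C * `|y| ^+ 1.
  apply: (@mvt_bound (fun y => c * (c - 1) * ((1 + y) `^ (c - 2) - 1))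
    (fun y => c * (c - 1) * (c - 2) * (1 + y) `^ (c - 3)) C 0).
  - move=> x /yN1 x1.
    have -> : c * (c - 1) * (c - 2) * (1 + x) `^ (c - 3) =
        (c * (c - 1)) *: ((c - 2) * (1 + x) `^ (c - 2 - 1) - 0).
      rewrite /GRing.scale/= subr0 -!mulrA; do 3 congr (_ * _).
      by congr (_ `^ _); ring.
    apply: is_deriveZ; apply: is_deriveB; exact: is_derive_powR1p.
  - by rewrite addr0 powR1 subrr mulr0.
  - move=> x x12; rewrite expr0 mulr1 normrM ler_wpM2l//.
    rewrite ger0_norm ?powR_ge0//; apply: HC.
    by move: x12; rewrite ler_norml => /andP[]; lra.
have D1 (y : R) : `|y| <= 2^-1 ->
    `|c * ((1 + y) `^ (c - 1) - 1 - (c - 1) * y)| <= C * `|y| ^+ 2.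
  apply: (@mvt_bound (fun y => c * ((1 + y) `^ (c - 1) - 1 - (c - 1) * y))
    (fun y => c * (c - 1) * ((1 + y) `^ (c - 2) - 1)) C 1).
  - move=> x /yN1 x1.
    have -> : c * (c - 1) * ((1 + x) `^ (c - 2) - 1) =
        c *: ((c - 1) * (1 + x) `^ (c - 1 - 1) - 0 - (c - 1)).
      rewrite /GRing.scale/= subr0.
      have -> : c - 1 - 1 = c - 2 by ring.
      by ring.
    apply: is_deriveZ; apply: is_deriveB; first apply: is_deriveB.
      exact: is_derive_powR1p.
    exact: is_derive_mull.
  - by rewrite addr0 powR1 mulr0 subrr subr0 mulr0.
  - exact: D2.
move=> y; apply: (@mvt_bound
  (fun y => (1 + y) `^ c - 1 - c * y - c * (c - 1) / 2 * y ^+ 2)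
  (fun y => c * ((1 + y) `^ (c - 1) - 1 - (c - 1) * y)) C 2).
- move=> x /yN1 x1.
  have -> : c * ((1 + x) `^ (c - 1) - 1 - (c - 1) * x) =
      c * (1 + x) `^ (c - 1) - 0 - c -
      (c * (c - 1) / 2) * (2%:R * x ^+ 1) by field.
  apply: is_deriveB; first apply: is_deriveB; first apply: is_deriveB.
  + exact: is_derive_powR1p.
  + exact: is_derive_mull.
  + exact: is_derive_monom.
- by rewrite addr0 powR1 mulr0 subrr subr0 expr0n mulr0 subrr.
- exact: D1.
Qed.

(** The remainder splits into [r y], [s] times the jet of [x], and cross terms of degree 3 and 4 in
    [e]. Their bounds [C (1 + 3 C)], [C (1 + 2 C)], [2 C^2] and [C^2], times [|e|^3], add up to the
    constant. *)
Lemma jetM (C e a g A B x y : R) : 0 <= C -> `|e| <= 1 ->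
  `|a| <= C -> `|g| <= C -> `|A| <= C -> `|B| <= C ->
  `|x - 1 - e * a - e ^+ 2 * g| <= C * `|e| ^+ 3 ->
  `|y - 1 - e * A - e ^+ 2 * B| <= C * `|e| ^+ 3 ->
  `|x * y - 1 - e * (a + A) - e ^+ 2 * (g + B + a * A)| <=
    (2 * C + 8 * C ^+ 2) * `|e| ^+ 3.
Proof.
move=> C0 e1 aC gC AC BC; set r := x - 1 - _ - _; set s := y - 1 - _ - _ => rC sC.
have xE : x = 1 + e * a + e ^+ 2 * g + r by rewrite /r; ring.
have yE : y = 1 + e * A + e ^+ 2 * B + s by rewrite /s; ring.
have -> : x * y - 1 - e * (a + A) - e ^+ 2 * (g + B + a * A) =
  r * y + s * (1 + e * a + e ^+ 2 * g) + e ^+ 3 * (a * B + g * A) + e ^+ 3 * (e * (g * B)).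
  by rewrite yE xE; ring.
have e20 : `|e| ^+ 2 <= 1 by rewrite expr_le1.
have e30 : `|e| ^+ 3 <= 1 by rewrite expr_le1.
have e3 : 0 <= `|e| ^+ 3 by rewrite exprn_ge0.
have le1M (u v : R) : 0 <= u -> u <= 1 -> `|v| <= C -> u * `|v| <= C.
  by move=> u0 u1 vC; rewrite (le_trans _ vC)// ler_piMl.
have yB : `|y| <= 1 + C + C + C.
  rewrite yE (le_trans (ler_normD _ _))// lerD//; last first.
    by apply: le_trans sC _; rewrite ler_piMr.
  rewrite (le_trans (ler_normD _ _))// lerD//; last by rewrite normrM normrX le1M.
  rewrite (le_trans (ler_normD _ _))// lerD//; first by rewrite normr1.
  by rewrite normrM le1M.
have zB : `|1 + e * a + e ^+ 2 * g| <= 1 + C + C.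
  rewrite (le_trans (ler_normD _ _))// lerD//; last by rewrite normrM normrX le1M.
  rewrite (le_trans (ler_normD _ _))// lerD//; first by rewrite normr1.
  by rewrite normrM le1M.
have t1 : `|r * y| <= C * `|e| ^+ 3 * (1 + C + C + C) by rewrite normrM ler_pM.
have t2 : `|s * (1 + e * a + e ^+ 2 * g)| <= C * `|e| ^+ 3 * (1 + C + C).
  by rewrite normrM ler_pM.
have t3 : `|e ^+ 3 * (a * B + g * A)| <= `|e| ^+ 3 * (C * C + C * C).
  rewrite normrM normrX ler_wpM2l//; rewrite (le_trans (ler_normD _ _))// lerD// normrM ler_pM//.
have t4 : `|e ^+ 3 * (e * (g * B))| <= `|e| ^+ 3 * (C * C).
  rewrite normrM normrX ler_wpM2l// normrM (@le_trans _ _ (`|g * B|))//.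
    by rewrite ler_piMl.
  by rewrite normrM ler_pM.
apply: (le_trans (ler_normD _ _)); apply: (le_trans (lerD (ler_normD _ _) t4)).
apply: (le_trans (lerD (lerD (ler_normD _ _) t3) (lexx _))).
apply: (le_trans (lerD (lerD (lerD t1 t2) (lexx _)) (lexx _))).
by rewrite le_eqVlt; apply/orP; left; apply/eqP; ring.
Qed.

(** With [A] and [Q] the sums of [c i * t i] and [c i * t i ^+ 2], the logarithm is
    [e A - e^2 Q / 2] up to order 3; exponentiating gives [(A^2 - Q) / 2] at order 2. [C] and [d]
    depend on [t] only through [K], because [t] will be random. *)
Lemma prod_powR_jet (I : eqType) (s : seq I) (c : I -> R) (K : R) : 0 <= K ->
  exists C d : R, [/\ 0 <= C, 0 < d & forall (t : I -> R) (e : R),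
    (forall i, `|t i| <= K) -> `|e| <= d ->
    [/\ `|\sum_(i <- s) c i * t i| <= C,
     `|((\sum_(i <- s) c i * t i) ^+ 2 - \sum_(i <- s) c i * t i ^+ 2) / 2| <= C &
     `|\prod_(i <- s) (1 + e * t i) `^ (c i) - 1 - e * (\sum_(i <- s) c i * t i) -
       e ^+ 2 * (((\sum_(i <- s) c i * t i) ^+ 2 -
         \sum_(i <- s) c i * t i ^+ 2) / 2)| <= C * `|e| ^+ 3]].
Proof.
move=> K0; elim: s => [|i s [C [d [C0 d0 IH]]]].
  exists 0, 1; split => // t e _ _; rewrite !big_nil.
  by rewrite expr0n !subrr mul0r !mulr0 subrr subr0 normr0 mul0r.
have [Ci Ci0 HCi] := powR_taylor2 (c i).
(* The last entry makes [|e * t i| <= 1/2], the range of [powR_taylor2]; [D] below dominates every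
   constant that [jetM] requires. *)
pose d' := Num.min (Num.min d 1) (2 * (K + 1))^-1.
pose D := C + Ci * K ^+ 3 + `|c i| * K + `|c i * (c i - 1) / 2| * K ^+ 2.
have K1 : 0 < K + 1 by rewrite ltr_wpDl.
have q1 : 0 <= Ci * K ^+ 3 by rewrite mulr_ge0// exprn_ge0.
have q2 : 0 <= `|c i| * K by rewrite mulr_ge0.
have q3 : 0 <= `|c i * (c i - 1) / 2| * K ^+ 2 by rewrite mulr_ge0// exprn_ge0.
have D0 : 0 <= D by rewrite /D !addr_ge0.
have D20 : 0 <= D ^+ 2 by rewrite exprn_ge0.
exists (2 * D + 8 * D ^+ 2), d'; split.
- by rewrite addr_ge0// mulr_ge0.
- by rewrite /d' !lt_min d0 ltr01 invr_gt0 mulr_gt0.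
move=> t e tK; rewrite /d' !le_min => /andP[/andP[ed e1] eK].
have [IH1 IH2 IH3] := IH t e tK ed.
rewrite !big_cons.
set S := \sum_(j <- s) c j * t j in IH1 IH2 IH3 *.
set Q := \sum_(j <- s) c j * t j ^+ 2 in IH2 IH3 *.
set Pr := \prod_(j <- s) _ in IH3 *.
have CD : C <= D by rewrite /D -!addrA lerDl !addr_ge0.
have bS : `|S| <= D by apply: le_trans CD.
have bQ : `|(S ^+ 2 - Q) / 2| <= D by apply: le_trans CD.
have ba : `|c i * t i| <= D.
  rewrite normrM (@le_trans _ _ (`|c i| * K))// ?ler_wpM2l//.
  by rewrite /D; lra.
have bg : `|c i * (c i - 1) / 2 * t i ^+ 2| <= D.
  rewrite normrM (@le_trans _ _ (`|c i * (c i - 1) / 2| * K ^+ 2))//.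
    by rewrite ler_wpM2l// normrX lerXn2r// nnegrE.
  by rewrite /D; lra.
have jx : `|(1 + e * t i) `^ c i - 1 - e * (c i * t i) -
    e ^+ 2 * (c i * (c i - 1) / 2 * t i ^+ 2)| <= D * `|e| ^+ 3.
  have et : `|e * t i| <= 2^-1.
    rewrite normrM (@le_trans _ _ ((2 * (K + 1))^-1 * K))// ?ler_pM//.
    by rewrite invfM -mulrA ler_piMr// ler_pdivrMl// mulr1 lerDl.
  have := HCi _ et.
  have -> : c i * (e * t i) = e * (c i * t i) by ring.
  have -> : c i * (c i - 1) / 2 * (e * t i) ^+ 2 =
    e ^+ 2 * (c i * (c i - 1) / 2 * t i ^+ 2) by ring.
  move=> H; apply: le_trans H _.
  rewrite normrM exprMn mulrCA [leRHS]mulrC ler_wpM2l ?exprn_ge0//.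
  rewrite (@le_trans _ _ (Ci * K ^+ 3))//; first by rewrite ler_wpM2l// lerXn2r// nnegrE.
  by rewrite /D; lra.
have jy : `|Pr - 1 - e * S - e ^+ 2 * ((S ^+ 2 - Q) / 2)| <= D * `|e| ^+ 3.
  by apply: le_trans IH3 _; rewrite ler_wpM2r// exprn_ge0.
have -> : ((c i * t i + S) ^+ 2 - (c i * t i ^+ 2 + Q)) / 2 =
  c i * (c i - 1) / 2 * t i ^+ 2 + (S ^+ 2 - Q) / 2 + c i * t i * S by field.
split.
- apply: (le_trans (ler_normD _ _)); rewrite (le_trans (lerD ba bS))//.
  by rewrite -mulr2n -[X in X <= _]mulr_natl lerDl mulr_ge0.
- apply: (le_trans (ler_normD _ _)).
  apply: (le_trans (lerD (le_trans (ler_normD _ _) (lerD bg bQ)) (lexx _))).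
  rewrite (@le_trans _ _ (D + D + D * D))//; first by rewrite lerD2l normrM ler_pM.
  by rewrite -expr2; lra.
- exact: jetM.
Qed.

(** Divide by [e] and let [e] tend to 0; then repeat with [e^2]. *)
Lemma small_jet_eq0 (x y C d : R) : 0 < d -> 0 <= C ->
  (forall e : R, `|e| <= d -> `|e * x + e ^+ 2 * y| <= C * `|e| ^+ 3) ->
  x = 0 /\ y = 0.
Proof.
move=> d0 C0 H.
have lin (u D : R) : 0 <= D -> (forall e : R, 0 < e -> e <= d -> `|u| <= D * e) -> u = 0.
  move=> D0 Hu; apply/eqP; rewrite -normr_le0; apply/ler_addgt0Pl => z z0.
  rewrite addr0; pose e := Num.min d (z / (D + 1)).
  have D1 : 0 < D + 1 by rewrite ltr_wpDl.
  have e0 : 0 < e by rewrite /e lt_min d0 divr_gt0.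
  apply: (le_trans (Hu e e0 _)); first by rewrite /e ge_min lexx.
  apply: (@le_trans _ _ ((D + 1) * (z / (D + 1)))).
    by rewrite ler_pM// ?(ltW e0)// ?lerDl// /e ge_min lexx orbT.
  by rewrite mulrC divfK// gt_eqF.
have x0 : x = 0.
  apply: (lin x (C * d + `|y|)); first by rewrite addr_ge0// mulr_ge0// ltW.
  move=> e e0 ed.
  have := H e; rewrite gtr0_norm// => /(_ ed).
  have -> : e * x + e ^+ 2 * y = e * (x + e * y) by ring.
  rewrite normrM gtr0_norm// exprS mulrCA ler_pM2l// => h.
  have -> : x = (x + e * y) - e * y by ring.
  apply: (le_trans (ler_normB _ _)); rewrite mulrDl lerD//.
    by apply: le_trans h _; rewrite expr2 mulrA ler_wpM2r ?(ltW e0)// ler_wpM2l.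
  by rewrite normrM gtr0_norm// mulrC.
split=> //; apply: (lin y C) => // e e0 ed.
have := H e; rewrite gtr0_norm// => /(_ ed).
rewrite x0 mulr0 add0r normrM normrX (gtr0_norm e0) => h.
by rewrite -(ler_pM2r (exprn_gt0 2 e0)) mulrC (le_trans h)// -mulrA -exprS.
Qed.

End taylor.

Section second_order.
Context (R : realType) d (T : measurableType d) (P : probability T R).

Lemma integrable_bounded (f : T -> R) (C : R) : measurable_fun setT f ->
  (forall x, `|f x| <= C) -> P.-integrable setT (EFin \o f).
Proof.
move=> mf fC; apply: measurable_bounded_integrable => //.
  by rewrite (_ : _ [set: T] = 1%E) ?ltry//; exact: probability_setT.
exists C; split; first exact: num_real.
by move=> M CM x _; rewrite /= (le_trans (fC x))// ltW.
Qed.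

(* Expanding [e |-> E (prod (1 + e t_i) ^ c_i) = 1] to second order in [e]. *)
Lemma second_order_identities (I : finType) (c : I -> R) (t : I -> T -> R) (K d0 : R) :
  0 < d0 -> (forall i x, `|t i x| <= K) -> (forall i, measurable_fun setT (t i)) ->
  (forall e : R, `|e| <= d0 ->
    (\int[P]_x (\prod_i (1 + e * t i x) `^ c i)%:E = 1)%E) ->
  \int[P]_x (\sum_i c i * t i x) = 0 /\
  \int[P]_x ((\sum_i c i * t i x) ^+ 2) = \int[P]_x (\sum_i c i * t i x ^+ 2).
Proof.
move=> d00 tK mt H.
pose K' : R := `|K|; have tK' i x : `|t i x| <= K' by rewrite (le_trans (tK i x))// ler_norm.
have [C [d1 [C0 d10 J]]] := prod_powR_jet (index_enum I) c (normr_ge0 K).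
pose A x := \sum_i c i * t i x.
pose Q x := \sum_i c i * t i x ^+ 2.
pose B x := (A x ^+ 2 - Q x) / 2.
have mA : measurable_fun setT A.
  by apply: measurable_sum => i; exact: measurable_funM.
have mQ : measurable_fun setT Q.
  by apply: measurable_sum => i; apply: measurable_funM => //; exact: measurable_funX.
have mB : measurable_fun setT B.
  by apply: measurable_funM => //; apply: measurable_funB => //; exact: measurable_funX.
have bA x : `|A x| <= C by have [] := J (t ^~ x) 0 (tK' ^~ x); rewrite ?normr0 ?(ltW d10).
have bB x : `|B x| <= C by have [] := J (t ^~ x) 0 (tK' ^~ x); rewrite ?normr0 ?(ltW d10).
have iA := integrable_bounded mA bA.
have iB := integrable_bounded mB bB.
have bA2 x : `|A x ^+ 2| <= C ^+ 2 by rewrite normrX lerXn2r// nnegrE.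
have iA2 := integrable_bounded (measurable_funX 2 mA) bA2.
have iQ : P.-integrable setT (EFin \o Q).
  apply: (integrable_bounded (C := C ^+ 2 + 2 * C)) => // x.
  have -> : Q x = A x ^+ 2 - 2 * B x by rewrite /B; field.
  (* [Q] inherits its bound from [A] and [B], the two quantities controlled by [prod_powR_jet]. *)
  by rewrite (le_trans (ler_normB _ _))// lerD// normrM ger0_norm// ler_wpM2l.
have E1 (u : R) : \int[P]_x u = u.
  rewrite Rintegral_cst// (_ : _ [set: T] = 1%E) ?mulr1//; exact: probability_setT.
have key : \int[P]_x A x = 0 /\ \int[P]_x B x = 0.
  apply: (@small_jet_eq0 _ _ _ C (Num.min d0 d1)) => //.
    by rewrite lt_min d00.
  move=> e; rewrite le_min => /andP[ed0 ed1].
  pose W x := \prod_i (1 + e * t i x) `^ c i.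
  have mW : measurable_fun setT W.
    apply: measurable_prod => i _; apply: (measurableT_comp (measurable_powR _)).
    by apply: measurable_funD => //; exact: measurable_funM.
  pose r x := W x - 1 - e * A x - e ^+ 2 * B x.
  have br x : `|r x| <= C * `|e| ^+ 3 by have [] := J (t ^~ x) e (tK' ^~ x) ed1.
  have iZ (k : R) (f : T -> R) : measurable_fun setT f -> (forall x, `|f x| <= C) ->
      P.-integrable setT (EFin \o (fun x => k * f x)).
    move=> mf fC; apply: (@integrable_bounded _ (`|k| * C)); first exact: measurable_funM.
    by move=> x; rewrite normrM ler_wpM2l.
  have ieA := iZ e A mA bA; have ieB := iZ (e ^+ 2) B mB bB.
  have i1 : P.-integrable setT (EFin \o (fun x : T => 1 : R)).
    by apply: (@integrable_bounded _ 1) => // x; rewrite normr1.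
  have mr : measurable_fun setT r.
    apply: measurable_funB; last exact: measurable_funM.
    apply: measurable_funB; last exact: measurable_funM.
    exact: measurable_funB.
  have ir := integrable_bounded mr br.
  have iW1 : P.-integrable setT (EFin \o (fun x => 1 + e * A x)).
    by have := integrableD measurableT i1 ieA.
  have iW2 : P.-integrable setT (EFin \o (fun x => 1 + e * A x + e ^+ 2 * B x)).
    by have := integrableD measurableT iW1 ieB.
  have : \int[P]_x W x = 1 by rewrite /Rintegral H.
  rewrite (_ : (fun x => W x) = fun x => (1 + e * A x + e ^+ 2 * B x) + r x); last first.
    by apply/funext => x; rewrite /r; ring.
  rewrite RintegralD// RintegralD// RintegralD// E1 RintegralZl// RintegralZl//.
  move=> E; have -> : e * \int[P]_x A x + e ^+ 2 * \int[P]_x B x = - \int[P]_x r x.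
    by move: E; lra.
  rewrite normrN (le_trans (le_normr_Rintegral _ ir))//.
  rewrite -[leRHS]E1; apply: le_Rintegral => //.
  - exact: (integrable_norm ir).
  - apply: (@integrable_bounded _ `|C * `|e| ^+ 3|) => //.
case: key => kA kB; split => //.
have : \int[P]_x (2 * B x) = 0 by rewrite RintegralZl// kB mulr0.
rewrite (_ : (fun x => 2 * B x) = fun x => A x ^+ 2 - Q x); last first.
  by apply/funext => x; rewrite /B; field.
by rewrite RintegralB// => /eqP; rewrite subr_eq0 => /eqP.
Qed.

End second_order.

(** * Loop equations *)

Section jacobi_deformation.
Context (R : realType).
Implicit Types (x y e : R) (k m n : nat).

(** Divided difference of the [m]-th power, in polynomial form so that it keeps a meaning on the
    diagonal. *)
Definition ddiff m x y : R := \sum_(i < m) x ^+ (m.-1 - i) * y ^+ i.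

Lemma ddiffC m x y : ddiff m x y = ddiff m y x.
Proof.
rewrite /ddiff (reindex_inj rev_ord_inj)/=; apply: eq_bigr => i _.
rewrite mulrC; congr (_ * _); congr (_ ^+ _); case: m i => [[]//|m] i /=.
all: by rewrite subSS ?subKn// -ltnS.
Qed.

Lemma ddiffP m x y : x ^+ m - y ^+ m = (x - y) * ddiff m x y.
Proof. exact: subrXX. Qed.

Lemma ddiffxx m x : ddiff m x x = m%:R * x ^+ m.-1.
Proof.
rewrite /ddiff (eq_bigr (fun=> x ^+ m.-1)).
  by rewrite sumr_const card_ord mulr_natl.
move=> i _; rewrite -exprD subnK//; case: m i => [[]//|m] i /=.
by rewrite -ltnS ltn_ord.
Qed.

(** Replace the smaller of the two numbers by the larger. *)
Lemma mon_le_sum x y p q : 0 <= x -> 0 <= y ->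
  x ^+ p * y ^+ q <= x ^+ (p + q) + y ^+ (p + q).
Proof.
move=> x0 y0; have [xy|/ltW xy] := leP x y.
  apply: (@le_trans _ _ (y ^+ p * y ^+ q)); last by rewrite -exprD lerDr exprn_ge0.
  by rewrite ler_wpM2r ?exprn_ge0// lerXn2r// nnegrE.
apply: (@le_trans _ _ (x ^+ p * x ^+ q)); last by rewrite -exprD lerDl exprn_ge0.
by rewrite ler_wpM2l ?exprn_ge0// lerXn2r// nnegrE.
Qed.

Lemma ddiff_ge0 m x y : 0 <= x -> 0 <= y -> 0 <= ddiff m x y.
Proof. by move=> x0 y0; apply: sumr_ge0 => i _; rewrite mulr_ge0// exprn_ge0. Qed.

Lemma ddiff_le m x y : 0 <= x -> 0 <= y ->
  ddiff m x y <= m%:R * (x ^+ m.-1 + y ^+ m.-1).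
Proof.
move=> x0 y0; rewrite -[X in X%:R](card_ord m) mulr_natl -sumr_const.
apply: ler_sum => i _; have -> : m.-1 = (m.-1 - i + i)%N.
  by rewrite subnK//; case: m i => [[]//|m] i; rewrite -ltnS ltn_ord.
by rewrite addnK; exact: mon_le_sum.
Qed.

Variables (n k : nat) (beta a b : R).

(** Divided difference and derivative of the field [x^(k+1) - x^(k+2)] along which [psi e] moves
    points. *)
Definition dfield x y : R := ddiff k.+1 x y - ddiff k.+2 x y.
Definition dfield' x : R := k.+1%:R * x ^+ k - k.+2%:R * x ^+ k.+1.
Definition psi e x : R := x + e * (x ^+ k.+1 - x ^+ k.+2).
Let ee : R := beta / 2 * (n.-1)%:R + 1.

Let J := (('I_n * 'I_n) + 'I_n + ('I_n + 'I_n))%type.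

(* Applying [psi e] to all coordinates multiplies each factor of the density (differences,
   [x i], [1 - x i], Jacobian) by [1 + e * jdir x u]; [jexp u] is its exponent. *)
Definition jexp (u : J) : R := match u with
  | inl (inl p) => if (p.1 < p.2)%N then beta else 0
  | inl (inr i) => a - ee
  | inr (inl i) => b - ee
  | inr (inr i) => 1 end.

Definition jdir (x : 'I_n -> R) (u : J) : R := match u with
  | inl (inl p) => dfield (x p.1) (x p.2)
  | inl (inr i) => x i ^+ k - x i ^+ k.+1
  | inr (inl i) => - x i ^+ k.+1
  | inr (inr i) => dfield' (x i) end.

Let bnd : R := k.+1%:R + k.+2%:R.

Lemma dfield_le x y : 0 < x < 1 -> 0 < y < 1 ->
  `|dfield x y| <= bnd * (x ^+ k + y ^+ k).
Proof.
move=> /andP[/ltW x0 /ltW x1] /andP[/ltW y0 /ltW y1].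
rewrite /dfield (le_trans (ler_normB _ _))// mulrDl lerD//.
  by rewrite ger0_norm ?ddiff_ge0//; exact: ddiff_le.
rewrite ger0_norm ?ddiff_ge0// (le_trans (ddiff_le _ x0 y0))// ler_wpM2l//.
by rewrite lerD// exprS ler_piMl// exprn_ge0.
Qed.

Lemma dfield'_le x : 0 < x < 1 -> `|dfield' x| <= bnd * x ^+ k.
Proof.
move=> /andP[/ltW x0 /ltW x1].
rewrite /dfield' (le_trans (ler_normB _ _))// [leRHS]mulrDl lerD//.
  by rewrite ger0_norm// mulr_ge0// exprn_ge0.
rewrite ger0_norm ?mulr_ge0// ?exprn_ge0// ler_wpM2l//.
by rewrite exprS ler_piMl// exprn_ge0.
Qed.

Lemma jdir_bound (x : 'I_n -> R) u : (forall i, 0 < x i < 1) ->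
  `|jdir x u| <= bnd * 2.
Proof.
move=> x01.
have x0 i : 0 <= x i by have /andP[/ltW] := x01 i.
have x1 i m : x i ^+ m <= 1 by have /andP[/ltW ? /ltW ?] := x01 i; rewrite exprn_ile1.
have b1 : 1 <= bnd * 2 by rewrite /bnd -natrD -natrM ler1n.
have bnd0 : 0 <= bnd by rewrite /bnd.
case: u => [[[i j]|i]|[i|i]] /=.
- by rewrite (le_trans (dfield_le _ _))// ler_wpM2l// -[2]/(1 + 1) lerD.
- rewrite (le_trans _ b1)// ger0_norm; last first.
    by rewrite subr_ge0 exprS ler_piMl ?exprn_ge0//; have /andP[_ /ltW] := x01 i.
  by rewrite lerBlDr (le_trans (x1 _ _))// lerDl exprn_ge0.
- by rewrite normrN ger0_norm ?exprn_ge0// (le_trans (x1 _ _)).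
- rewrite (le_trans (dfield'_le _))// ler_wpM2l// (le_trans (x1 _ _))//.
  by rewrite ler1n.
Qed.

(** Turns interactions over pairs into a full double sum minus its diagonal. This diagonal, set
    against the Jacobian, is the origin of the coefficient [1 - beta / 2] in [loop]. *)
Lemma sum_sym (F : 'I_n -> 'I_n -> R) : (forall i j, F i j = F j i) ->
  \sum_(i < n) \sum_(j < n | (i < j)%N) F i j =
  2^-1 * (\sum_i \sum_j F i j - \sum_i F i i).
Proof.
move=> Fsym.
have E1 : \sum_i \sum_j F i j = \sum_(i < n) \sum_(j < n | (i < j)%N) F i j +
    \sum_(i < n) \sum_(j < n | (j < i)%N) F i j + \sum_i F i i.
  rewrite -!big_split/=; apply: eq_bigr => i _.
  rewrite (bigID (fun j : 'I_n => (i < j)%N))/= -addrA; congr (_ + _).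
  rewrite (bigD1 i) ?ltnn//= addrC; congr (_ + _); apply: eq_bigl => j.
  by rewrite -leqNgt andbC -ltn_neqAle.
have E2 : \sum_(i < n) \sum_(j < n | (j < i)%N) F i j =
    \sum_(i < n) \sum_(j < n | (i < j)%N) F i j.
  rewrite (exchange_big_dep predT)//=; apply: eq_bigr => i _.
  by apply: eq_bigr => j _; rewrite Fsym.
by rewrite E1 E2; field.
Qed.

Definition psum (x : 'I_n -> R) m : R := \sum_i x i ^+ m.
Definition pconv (x : 'I_n -> R) m : R := \sum_(p < m.+1) psum x (m - p) * psum x p.

Lemma sum_ddiff (x : 'I_n -> R) m :
  \sum_i \sum_j ddiff m.+1 (x i) (x j) = pconv x m.
Proof.
rewrite /ddiff /pconv.
under eq_bigr => i _ do rewrite exchange_big/=.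
rewrite exchange_big/=; apply: eq_bigr => p _.
rewrite /psum mulr_suml; apply: eq_bigr => i _.
by rewrite mulr_sumr.
Qed.

(** Derivative at [e = 0] of the logarithm of the deformed density, Jacobian included, sorted by
    power sums. The term [2 * ee] collects the shifts of both exponents. *)
Definition loop (x : 'I_n -> R) : R :=
  beta / 2 * (pconv x k - pconv x k.+1) +
  (1 - beta / 2) * (k.+1%:R * psum x k - k.+2%:R * psum x k.+1) +
  (a - ee) * psum x k - (a + b - 2 * ee) * psum x k.+1.

Lemma jdir_sum (x : 'I_n -> R) : \sum_u jexp u * jdir x u = loop x.
Proof.
rewrite !big_sumType/=.
have -> : \sum_(p : 'I_n * 'I_n) (if (p.1 < p.2)%N then beta else 0) *
    dfield (x p.1) (x p.2) = beta * \sum_(i < n) \sum_(j < n | (i < j)%N) dfield (x i) (x j).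
  rewrite -(pair_bigA _ (fun i j : 'I_n => (if (i < j)%N then beta else 0) *
    dfield (x i) (x j)))/= mulr_sumr; apply: eq_bigr => i _.
  rewrite mulr_sumr [RHS]big_mkcond/=; apply: eq_bigr => j _.
  by case: ifP; rewrite ?mul0r.
rewrite sum_sym; last by move=> i j; rewrite /dfield ddiffC (ddiffC k.+2).
have -> : \sum_i \sum_j dfield (x i) (x j) = pconv x k - pconv x k.+1.
  rewrite -!sum_ddiff -sumrB; apply: eq_bigr => i _.
  by rewrite -sumrB.
have -> : \sum_i dfield (x i) (x i) = k.+1%:R * psum x k - k.+2%:R * psum x k.+1.
  rewrite /psum !mulr_sumr -sumrB; apply: eq_bigr => i _.
  by rewrite /dfield !ddiffxx.
have -> : \sum_i (a - ee) * (x i ^+ k - x i ^+ k.+1) =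
    (a - ee) * (psum x k - psum x k.+1).
  by rewrite /psum -sumrB mulr_sumr.
have -> : \sum_i (b - ee) * - x i ^+ k.+1 = - (b - ee) * psum x k.+1.
  by rewrite /psum mulr_sumr; apply: eq_bigr => i _; ring.
have -> : \sum_i 1 * dfield' (x i) = k.+1%:R * psum x k - k.+2%:R * psum x k.+1.
  by rewrite /psum !mulr_sumr -sumrB; apply: eq_bigr => i _; rewrite mul1r.
by rewrite /loop; field.
Qed.

(** The large parameter [b] meets only the direction [- x^(k+1)], whose square has order [2 (k + 1)]
    and not [2 k]. The two extra powers will compensate the size of [b] once power sums scale like
    powers of [theta]. *)
Lemma jdir_sum_sqr_le (x : 'I_n -> R) : 0 <= beta -> (forall i, 0 < x i < 1) ->
  \sum_u jexp u * jdir x u ^+ 2 <=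
  (4 * beta * n%:R * bnd ^+ 2 + `|a - ee| + bnd ^+ 2) * psum x (2 * k) +
  `|b - ee| * psum x (2 * k.+1).
Proof.
move=> beta0 x01.
have x0 i : 0 <= x i by have /andP[/ltW] := x01 i.
have x1 i : x i <= 1 by have /andP[_ /ltW] := x01 i.
have bnd0 : 0 <= bnd by rewrite /bnd.
have X2 i m : x i ^+ (2 * m) = (x i ^+ m) ^+ 2 by rewrite mulnC exprM.
rewrite !big_sumType/=.
have H1 : \sum_(p : 'I_n * 'I_n) (if (p.1 < p.2)%N then beta else 0) *
    dfield (x p.1) (x p.2) ^+ 2 <= 4 * beta * n%:R * bnd ^+ 2 * psum x (2 * k).
  apply: (@le_trans _ _ (\sum_(p : 'I_n * 'I_n) 2 * beta * bnd ^+ 2 *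
      (x p.1 ^+ (2 * k) + x p.2 ^+ (2 * k)))).
    apply: ler_sum => -[i j] _ /=.
    have : dfield (x i) (x j) ^+ 2 <= bnd ^+ 2 * (2 * (x i ^+ (2 * k) + x j ^+ (2 * k))).
      rewrite -real_normK ?num_real//.
      apply: (@le_trans _ _ ((bnd * (x i ^+ k + x j ^+ k)) ^+ 2)).
        rewrite lerXn2r ?nnegrE// ?mulr_ge0// ?addr_ge0 ?exprn_ge0//.
        exact: dfield_le.
      rewrite exprMn ler_wpM2l ?exprn_ge0// !X2.
      have := sqr_ge0 (x i ^+ k - x j ^+ k); lra.
    case: ifP => _ H; last first.
      by rewrite mul0r !mulr_ge0// ?exprn_ge0// addr_ge0// exprn_ge0.
    apply: (le_trans (ler_wpM2l beta0 H)).
    by rewrite le_eqVlt; apply/orP; left; apply/eqP; ring.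
  rewrite -(pair_bigA _ (fun i j : 'I_n => 2 * beta * bnd ^+ 2 *
      (x i ^+ (2 * k) + x j ^+ (2 * k))))/=.
  under eq_bigr do rewrite -mulr_sumr big_split/= sumr_const card_ord.
  rewrite -mulr_sumr big_split/= sumr_const card_ord sumrMnl -/(psum x (2 * k)).
  rewrite -[psum x (2 * k) *+ n]mulr_natl.
  by rewrite le_eqVlt; apply/orP; left; apply/eqP; ring.
have H2 : \sum_i (a - ee) * (x i ^+ k - x i ^+ k.+1) ^+ 2 <=
    `|a - ee| * psum x (2 * k).
  rewrite /psum mulr_sumr; apply: ler_sum => i _.
  apply: (@le_trans _ _ (`|a - ee| * (x i ^+ k - x i ^+ k.+1) ^+ 2)).
    by rewrite ler_wpM2r ?sqr_ge0// ler_norm.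
  rewrite ler_wpM2l// X2 lerXn2r ?nnegrE ?exprn_ge0//.
    by rewrite subr_ge0 exprS ler_piMl ?exprn_ge0.
  by rewrite lerBlDr lerDl exprn_ge0.
have H3 : \sum_i (b - ee) * (- x i ^+ k.+1) ^+ 2 <= `|b - ee| * psum x (2 * k.+1).
  rewrite /psum mulr_sumr; apply: ler_sum => i _.
  by rewrite sqrrN X2 ler_wpM2r ?sqr_ge0// ler_norm.
have H4 : \sum_i 1 * dfield' (x i) ^+ 2 <= bnd ^+ 2 * psum x (2 * k).
  rewrite /psum mulr_sumr; apply: ler_sum => i _.
  rewrite mul1r -real_normK ?num_real// X2 -exprMn lerXn2r ?nnegrE//.
    by rewrite mulr_ge0// exprn_ge0.
  exact: dfield'_le.
by rewrite !mulrDl; apply: le_trans (lerD (lerD H1 H2) (lerD H3 H4)) _; lra.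
Qed.

(** Directions are bounded by [2 * bnd], so this radius gives [|e * t| <= 1/2] and keeps every
    factor positive. *)
Let d0 : R := (4 * bnd)^-1.

Let small e (t : R) : `|e| <= d0 -> `|t| <= bnd * 2 -> 0 < 1 + e * t.
Proof.
move=> ed tb; have bp : 0 < bnd by rewrite /bnd -natrD.
have : `|e * t| <= 2^-1.
  rewrite normrM (le_trans (ler_pM _ _ ed tb))// /d0.
  by rewrite le_eqVlt; apply/orP; left; apply/eqP; field; rewrite gt_eqF.
by rewrite ler_norml => /andP[+ _]; lra.
Qed.

Lemma psi_ratio e x : psi e x = x * (1 + e * (x ^+ k - x ^+ k.+1)).
Proof. by rewrite /psi !exprS; ring. Qed.

Lemma onem_psi_ratio e x : 1 - psi e x = (1 - x) * (1 + e * - x ^+ k.+1).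
Proof. by rewrite /psi !exprS; ring. Qed.

Lemma psi_diff e x y : psi e x - psi e y = (x - y) * (1 + e * dfield x y).
Proof.
rewrite /dfield mulrDr mulr1 mulrCA mulrBr -!ddiffP /psi; ring.
Qed.

Lemma psi_itv e x : `|e| <= d0 -> 0 < x < 1 -> 0 < psi e x < 1.
Proof.
move=> ed /andP[x0 x1]; have b1 : 1 <= bnd * 2 by rewrite /bnd -natrD -natrM ler1n.
have xk m : 0 <= x ^+ m <= 1 by rewrite exprn_ge0 ?exprn_ile1 ?(ltW x0) ?(ltW x1).
apply/andP; split.
  rewrite psi_ratio mulr_gt0// small// (le_trans _ b1)// ger0_norm.
    by have /andP[? ?] := xk k; have /andP[? ?] := xk k.+1; lra.
  by rewrite subr_ge0 exprS ler_piMl// ?ltW// exprn_gt0.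
rewrite -subr_gt0 onem_psi_ratio mulr_gt0 ?subr_gt0// small//.
by rewrite normrN ger0_norm; have /andP[? ?] := xk k.+1 => //; rewrite (le_trans _ b1).
Qed.

(** The indicator discards points outside []0, 1[], where [1 + e * dfield'] may be negative and from
    which [psi e] may re-enter the interval. *)
Definition psi_jac e x : R := (1 + e * dfield' x) * \1_(`]0, 1[%classic : set R) x.

Lemma jac_dens_psi e (s : seq R) : size s = n -> `|e| <= d0 ->
  (forall i : 'I_n, 0 < s`_i < 1) ->
  jac_dens beta a b (map (psi e) s) * \prod_(x <- s) psi_jac e x =
  (\prod_u (1 + e * jdir (fun i : 'I_n => s`_i) u) `^ jexp u) * jac_dens beta a b s.
Proof.
move=> sn ed s01.
have pos u : 0 < 1 + e * jdir (fun i : 'I_n => s`_i) u.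
  by apply: small => //; exact: jdir_bound.
have nthm (i : 'I_n) : (map (psi e) s)`_i = psi e s`_i.
  by rewrite (nth_map 0)// sn.
rewrite (jac_densE beta a b sn) (@jac_densE _ n) ?size_map//.
rewrite (big_nth 0) sn big_mkord !big_sumType/=.
have -> : \prod_(p : 'I_n * 'I_n) (1 + e * dfield s`_p.1 s`_p.2) `^
   (if (p.1 < p.2)%N then beta else 0) =
   \prod_(i < n) \prod_(j < n | (i < j)%N) (1 + e * dfield s`_i s`_j) `^ beta.
  rewrite -(pair_bigA _ (fun i j : 'I_n => (1 + e * dfield s`_i s`_j) `^
    (if (i < j)%N then beta else 0)))/=; apply: eq_bigr => i _.
  rewrite [RHS]big_mkcond/=; apply: eq_bigr => j _.
  by case: ifP; rewrite ?powRr0.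
set A1 := \prod_i _; set A2 := \prod_i (_ * _ * _); set A3 := \prod_i psi_jac _ _.
set B1 := \prod_(i < n) _; set B2 := \prod_i _; set B3 := \prod_i _; set B4 := \prod_i _.
set C1 := \prod_i _; set C2 := \prod_i _.
have -> : A1 = B1 * C1.
  rewrite /A1 /B1 /C1 -big_split; apply: eq_bigr => i _ /=.
  rewrite -big_split; apply: eq_bigr => j ij /=.
  rewrite !nthm psi_diff normrM mulrC powRM// gtr0_norm//.
  exact: (pos (inl (inl (i, j)))).
have E2 : A2 * A3 = B2 * B3 * B4 * C2.
  rewrite /A2 /A3 /B2 /B3 /B4 /C2 -!big_split; apply: eq_bigr => i _ /=.
  have /andP[s0 s1] := s01 i.
  have ps := psi_itv ed (s01 i).
  rewrite !nthm /psi_jac !indicE.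
  have -> : psi e s`_i \in [set x | 0 < x < 1] by rewrite mem_set.
  have E3 : s`_i \in [set x : R | 0 < x < 1] by rewrite mem_set//; exact: s01.
  have E4 : s`_i \in (`]0, 1[%classic : set R) by rewrite mem_setE in_itv/= s0.
  rewrite E3 ?E4.
  have p1 := pos (inl (inr i)); have p2 := pos (inr (inl i)).
  have p3 := pos (inr (inr i)); move: p1 p2 p3 => /= p1 p2 p3.
  rewrite onem_psi_ratio psi_ratio powRM ?(ltW s0) ?(ltW p1)//.
  rewrite powRM ?(ltW p2) ?subr_ge0 ?(ltW s1)// powRr1 ?(ltW p3)//.
  by ring.
transitivity (B1 * C1 * (A2 * A3)); first by ring.
by rewrite E2; ring.
Qed.

Lemma lebesgue_psi e : `|e| <= d0 ->
  forall h : R -> \bar R, (forall x, 0 <= h x)%E -> measurable_fun setT h ->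
    (forall x, ~ (`]0, 1[%classic : set R) x -> h x = 0%E) ->
    (\int[@lebesgue_measure R]_x h x =
    \int[@lebesgue_measure R]_x (h (psi e x) * (psi_jac e x)%:E))%E.
Proof.
move=> ed h h0 mh hD.
(* The bound of [dfield_le] on the closed interval: monotonicity in [change_of_variables] is asked
   up to the endpoints. *)
have x01 x : 0 <= x <= 1 -> forall y, 0 <= y <= 1 -> `|dfield x y| <= bnd * 2.
  move=> /andP[x0 x1] y /andP[y0 y1].
  have p0 (z : R) m : 0 <= z -> z <= 1 -> z ^+ m <= 1.
    by move=> z0 z1; rewrite exprn_ile1.
  have bnd0 : 0 <= bnd by rewrite /bnd.
  have dd m : ddiff m.+1 x y <= m.+1%:R * 2.
    by rewrite (le_trans (ddiff_le _ x0 y0))// ler_wpM2l// -[2]/(1 + 1) lerD// p0.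
  rewrite /dfield (le_trans (ler_normB _ _))// mulrDl !ger0_norm ?ddiff_ge0//.
  by rewrite lerD.
have p0 : psi e 0 = 0 by rewrite /psi !expr0n/= subrr mulr0 addr0.
have p1 : psi e 1 = 1 by rewrite /psi !expr1n subrr mulr0 addr0.
transitivity (\int[@lebesgue_measure R]_(x in `]psi e 0, psi e 1[) h x)%E.
  rewrite [RHS]integral_mkcond; apply: eq_integral => x _; rewrite patchE.
  rewrite p0 p1.
  by case: ifPn => //; rewrite notin_setE => /hD.
have cpoly (c1 c2 c3 c4 : R) m : continuous (fun x : R => c1 + c4 * x + (c2 * x ^+ m + c3 * x ^+ m.+1)).
  pose p : {poly R} := c1%:P + c4%:P * 'X + (c2%:P * ('X ^+ m) + c3%:P * ('X ^+ m.+1)).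
  move=> x; have := @continuous_horner R p x.
  rewrite (_ : horner _ = fun x : R => c1 + c4 * x + (c2 * x ^+ m + c3 * x ^+ m.+1))//.
  by apply/funext => y; rewrite /p !hornerE.
transitivity (\int[@lebesgue_measure R]_(x in `]0%R, 1%R[)
    (h (psi e x) * (1 + e * dfield' x)%:E))%E; last first.
  rewrite integral_mkcond; apply: eq_integral => x _; rewrite patchE /psi_jac indicE.
  by case: ifPn => _; rewrite ?mulr1 ?mulr0 ?mule0.
apply: (@change_of_variables R (psi e) (fun x => 1 + e * dfield' x)) => //.
- rewrite (_ : psi e = fun x => 0 + 1 * x + (e * x ^+ k.+1 + (- e) * x ^+ k.+2)).
    exact: cpoly.
  by apply/funext => x; rewrite /psi; ring.
- rewrite (_ : (fun x => _) = fun x => 1 + 0 * x + ((e * k.+1%:R) * x ^+ k + (- e * k.+2%:R) * x ^+ k.+1)).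
    exact: cpoly.
  by apply/funext => x; rewrite /dfield'; ring.
- move=> x.
  rewrite (_ : psi e = (fun x => 1 * x) + ((fun x => e * x ^+ k.+1) + (fun x => (- e) * x ^+ k.+2))).
    2: by apply/funext => y; rewrite /psi;
      change (y + e * (y ^+ k.+1 - y ^+ k.+2) =
        1 * y + (e * y ^+ k.+1 + - e * y ^+ k.+2)); ring.
  rewrite (_ : 1 + e * dfield' x = 1 + (e * (k.+1%:R * x ^+ k) + (- e) * (k.+2%:R * x ^+ k.+1))).
    2: by rewrite /dfield'; ring.
  apply: is_deriveD; first exact: is_derive_mull.
  by apply: is_deriveD; exact: is_derive_monom.
- move=> x x01'; apply/ltW/small => //.
  have bnd0 : 0 <= bnd by rewrite /bnd.
  rewrite (le_trans (dfield'_le x01'))// ler_wpM2l//.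
  have /andP[/ltW ? /ltW ?] := x01'.
  by rewrite (@le_trans _ _ 1) ?ler1n// exprn_ile1.
- move=> x y x0 y1 xy; rewrite -subr_gt0 psi_diff mulr_gt0 ?subr_gt0//.
  apply: small => //; apply: x01; apply/andP; split => //.
  + by rewrite (le_trans x0)// ltW.
  + by rewrite (le_trans _ y1)// ltW.
Qed.

End jacobi_deformation.

Section clamp.
Context (R : realType).

(** Eigenvalues lie in []0, 1[] only almost surely. Clamping makes it hold everywhere, so that all
    statistics are bounded and integrable; the value 1/2 is arbitrary, and [support_ae] removes the
    clamp at the end. *)
Definition clamp (x : R) : R := if 0 < x < 1 then x else 2^-1.

Lemma clamp_itv x : 0 < clamp x < 1.
Proof.
by rewrite /clamp; case: ifPn => //; rewrite invr_gt0 invf_lt1// ltr0n ltr1n.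
Qed.

Lemma clamp_id x : 0 < x < 1 -> clamp x = x.
Proof. by rewrite /clamp => ->. Qed.

Lemma measurable_clamp : measurable_fun setT clamp.
Proof.
apply: measurable_fun_ifT => //; apply: measurable_and; exact: measurable_fun_ltr.
Qed.

End clamp.

Section jacobi_law.
Context (R : realType) (d : measure_display) (T : measurableType d).
Variables (P : probability T R) (n : nat) (lam w : T -> 'I_n -> R).
Variables (beta a b c : R).
Hypothesis mlam : forall i, measurable_fun setT (fun t => lam t i).
Hypothesis mw : forall i, measurable_fun setT (fun t => w t i).
Hypothesis rect : forall A B : 'I_n -> set R,
  (forall i, measurable (A i)) -> (forall i, measurable (B i)) ->
  P [set t | forall i : 'I_n, A i (lam t i) /\ B i (w t i)] =
  (jac_prob beta a b A * dir_prob c B)%E.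

Definition clam (t : T) (i : 'I_n) : R := clamp (lam t i).

Lemma clam_itv t i : 0 < clam t i < 1.
Proof. exact: clamp_itv. Qed.

Lemma measurable_clam i : measurable_fun setT (fun t => clam t i).
Proof. by apply: measurableT_comp => //; exact: measurable_clamp. Qed.

Lemma measurable_psum d' (T' : measurableType d') (x : T' -> 'I_n -> R) m :
  (forall i, measurable_fun setT (fun t => x t i)) ->
  measurable_fun setT (fun t => psum (x t) m).
Proof. by move=> mx; apply: measurable_sum => i; exact: measurable_funX. Qed.

Lemma measurable_jdir d' (T' : measurableType d') (x : T' -> 'I_n -> R) k u :
  (forall i, measurable_fun setT (fun t => x t i)) ->
  measurable_fun setT (fun t => jdir k (x t) u).
Proof.
move=> mx.
have md m i j : measurable_fun setT (fun t => ddiff m (x t i) (x t j)).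
  by apply: measurable_sum => l; apply: measurable_funM; exact: measurable_funX.
case: u => [[[i j]|i]|[i|i]] /=.
- by apply: measurable_funB.
- by apply: measurable_funB; exact: measurable_funX.
- by apply: measurableT_comp => //; exact: measurable_funX.
- by apply: measurable_funB; apply: measurable_funM => //; exact: measurable_funX.
Qed.

Lemma psum_bound (x : 'I_n -> R) m : (forall i, 0 < x i < 1) -> 0 <= psum x m <= n%:R.
Proof.
move=> x01; apply/andP; split.
  by apply: sumr_ge0 => i _; have /andP[/ltW ? _] := x01 i; rewrite exprn_ge0.
rewrite -[X in X%:R](card_ord n) -sumr_const; apply: ler_sum => i _.
by have /andP[/ltW ? /ltW ?] := x01 i; rewrite exprn_ile1.
Qed.

Lemma integrable_psum m : P.-integrable setT (EFin \o (fun t => psum (clam t) m)).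
Proof.
apply: (@integrable_bounded _ _ _ _ _ n%:R).
  by apply: measurable_psum; exact: measurable_clam.
by move=> t; have /andP[? ?] := psum_bound m (clam_itv t); rewrite ger0_norm.
Qed.

Let bnd k : R := k.+1%:R + k.+2%:R.

(** By [jac_dens_psi] the product times the density is the pull-back of the density under [psi];
    changing variables returns the normalising constant [z]. *)
Lemma deform_mean k (e : R) : `|e| <= (4 * bnd k)^-1 ->
  (\int[P]_t (\prod_u (1 + e * jdir k (clam t) u) `^ @jexp _ n beta a b u)%:E = 1)%E.
Proof.
move=> ed.
have [z z0 Ez] := jac_norm rect.
pose f (s : n.-tuple R) : R :=
  \prod_u (1 + e * jdir k (fun i => clamp (tnth s i)) u) `^ @jexp _ n beta a b u.
have f0 s : 0 <= f s by apply: prodr_ge0 => u _; exact: powR_ge0.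
have mf : measurable_fun setT f.
  apply: measurable_prod => u _; apply: (measurableT_comp (measurable_powR _)).
  apply: measurable_funD => //; apply: measurable_funM => //.
  apply: (@measurable_jdir _ _ (fun (s : n.-tuple R) i => clamp (tnth s i))) => i.
  apply: measurableT_comp; [exact: measurable_clamp|exact: measurable_tnth].
have := law_lam mlam mw rect f0 mf.
rewrite (_ : (fun t => _) = (fun t =>
  (\prod_u (1 + e * jdir k (clam t) u) `^ @jexp _ n beta a b u)%:E)); last first.
  apply/funext => t; rewrite /f /rv_pair/=; congr EFin; apply: eq_bigr => u _.
  by congr ((1 + e * jdir _ _ _) `^ _); apply/funext => i; rewrite tnth_mktuple.
move=> ->.
rewrite Ez/= (_ : iint n _ = z%:E); first by rewrite -EFinM mulVf// gt_eqF.
rewrite -Ez [RHS](@iint_change R (psi k e) (psi_jac k e) (`]0, 1[%classic)).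
- apply: eq_iint => s sn; rewrite -EFinM; congr EFin.
  have [s01|] := pselect (forall i : 'I_n, 0 < s`_i < 1).
    rewrite (jac_dens_psi _ _ _ sn ed s01); congr (_ * _); apply: eq_bigr => u _.
    congr ((1 + e * jdir _ _ _) `^ _); apply/funext => i.
    by rewrite tnth_mktuple clamp_id.
  move=> /existsNP[i /negP si].
  have ins : s`_i \in s by rewrite mem_nth// sn.
  rewrite (jac_dens_out beta a b ins si) mulr0.
  rewrite (big_rem _ ins)/= {1}/psi_jac indicE memNset ?mulr0 ?mul0r ?mulr0//.
  by rewrite /= in_itv/=; apply/negP.
- apply: continuous_measurable_fun.
  pose p : {poly R} := 'X + e%:P * ('X ^+ k.+1 - 'X ^+ k.+2).
  rewrite (_ : psi k e = horner p); first exact: continuous_horner.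
  by apply/funext => y; rewrite /p /psi !hornerE.
- apply: measurable_funM; last exact: measurable_indic.
  apply: measurable_funD => //; apply: measurable_funM => //.
  by apply: measurable_funB; apply: measurable_funM => //; exact: measurable_funX.
- move=> x; rewrite /psi_jac indicE.
  case: (boolP (x \in _)); last by rewrite mulr0.
  rewrite mem_setE in_itv/= => x01; rewrite mulr1.
  have b0 : 0 < bnd k by rewrite /bnd -natrD.
  have : `|e * dfield' k x| <= 1.
    rewrite normrM (le_trans (ler_pM _ _ ed (dfield'_le _ x01)))// -/(bnd k).
    have /andP[/ltW ? /ltW ?] := x01.
    rewrite (@le_trans _ _ ((4 * bnd k)^-1 * (bnd k * 1)))//.
      by rewrite ler_wpM2l ?invr_ge0 ?mulr_ge0 ?(ltW b0)// ler_wpM2l ?(ltW b0)// exprn_ile1.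
    rewrite mulr1 ler_pdivrMl ?mulr_gt0// mulr1 ler_peMl ?(ltW b0)//.
    by rewrite ler1n.
  by rewrite ler_norml => /andP[+ _]; lra.
- exact: lebesgue_psi.
- by move=> s; rewrite lee_fin jac_dens_ge0.
- by apply/measurable_EFinP; exact: measurable_jac_dens.
- move=> s x xs; rewrite /= in_itv/= => /negP x01.
  by rewrite (jac_dens_out beta a b xs x01).
Qed.

Let ids k := @second_order_identities R _ T P _ (@jexp R n beta a b)
  (fun u t => jdir k (clam t) u) (bnd k * 2) (4 * bnd k)^-1.

Let ids_concl k : \int[P]_t loop k beta a b (clam t) = 0 /\
  \int[P]_t (loop k beta a b (clam t)) ^+ 2 =
  \int[P]_t (\sum_u @jexp R n beta a b u * jdir k (clam t) u ^+ 2).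
Proof.
have [] := @ids k.
- by rewrite invr_gt0 mulr_gt0// /bnd -natrD.
- by move=> u t; apply: jdir_bound => i; exact: clam_itv.
- by move=> u; apply: measurable_jdir; exact: measurable_clam.
- exact: deform_mean.
- move=> H1 H2; split.
    by rewrite -[RHS]H1; apply: eq_Rintegral => t _; rewrite jdir_sum.
  by rewrite -[RHS]H2; apply: eq_Rintegral => t _; rewrite jdir_sum.
Qed.

Lemma loop_mean k : \int[P]_t loop k beta a b (clam t) = 0.
Proof. exact: (ids_concl k).1. Qed.

Lemma loop_var k : 0 <= beta -> \int[P]_t (loop k beta a b (clam t)) ^+ 2 <=
  (4 * beta * n%:R * bnd k ^+ 2 + `|a - (beta / 2 * (n.-1)%:R + 1)| + bnd k ^+ 2) *
    \int[P]_t psum (clam t) (2 * k) +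
  `|b - (beta / 2 * (n.-1)%:R + 1)| * \int[P]_t psum (clam t) (2 * k.+1).
Proof.
move=> beta0; rewrite (ids_concl k).2.
set A := (_ + _ + _); set B := `|b - _|.
have iZ (C : R) m : P.-integrable setT (EFin \o (fun t => C * psum (clam t) m)).
  by have := integrableZl measurableT C (integrable_psum m).
rewrite -!RintegralZl//; try exact: integrable_psum.
rewrite -RintegralD//; apply: le_Rintegral => //.
- apply: (@integrable_bounded _ _ _ _ _ (\sum_u `|@jexp R n beta a b u| * (bnd k * 2) ^+ 2)).
    apply: measurable_sum => u; apply: measurable_funM => //; apply: measurable_funX.
    by apply: measurable_jdir; exact: measurable_clam.
  move=> t; apply: (le_trans (ler_norm_sum _ _ _)); apply: ler_sum => u _.
  have b0 : 0 <= bnd k by rewrite /bnd addr_ge0.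
  rewrite normrM ler_wpM2l// normrX lerXn2r ?nnegrE// ?mulr_ge0//.
  by apply: jdir_bound => i; exact: clam_itv.
- by have := integrableD measurableT (iZ A (2 * k)%N) (iZ B (2 * k.+1)%N).
- by move=> t _; apply: jdir_sum_sqr_le => // i; exact: clam_itv.
Qed.

End jacobi_law.

(** * Concentration of the power sums *)

Section almost_sure.
Context (R : realType) d (T : measurableType d) (P : probability T R).

Lemma ae_forall_nat (Q : nat -> T -> Prop) :
  (forall k, {ae P, forall t, Q k t}) -> {ae P, forall t, forall k, Q k t}.
Proof.
move=> H; have := negligible_bigcup (fun k => H k); apply: negligibleS.
by move=> t /= /existsNP[k Qk]; exists k.
Qed.

Lemma sum_inv_sqr_le (m : nat) : \sum_(0 <= i < m) (i.+1%:R ^- 2 : R) <= 2.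
Proof.
case: m => [|m]; first by rewrite big_nil.
(* The sharper bound is the one that induction can carry, through
   [1 / (x + 1)^2 <= 1 / x - 1 / (x + 1)]. *)
suff : \sum_(0 <= i < m.+1) (i.+1%:R ^- 2 : R) <= 2 - m.+1%:R^-1.
  by move=> /le_trans; apply; rewrite lerBlDr lerDl invr_ge0.
elim: m => [|m IH].
  by rewrite big_nat1 expr1n invr1; lra.
rewrite big_nat_recr//= (le_trans (lerD IH (lexx _)))// -addrA lerD2l.
have -> : m.+2%:R = m.+1%:R + 1 :> R by rewrite -natr1.
have : 0 < m.+1%:R :> R by [].
move: m.+1%:R => x x0.
have x1 : 0 < x + 1 by rewrite ltr_wpDr.
have : (x + 1) ^- 2 <= x^-1 - (x + 1)^-1; last by lra.
have -> : x^-1 - (x + 1)^-1 = x^-1 * (x + 1)^-1.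
  by field; rewrite !gt_eqF.
rewrite expr2 invfM ler_pM2r ?invr_gt0// lef_pV2 ?posrE//.
by rewrite lerDl.
Qed.

(** Borel-Cantelli in integrated form: the series has a finite mean, hence is finite almost
    everywhere, hence its terms tend to 0. *)
Lemma ae_cvg0 (X : nat -> T -> R) (C : R) :
  (forall n, measurable_fun setT (X n)) -> (forall n t, 0 <= X n t) ->
  (\forall n \near \oo, (\int[P]_t (X n t)%:E <= (C / n%:R ^+ 2)%:E)%E) ->
  {ae P, forall t, X n t @[n --> \oo] --> 0}.
Proof.
move=> mX X0 [N _ HN].
(* The shift drops the indices where the bound is not granted, and the shifted bound is at most
   [C / (n + 1)^2]. *)
pose Y n t : \bar R := (X (n + N.+1)%N t)%:E.
have mY n : measurable_fun setT (Y n) by exact/measurable_EFinP.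
have Y0 n t : (0 <= Y n t)%E by rewrite lee_fin.
pose f t : \bar R := (\sum_(0 <= n <oo) Y n t)%E.
have mf : measurable_fun setT f.
  have := @ge0_emeasurable_sum _ _ _ setT Y predT (fun k x _ _ => Y0 k x) (fun k _ => mY k).
  by [].
have f0 t : (0 <= f t)%E by exact: nneseries_ge0.
have C0 : 0 <= C.
  have : (0 <= (C / N.+1%:R ^+ 2)%:E)%E.
    by apply: le_trans (HN N.+1 _) => //=; apply: integral_ge0 => t _; rewrite lee_fin.
  by rewrite lee_fin pmulr_lge0// invr_gt0 exprn_gt0.
have fint : P.-integrable setT f.
  apply/integrableP; split => //.
  under eq_integral => t _ do rewrite gee0_abs//.
  rewrite /f integral_nneseries//.
  apply: (@le_lt_trans _ _ (C * 2)%:E); last exact: ltry.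
  apply: lime_le.
    by apply: is_cvg_nneseries => n _ _; exact: integral_ge0.
  apply: nearW => m.
  apply: (@le_trans _ _ (\sum_(0 <= i < m) (C * (i.+1%:R ^- 2))%:E)%E).
    apply: lee_sum => i _.
    apply: (le_trans (HN (i + N.+1)%N _)); first by rewrite /= addnS -addSn leq_addl.
    rewrite lee_fin ler_wpM2l// lef_pV2 ?posrE ?exprn_gt0 ?ltr0n ?addn_gt0 ?orbT//.
    by rewrite lerXn2r ?nnegrE// ler_nat addnS ltnS leq_addr.
  by rewrite sumEFin lee_fin -mulr_sumr ler_wpM2l// sum_inv_sqr_le.
have := integrable_ae measurableT fint; apply: filterS => t /(_ I) ft.
have ftoo : (\sum_(0 <= n <oo) Y n t < +oo)%E by rewrite -ge0_fin_numE// f0.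
have Yt : Y n t @[n --> \oo] --> (0 : \bar R).
  apply: (@squeeze_cvge _ _ _ _ (fun=> 0%E) _ (fun n => \sum_(n <= k <oo) Y k t)%E).
  - apply: nearW => n; rewrite Y0/=.
    have := @nneseries_lim_ge R (Y ^~ t) predT n n.+1 (fun k _ _ => Y0 k t).
    by rewrite big_nat1.
  - exact: cvg_cst.
  - by apply: (nneseries_tail_cvg ftoo) => k _.
rewrite -(cvg_shiftn N.+1).
by move/fine_cvgP : Yt => [].
Qed.

End almost_sure.

Section loop_estimates.
Context (R : realType).

(** Linearises the quadratic part of the loop function, which closes the recursion on mean power
    sums without any control of correlations. *)
Lemma psumM_le n (x : 'I_n -> R) p q : (forall i, 0 < x i < 1) ->
  psum x p * psum x q <= 2 * n%:R * psum x (p + q).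
Proof.
move=> x01; have x0 i : 0 <= x i by have /andP[/ltW] := x01 i.
apply: (@le_trans _ _ (\sum_i \sum_j (x i ^+ (p + q) + x j ^+ (p + q)))).
  rewrite /psum mulr_suml; apply: ler_sum => i _.
  by rewrite mulr_sumr; apply: ler_sum => j _; exact: mon_le_sum.
under eq_bigr do rewrite big_split/= sumr_const card_ord.
rewrite big_split/= sumr_const card_ord sumrMnl -/(psum x (p + q)).
by rewrite -[psum x (p + q) *+ n]mulr_natl; lra.
Qed.

Lemma psum0 n (x : 'I_n -> R) : psum x 0 = n%:R.
Proof. by rewrite /psum (eq_bigr (fun=> 1))// sumr_const card_ord. Qed.

Lemma pconv_le n (x : 'I_n -> R) k : (forall i, 0 < x i < 1) ->
  pconv x k <= 2 * n%:R * k.+1%:R * psum x k.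
Proof.
move=> x01; apply: (@le_trans _ _ (\sum_(p < k.+1) 2 * n%:R * psum x k)).
  apply: ler_sum => p _; rewrite (le_trans (psumM_le _ _ x01))// subnK//.
  by rewrite -ltnS.
by rewrite sumr_const card_ord -mulr_natr; lra.
Qed.

(** The two extreme terms contain [psum x 0 = n] and are linear in [psum x k.+1]. In the recursion
    they join the coefficient of the top moment, while the remaining sum is smaller by a factor
    [theta]. *)
Lemma pconvS n (x : 'I_n -> R) k : pconv x k.+1 = 2 * n%:R * psum x k.+1 +
  \sum_(p < k) psum x (k - p) * psum x p.+1.
Proof.
rewrite /pconv big_ord_recl big_ord_recr/= subn0 psum0 /bump/= add1n subnn psum0.
rewrite (eq_bigr (fun p : 'I_k => psum x (k - p) * psum x p.+1)); last first.
  by move=> p _; rewrite /bump/= add1n subSS.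
by lra.
Qed.

(** The term [beta * n] coming from [pconv x k.+1] cancels the one inside [2 * ee], which leaves the
    coefficient [a + b + (1 - beta / 2) k], dominated by [b]. *)
Lemma loop_le n (x : 'I_n -> R) k (beta a b : R) : (forall i, 0 < x i < 1) ->
  (0 < n)%N -> 0 <= beta ->
  loop k beta a b x <=
  (beta * n%:R * k.+1%:R + (1 - beta / 2) * k.+1%:R + a -
    (beta / 2 * (n.-1)%:R + 1)) * psum x k -
  (a + b + (1 - beta / 2) * k%:R) * psum x k.+1.
Proof.
move=> x01 n0 beta0.
have n1 : (n.-1)%:R = n%:R - 1 :> R.
  by rewrite -[in RHS](prednK n0) -natr1 addrK.
have h1 := pconv_le k x01.
have h2 : 2 * n%:R * psum x k.+1 <= pconv x k.+1.
  rewrite pconvS lerDl; apply: sumr_ge0 => p _.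
  by apply: mulr_ge0; apply: sumr_ge0 => i _; have /andP[/ltW ? _] := x01 i; rewrite exprn_ge0.
have b20 : 0 <= beta / 2 by rewrite divr_ge0.
have k1 : k.+1%:R = k%:R + 1 :> R by rewrite natr1.
have k2 : k.+2%:R = k%:R + 1 + 1 :> R by rewrite !natr1.
rewrite /loop n1 k2; rewrite k1 in h1 *.
move: (pconv x k) (pconv x k.+1) (psum x k) (psum x k.+1) n%:R k%:R h1 h2
  => c1 c2 p1 p2 N K h1 h2.
rewrite -subr_ge0; set D := (X in 0 <= X).
have -> : D = beta / 2 * ((2 * N * (K + 1) * p1 - c1) + (c2 - 2 * N * p2)).
  by rewrite /D; field.
by rewrite mulr_ge0// addr_ge0// subr_ge0.
Qed.

End loop_estimates.

Lemma cvg_bigsum (R : realType) (I : Type) (s : seq I) (f : I -> nat -> R) (l : I -> R) :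
  (forall i, f i n @[n --> \oo] --> l i) ->
  \sum_(i <- s) f i n @[n --> \oo] --> \sum_(i <- s) l i.
Proof.
move=> H; elim: s => [|i s IH].
  under eq_fun do rewrite big_nil.
  by rewrite big_nil; exact: cvg_cst.
under eq_fun do rewrite big_cons.
by rewrite big_cons; exact: cvgD.
Qed.

(** * Scaling of the parameters and deterministic convergence of the moments *)

Section asymptotics.
Context (R : realType).
Variables (beta tau : R) (a b : nat -> R).
Hypothesis beta0 : 0 < beta.
Hypothesis tau0 : 0 < tau.
Hypothesis hab : forall n : nat,
  beta / 2 * (n.-1)%:R < a n /\ beta / 2 * (n.-1)%:R < b n.
Hypothesis ha : (fun n : nat => beta / 2 * n%:R / a n) @ \oo --> tau.
Hypothesis hb : (fun n : nat => b n / n%:R) @ \oo --> +oo.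

Definition theta n : R := a n / b n.

Let bp0 : 0 < beta / 2. Proof. by rewrite divr_gt0. Qed.

Lemma a_gt0 n : 0 < a n.
Proof. by apply: le_lt_trans (hab n).1; rewrite mulr_ge0// ltW. Qed.

Lemma b_gt0 n : 0 < b n.
Proof. by apply: le_lt_trans (hab n).2; rewrite mulr_ge0// ltW. Qed.

Lemma theta_gt0 n : 0 < theta n.
Proof. by rewrite divr_gt0 ?a_gt0 ?b_gt0. Qed.

Lemma cvg_a_n : a n / n%:R @[n --> \oo] --> beta / 2 / tau.
Proof.
rewrite (_ : (fun n => _) = fun n => beta / 2 * (beta / 2 * n%:R / a n)^-1).
  by apply: cvgM; [exact: cvg_cst|apply: cvgV => //; rewrite gt_eqF].
apply/funext => n; have [n0|n0] := eqVneq (n%:R : R) 0.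
  by rewrite n0 mulr0 mul0r invr0 !mulr0.
by field; rewrite n0 !gt_eqF// a_gt0.
Qed.

Lemma near_b (C : R) : \forall n \near \oo, C * n%:R <= b n.
Proof.
have /cvgryPge/(_ C) := hb; apply: filterS2 (nbhs_infty_gt 0) => n n0.
by rewrite ler_pdivlMr// ltr0n.
Qed.

Lemma near_a : exists2 K : R, 0 < K &
  \forall n \near \oo, n%:R <= K * a n /\ a n <= K * n%:R.
Proof.
pose l := beta / 2 / tau; have l0 : 0 < l by rewrite divr_gt0.
have h1 : \forall n \near \oo, a n / n%:R < 2 * l.
  by apply: (cvgr_lt _ cvg_a_n); rewrite -/l ltr_pMl// ltr1n.
have h2 : \forall n \near \oo, l / 2 < a n / n%:R.
  apply: (cvgr_gt _ cvg_a_n); rewrite -/l.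
  by rewrite ltr_pdivrMr// ltr_pMr// ltr1n.
exists (2 * l + 2 / l); first by rewrite addr_gt0 ?mulr_gt0 ?invr_gt0.
apply: filterS3 h1 h2 (nbhs_infty_gt 0) => n h1 h2 n0.
have n0' : 0 < n%:R :> R by rewrite ltr0n.
have a0 := a_gt0 n; split.
- rewrite mulrDl (@le_trans _ _ (2 / l * a n))//; last first.
    rewrite lerDr; apply: mulr_ge0; last exact: ltW.
    by apply: mulr_ge0 => //; exact: ltW.
  move: h2; rewrite ltr_pdivlMr// => /ltW h2.
  rewrite mulrAC ler_pdivlMr// mulrC.
  by move: h2; rewrite mulrAC ler_pdivrMr// [a n * 2]mulrC.
- rewrite mulrDl (@le_trans _ _ (2 * l * n%:R))//; last first.
    by rewrite lerDl mulr_ge0// divr_ge0// ltW.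
  by move: h1; rewrite ltr_pdivrMr// => /ltW.
Qed.

Lemma cvg_theta : theta n @[n --> \oo] --> (0 : R).
Proof.
have hV : (b n / n%:R)^-1 @[n --> \oo] --> (0 : R).
  apply/gtr0_cvgV0 => //; apply: filterS (nbhs_infty_gt 0) => n n0.
  by rewrite divr_gt0 ?b_gt0// ltr0n.
have h : (a n / n%:R) * (b n / n%:R)^-1 @[n --> \oo] --> beta / 2 / tau * 0.
  by apply: cvgM => //; exact: cvg_a_n.
rewrite mulr0 in h.
apply: cvg_trans h; apply: near_eq_cvg.
apply: filterS (nbhs_infty_gt 0) => n n0; rewrite /theta.
have n0' : n%:R != 0 :> R by rewrite pnatr_eq0 -lt0n.
by rewrite invfM invrK mulrACA mulVf// mulr1.
Qed.

Lemma cvg_inv_n : (n%:R^-1 : R) @[n --> \oo] --> (0 : R).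
Proof.
apply/gtr0_cvgV0; last exact: cvgr_idn.
by apply: filterS (nbhs_infty_gt 0) => n n0; rewrite ltr0n.
Qed.

(** The exponent shift [e_beta] of the Jacobi density. *)
Definition edge n : R := beta / 2 * (n.-1)%:R + 1.

Lemma cvg_edge_n : edge n / n%:R @[n --> \oo] --> beta / 2.
Proof.
have h : beta / 2 + (1 - beta / 2) * n%:R^-1 @[n --> \oo] --> beta / 2 + (1 - beta / 2) * 0.
  by apply: cvgD; [exact: cvg_cst|apply: cvgM; [exact: cvg_cst|exact: cvg_inv_n]].
rewrite mulr0 addr0 in h; apply: cvg_trans h; apply: near_eq_cvg.
apply: filterS (nbhs_infty_gt 0) => n n0.
have n0' : n%:R != 0 :> R by rewrite pnatr_eq0 -lt0n.
have n1 : (n.-1)%:R = n%:R - 1 :> R by rewrite -[in RHS](prednK n0) -natr1 addrK.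
by rewrite /edge n1; field; rewrite n0'.
Qed.

Definition smom (x : forall n, 'I_n -> R) k n : R :=
  psum (x n) k / (n%:R * theta n ^+ k).

(** The natural size of [loop]: [pconv] at order [k], [a] times the power sum of order [k] and [b]
    times the one of order [k + 1] are all of order [n^2 theta^k]. *)
Definition sloop (x : forall n, 'I_n -> R) k n : R :=
  loop k beta (a n) (b n) (x n) / (n%:R ^+ 2 * theta n ^+ k).

(** Coefficient of the top moment once [loop] is divided by [n^2 theta^k]. The dominant term
    [a n / n] comes from [b], since [b theta = a]; all the others carry a factor [theta]. *)
Definition kappa k n : R := beta * theta n +
  (1 - beta / 2) * k.+2%:R * theta n / n%:R +
  (theta n * (a n / n%:R) + a n / n%:R - 2 * (theta n * (edge n / n%:R))).

(** Pure algebra: the normalised [loop], solved for its top moment, so that limits can be taken at a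
    fixed sample point. *)
Lemma sloopE (x : forall n, 'I_n -> R) k n : (0 < n)%N ->
  kappa k n * smom x k.+1 n =
  beta / 2 * (\sum_(p < k.+1) smom x (k - p) n * smom x p n) -
  theta n * (beta / 2 * \sum_(p < k) smom x (k - p) n * smom x p.+1 n) +
  ((1 - beta / 2) * k.+1%:R / n%:R + a n / n%:R - edge n / n%:R) * smom x k n -
  sloop x k n.
Proof.
move=> n0.
have n0' : n%:R != 0 :> R by rewrite pnatr_eq0 -lt0n.
have th0 : theta n != 0 by rewrite gt_eqF// theta_gt0.
have b0 : b n != 0 by rewrite gt_eqF// b_gt0.
have -> : \sum_(p < k.+1) smom x (k - p) n * smom x p n =
    pconv (x n) k / (n%:R ^+ 2 * theta n ^+ k).
  rewrite /pconv mulr_suml; apply: eq_bigr => p _.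
  have pk : (p <= k)%N by rewrite -ltnS.
  rewrite /smom mulrACA -invfM; congr (_ / _).
  by rewrite mulrACA -expr2 -exprD subnK.
have -> : theta n * (beta / 2 * \sum_(p < k) smom x (k - p) n * smom x p.+1 n) =
    beta / 2 * ((pconv (x n) k.+1 - 2 * n%:R * psum (x n) k.+1) / (n%:R ^+ 2 * theta n ^+ k)).
  rewrite pconvS addrAC subrr add0r mulrCA; congr (_ * _).
  rewrite mulr_suml mulr_sumr; apply: eq_bigr => p _.
  have pk : (k - p + p.+1 = k.+1)%N by rewrite addnS subnK// ltnW.
  have -> : smom x (k - p) n * smom x p.+1 n =
      psum (x n) (k - p) * psum (x n) p.+1 / (n%:R ^+ 2 * (theta n ^+ k * theta n)).
    rewrite /smom mulrACA -invfM; congr (_ / _).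
    by rewrite mulrACA -expr2 -exprD pk -exprSr.
  by field; rewrite n0' th0 expf_neq0.
rewrite /sloop /smom /kappa /loop -/(edge n).
rewrite (exprSr (theta n) k).
have tk0 : theta n ^+ k != 0 by rewrite expf_neq0.
move: (theta n ^+ k) tk0 => tk tk0.
have -> : b n = a n / theta n by rewrite /theta; field; rewrite b0 gt_eqF// a_gt0.
move: (theta n) th0 => th th0.
by field; rewrite n0' th0 tk0.
Qed.

Lemma cvg_kappa k : kappa k n @[n --> \oo] --> beta / 2 / tau.
Proof.
rewrite [X in _ --> X](_ : _ = beta * 0 + (1 - beta / 2) * k.+2%:R * 0 * 0 +
  (0 * (beta / 2 / tau) + beta / 2 / tau - 2 * (0 * (beta / 2)))); last by ring.
have ct (c : R) : (fun=> c) @ \oo --> c by exact: cvg_cst.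
apply: cvgD; first apply: cvgD.
- by apply: cvgM => //; exact: cvg_theta.
- by apply: cvgM; [apply: cvgM => //; exact: cvg_theta|exact: cvg_inv_n].
- apply: cvgB; first apply: cvgD.
  + by apply: cvgM; [exact: cvg_theta|exact: cvg_a_n].
  + exact: cvg_a_n.
  + by apply: cvgM => //; apply: cvgM; [exact: cvg_theta|exact: cvg_edge_n].
Qed.

(** In the limit [sloopE] reads [beta/(2 tau) m_(k+1) = beta/2 sum_p m_(k-p) m_p + (beta/(2 tau) -
    beta/2) m_k], which is the recursion for [m]; strong induction supplies the lower moments. *)
Lemma smom_cvg (x : forall n, 'I_n -> R) (m : nat -> R) :
  m 0%N = 1 ->
  (forall k, m k.+1 = (1 - tau) * m k + tau * \sum_(p < k.+1) m (k - p)%N * m p) ->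
  (forall k, sloop x k n @[n --> \oo] --> (0 : R)) ->
  forall k, smom x k n @[n --> \oo] --> m k.
Proof.
move=> m0 mS D0 k; elim/ltn_ind: k => k IH.
have ct (c : R) : (fun=> c) @ \oo --> c by exact: cvg_cst.
case: k IH => [_|k IH].
  rewrite m0; apply: cvg_trans (ct 1); apply: near_eq_cvg.
  apply: filterS (nbhs_infty_gt 0) => n n0.
  by rewrite /smom psum0 expr0 mulr1 divff// pnatr_eq0 -lt0n.
have l0 : beta / 2 / tau != 0 by rewrite gt_eqF// divr_gt0.
pose rhs n := beta / 2 * (\sum_(p < k.+1) smom x (k - p) n * smom x p n) -
  theta n * (beta / 2 * \sum_(p < k) smom x (k - p) n * smom x p.+1 n) +
  ((1 - beta / 2) * k.+1%:R / n%:R + a n / n%:R - edge n / n%:R) * smom x k n -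
  sloop x k n.
pose lrhs := beta / 2 * (\sum_(p < k.+1) m (k - p)%N * m p) -
  0 * (beta / 2 * \sum_(p < k) m (k - p)%N * m p.+1) +
  ((1 - beta / 2) * k.+1%:R * 0 + beta / 2 / tau - beta / 2) * m k - 0.
have crhs : rhs n @[n --> \oo] --> lrhs.
  apply: cvgB; last exact: D0.
  apply: cvgD; first apply: cvgB.
  - apply: cvgM => //; apply: cvg_bigsum => p; apply: cvgM; apply: IH.
      by rewrite ltnS leq_subr.
    by [].
  - apply: cvgM; first exact: cvg_theta.
    apply: cvgM => //; apply: cvg_bigsum => p; apply: cvgM; apply: IH.
      by rewrite ltnS leq_subr.
    by rewrite ltnS.
  - apply: cvgM; last exact: IH.
    apply: cvgB; last exact: cvg_edge_n.
    apply: cvgD; last exact: cvg_a_n.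
    by apply: cvgM => //; exact: cvg_inv_n.
have -> : m k.+1 = lrhs / (beta / 2 / tau).
  by rewrite mS /lrhs; field; rewrite !gt_eqF.
apply: cvg_trans (cvgM crhs (cvgV l0 (cvg_kappa k))); apply: near_eq_cvg.
near=> n; have n0 : (0 < n)%N by near: n; exact: nbhs_infty_gt.
transitivity (rhs n * (kappa k n)^-1) => //.
rewrite /rhs -sloopE// mulrC mulKf//.
near: n; exact: (cvgr_neq0 _ (cvg_kappa k)).
Unshelve. all: by end_near. Qed.

End asymptotics.

(** * Mean power sums and almost sure smallness of the loop functions *)

Section ensemble.
Context (R : realType) (d : measure_display) (T : measurableType d).
Unset Implicit Arguments.
Variables (P : probability T R) (beta tau : R) (a b : nat -> R).
Variables (lam w : forall n : nat, T -> 'I_n -> R) (c : R).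
Hypothesis beta0 : 0 < beta.
Hypothesis tau0 : 0 < tau.
Hypothesis hab : forall n : nat,
  beta / 2 * (n.-1)%:R < a n /\ beta / 2 * (n.-1)%:R < b n.
Hypothesis ha : (fun n : nat => beta / 2 * n%:R / a n) @ \oo --> tau.
Hypothesis hb : (fun n : nat => b n / n%:R) @ \oo --> +oo.
Hypothesis mlam : forall (n : nat) (i : 'I_n), measurable_fun setT (fun t => lam n t i).
Hypothesis mw : forall (n : nat) (i : 'I_n), measurable_fun setT (fun t => w n t i).
Hypothesis rect : forall (n : nat) (A B : 'I_n -> set R),
  (forall i, measurable (A i)) -> (forall i, measurable (B i)) ->
  P [set t | forall i : 'I_n, A i (lam n t i) /\ B i (w n t i)] =
  (jac_prob beta (a n) (b n) A * dir_prob c B)%E.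

Set Implicit Arguments.

Definition EP n k : R := \int[P]_t psum (clam (lam n) t) k.

Lemma EP_ge0 n k : 0 <= EP n k.
Proof.
by apply: Rintegral_ge0 => t _; have /andP[] := psum_bound k (clam_itv (lam n) t).
Qed.

Let ipsum n k := integrable_psum P (mlam n) k.

(** The pointwise bound [loop_le], integrated, with the mean of [loop] equal to 0. *)
Lemma EP_step n k : (0 < n)%N ->
  (a n + b n + (1 - beta / 2) * k%:R) * EP n k.+1 <=
  (beta * n%:R * k.+1%:R + (1 - beta / 2) * k.+1%:R + a n -
    (beta / 2 * (n.-1)%:R + 1)) * EP n k.
Proof.
move=> n0; rewrite -subr_ge0 -(loop_mean (mlam n) (mw n) (rect n) k) /EP.
set C1 := (X in _ <= X * _ - _); set C2 := (X in _ <= _ - X * _).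
have iZ (C : R) m : P.-integrable setT (EFin \o (fun t => C * psum (clam (lam n) t) m)).
  by have := integrableZl measurableT C (ipsum n m).
rewrite -!RintegralZl// -RintegralB//; apply: le_Rintegral => //.
- have -> : (fun t => loop k beta (a n) (b n) (clam (lam n) t)) =
      (fun t => \sum_u @jexp R n beta (a n) (b n) u * jdir k (clam (lam n) t) u).
    by apply/funext => t; rewrite jdir_sum.
  apply: (@integrable_bounded _ _ _ _ _ (\sum_u `|@jexp R n beta (a n) (b n) u| *
      ((k.+1%:R + k.+2%:R) * 2))).
    apply: measurable_sum => u; apply: measurable_funM => //.
    by apply: measurable_jdir => i; exact: measurable_clam.
  move=> t; apply: (le_trans (ler_norm_sum _ _ _)); apply: ler_sum => u _.
  by rewrite normrM ler_wpM2l//; apply: jdir_bound => i; exact: clam_itv.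
- by have := integrableB measurableT (iZ C1 k) (iZ C2 k.+1).
- by move=> t _; apply: loop_le => //; [move=> i; exact: clam_itv|exact: ltW].
Qed.

(** For large [n] the left coefficient in [EP_step] is at least [b n / 2] and the right one at most
    [K1 * a n], so each step costs a constant times [theta]. *)
Lemma EP_bound k : exists2 C : R, 0 <= C &
  \forall n \near \oo, EP n k <= C * (n%:R * theta a b n ^+ k).
Proof.
elim: k => [|k [C C0 IH]].
  exists 1 => //; apply: nearW => n.
  have -> : EP n 0 = \int[P]_t (n%:R : R).
    by apply: eq_Rintegral => t _; rewrite psum0.
  rewrite Rintegral_cst// (_ : _ [set: T] = 1%E); last exact: probability_setT.
  by rewrite /= expr0 !mulr1 mul1r.
have [K K0 HK] := near_a beta0 tau0 hab ha.
pose K1 := (beta + 1) * k.+1%:R * K + 1.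
have K10 : 0 <= K1 by rewrite addr_ge0// !mulr_ge0// ?addr_ge0// ltW.
exists (2 * K1 * C); first by rewrite !mulr_ge0.
(* Ensures [a + b + (1 - beta / 2) k >= b / 2] even when [1 - beta / 2] is negative. *)
have Hb := near_b hb (beta * k%:R).
near=> n.
have n0 : (0 < n)%N by near: n; exact: nbhs_infty_gt.
have n1 : 1 <= n%:R :> R by rewrite ler1n.
have [Kn _] : n%:R <= K * a n /\ a n <= K * n%:R by near: n.
have bn : beta * k%:R * n%:R <= b n by near: n.
have En : EP n k <= C * (n%:R * theta a b n ^+ k) by near: n.
have a0 := a_gt0 beta0 hab n; have b0 := b_gt0 beta0 hab n.
have C1a : beta * n%:R * k.+1%:R + (1 - beta / 2) * k.+1%:R + a n -
    (beta / 2 * (n.-1)%:R + 1) <= K1 * a n.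
  have h1 : (beta + 1) * k.+1%:R * n%:R <= (beta + 1) * k.+1%:R * (K * a n).
    by rewrite ler_wpM2l// mulr_ge0// addr_ge0// ltW.
  have h2 : k.+1%:R <= k.+1%:R * n%:R :> R by rewrite ler_peMr.
  have h3 : 0 <= beta / 2 * k.+1%:R by rewrite mulr_ge0// divr_ge0// ltW.
  have h4 : 0 <= beta / 2 * (n.-1)%:R by rewrite mulr_ge0// divr_ge0// ltW.
  rewrite /K1.
  move: (k.+1%:R : R) ((n.-1)%:R : R) (n%:R : R) (a n) h1 h2 h3 h4 => u v N A h1 h2 h3 h4.
  have -> : ((beta + 1) * u * K + 1) * A = (beta + 1) * u * (K * A) + A by ring.
  lra.
have C2b : b n / 2 <= a n + b n + (1 - beta / 2) * k%:R.
  have h1 : beta * k%:R <= beta * k%:R * n%:R by rewrite ler_peMr// mulr_ge0// ltW.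
  have h2 : 0 <= k%:R :> R by [].
  move: (k%:R : R) h1 h2 bn => u h1 h2 bn.
  lra.
have := EP_step k n0 => H.
have : b n / 2 * EP n k.+1 <= K1 * a n * (C * (n%:R * theta a b n ^+ k)).
  apply: (le_trans (ler_wpM2r (EP_ge0 _ _) C2b)); apply: (le_trans H).
  apply: (le_trans (ler_wpM2r (EP_ge0 _ _) C1a)).
  by rewrite ler_wpM2l// mulr_ge0// ltW.
have b20 : 0 < b n / 2 by rewrite divr_gt0.
rewrite mulrC -ler_pdivlMr// => /le_trans; apply.
rewrite le_eqVlt; apply/orP; left; apply/eqP.
rewrite exprS; move: (theta a b n ^+ k) => tk; rewrite /theta.
by field; rewrite gt_eqF.
Unshelve. all: by end_near. Qed.

(** In [loop_var] the first coefficient is [O(n)] and the second [O(b)]; with [EP_bound] both terms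
    are [O(n^2 theta^(2k))], to be divided by [n^4 theta^(2k)]. *)
Lemma sloop_var k : exists C : R, \forall n \near \oo,
  (\int[P]_t (sloop beta a b (fun m => clam (lam m) t) k n ^+ 2)%:E <=
    (C / n%:R ^+ 2)%:E)%E.
Proof.
have [K K0 HK] := near_a beta0 tau0 hab ha.
have [C1 C10 H1] := EP_bound (2 * k).
have [C2 C20 H2] := EP_bound (2 * k.+1).
pose B : R := k.+1%:R + k.+2%:R.
pose A : R := 4 * beta * B ^+ 2 + K + beta + 1 + B ^+ 2.
exists (A * C1 + 2 * C2 * K).
have Hb1 := near_b hb (beta + 1); have Hb2 := near_b hb K.
near=> n.
have n0 : (0 < n)%N by near: n; exact: nbhs_infty_gt.
have n1 : 1 <= n%:R :> R by rewrite ler1n.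
have n0' : 0 < n%:R :> R by rewrite ltr0n.
have [_ Kn] : n%:R <= K * a n /\ a n <= K * n%:R by near: n.
have bn1 : (beta + 1) * n%:R <= b n by near: n.
have bn2 : K * n%:R <= b n by near: n.
have E1 : EP n (2 * k) <= C1 * (n%:R * theta a b n ^+ (2 * k)) by near: n.
have E2 : EP n (2 * k.+1) <= C2 * (n%:R * theta a b n ^+ (2 * k.+1)) by near: n.
have a0 := a_gt0 beta0 hab n; have b0 := b_gt0 beta0 hab n.
have t0 : 0 < theta a b n by rewrite divr_gt0.
have ab : a n <= b n by exact: le_trans bn2.
have e1 : `|edge beta n| <= (beta + 1) * n%:R.
  have h : (n.-1)%:R <= n%:R :> R by rewrite ler_nat leq_pred.
  have h0 : 0 <= (n.-1)%:R :> R by [].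
  rewrite ger0_norm /edge; last by rewrite addr_ge0// mulr_ge0// divr_ge0// ltW.
  have := ler_wpM2l (ltW beta0) h; have := mulr_ge0 (ltW beta0) h0.
  by move: ((n.-1)%:R : R) h h0 => u h h0; lra.
have V := loop_var (mlam n) (mw n) (rect n) k (ltW beta0).
have AB : 4 * beta * n%:R * B ^+ 2 + `|a n - edge beta n| + B ^+ 2 <= A * n%:R.
  have q1 : `|a n - edge beta n| <= K * n%:R + (beta + 1) * n%:R.
    by rewrite (le_trans (ler_normB _ _))// lerD// gtr0_norm.
  have q2 : B ^+ 2 <= B ^+ 2 * n%:R by rewrite ler_peMr// sqr_ge0.
  by rewrite /A; lra.
have Bb : `|b n - edge beta n| <= 2 * b n.
  have q := ler_normB (b n) (edge beta n); rewrite (gtr0_norm b0) in q.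
  by have := le_trans e1 bn1; lra.
have A0 : 0 <= A.
  have B2 : 0 <= B ^+ 2 by rewrite sqr_ge0.
  have := mulr_ge0 (ltW beta0) B2; rewrite /A; move: (B ^+ 2) B2 => B2 B20 bB2.
  by rewrite -mulrA; move: (beta * B2) bB2 => x x0; move: (ltW beta0) (ltW K0) => *; lra.
have L2 : \int[P]_t (loop k beta (a n) (b n) (clam (lam n) t)) ^+ 2 <=
    (A * C1 + 2 * C2 * K) * (n%:R ^+ 2 * theta a b n ^+ (2 * k)).
  apply: (le_trans V); rewrite [leRHS]mulrDl; apply: lerD.
    apply: (@le_trans _ _ (A * n%:R * (C1 * (n%:R * theta a b n ^+ (2 * k))))).
      by apply: ler_pM => //; [rewrite !addr_ge0// ?mulr_ge0// ?sqr_ge0// ltW|exact: EP_ge0].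
    by rewrite le_eqVlt; apply/orP; left; apply/eqP; ring.
  apply: (@le_trans _ _ (2 * b n * (C2 * (n%:R * theta a b n ^+ (2 * k.+1))))).
    by apply: ler_pM => //; exact: EP_ge0.
  have -> : theta a b n ^+ (2 * k.+1) = theta a b n ^+ (2 * k) * theta a b n ^+ 2.
    by rewrite -exprD mulnS addnC.
  (* The large factor [b] is absorbed here: [b theta^2 = a theta <= a], and [a] is [O(n)]. *)
  have th2 : b n * theta a b n ^+ 2 <= K * n%:R.
    rewrite expr2 mulrA (_ : b n * theta a b n = a n); last first.
      by rewrite /theta mulrC divfK// gt_eqF.
    apply: (le_trans _ Kn); rewrite ler_piMr ?(ltW a0)//.
    by rewrite ler_pdivrMr// mul1r.
  have := ler_wpM2l (mulr_ge0 (mulr_ge0 (mulr_ge0 (ler0n R 2) C20) (ltW n0'))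
    (exprn_ge0 (2 * k) (ltW t0))) th2.
  by congr (_ <= _); ring.
have iL : P.-integrable setT (EFin \o (fun t => (loop k beta (a n) (b n) (clam (lam n) t)) ^+ 2)).
  have -> : (fun t => (loop k beta (a n) (b n) (clam (lam n) t)) ^+ 2) =
      (fun t => (\sum_u @jexp R n beta (a n) (b n) u * jdir k (clam (lam n) t) u) ^+ 2).
    by apply/funext => t; rewrite jdir_sum.
  apply: (@integrable_bounded _ _ _ _ _ ((\sum_u `|@jexp R n beta (a n) (b n) u| * (B * 2)) ^+ 2)).
    apply: measurable_funX; apply: measurable_sum => u; apply: measurable_funM => //.
    by apply: measurable_jdir => i; exact: measurable_clam.
  move=> t; rewrite normrX lerXn2r ?nnegrE//.
    by apply: sumr_ge0 => u _; rewrite !mulr_ge0// /B addr_ge0.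
  apply: (le_trans (ler_norm_sum _ _ _)); apply: ler_sum => u _.
  by rewrite normrM ler_wpM2l//; apply: jdir_bound => i; exact: clam_itv.
pose q : R := (n%:R ^+ 2 * theta a b n ^+ k) ^- 2.
have q0 : 0 <= q by rewrite invr_ge0 exprn_ge0// mulr_ge0// exprn_ge0// ltW.
rewrite (_ : (fun t => _) = (fun t => q%:E *
    ((loop k beta (a n) (b n) (clam (lam n) t)) ^+ 2)%:E)%E); last first.
  by apply/funext => t; rewrite -EFinM /sloop exprMn mulrC exprVn.
rewrite ge0_integralZl_EFin//; last 2 first.
- by move=> t _; rewrite lee_fin sqr_ge0.
- by have /integrableP[] := iL.
rewrite -[X in (_ * X)%E]fineK; last exact: integrable_fin_num iL.
rewrite -EFinM lee_fin; apply: (le_trans (ler_wpM2l q0 L2)).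
rewrite le_eqVlt; apply/orP; left; apply/eqP.
rewrite /q mulnC exprM; field.
by rewrite gt_eqF//= expf_neq0// gt_eqF.
Unshelve. all: by end_near. Qed.

Lemma sloop_ae : {ae P, forall t, forall k,
  sloop beta a b (fun m => clam (lam m) t) k n @[n --> \oo] --> (0 : R)}.
Proof.
apply: ae_forall_nat => k; have [C HC] := sloop_var k.
have : {ae P, forall t, sloop beta a b (fun m => clam (lam m) t) k n ^+ 2
    @[n --> \oo] --> (0 : R)}.
  apply: (ae_cvg0 (C := C)) => //.
  - move=> n; apply: measurable_funX; apply: measurable_funM => //.
    have -> : (fun t => loop k beta (a n) (b n) (clam (lam n) t)) =
        (fun t => \sum_u @jexp R n beta (a n) (b n) u * jdir k (clam (lam n) t) u).
      by apply/funext => t; rewrite jdir_sum.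
    apply: measurable_sum => u; apply: measurable_funM => //.
    by apply: measurable_jdir => i; exact: measurable_clam.
  - by move=> n t; rewrite sqr_ge0.
apply: filterS => t H.
have H2 : Num.sqrt (sloop beta a b (fun m => clam (lam m) t) k n ^+ 2)
    @[n --> \oo] --> Num.sqrt (0 : R).
  by apply: (cvg_comp _ _ H); exact: sqrt_continuous.
rewrite sqrtr0 in H2.
apply/norm_cvg0P; apply: cvg_trans H2; apply: near_eq_cvg; apply: nearW => n.
by rewrite /= sqrtr_sqr.
Qed.

End ensemble.

(** * Dirichlet weights *)

Section beta_integral.
Context (R : realType).
Notation mu := (@lebesgue_measure R).
Implicit Types p q c : R.

Definition beta_integrand p q (u : R) : R := u `^ (p - 1) * (1 - u) `^ (q - 1).

Definition Beta p q : \bar R := (\int[mu]_(u in `]0%R, 1%R[) (beta_integrand p q u)%:E)%E.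

Lemma beta_integrand_ge0 p q u : 0 <= beta_integrand p q u.
Proof. by rewrite mulr_ge0 ?powR_ge0. Qed.

Lemma measurable_beta_integrand p q : measurable_fun setT (beta_integrand p q).
Proof.
apply: measurable_funM => //.
by apply: (measurableT_comp (measurable_powR _)); exact: measurable_funB.
Qed.

Let mb p q (D : set R) : measurable D ->
  measurable_fun D (fun u => (beta_integrand p q u)%:E).
Proof.
move=> mD; apply/measurable_EFinP; apply: measurable_funTS.
exact: measurable_beta_integrand.
Qed.

Lemma Beta_ge0 p q : (0 <= Beta p q)%E.
Proof. by apply: integral_ge0 => u _; rewrite lee_fin beta_integrand_ge0. Qed.

(** [u + (1 - u) = 1] under the integral. *)
Lemma BetaD p q : (Beta (p + 1) q + Beta p (q + 1) = Beta p q)%E.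
Proof.
rewrite /Beta -ge0_integralD//; try exact: mb; last first.
- by move=> u _; rewrite lee_fin beta_integrand_ge0.
- by move=> u _; rewrite lee_fin beta_integrand_ge0.
apply: eq_integral => u; rewrite inE/= in_itv/= => /andP[u0 u1].
rewrite -EFinD /beta_integrand; congr EFin.
have v0 : 0 < 1 - u by rewrite subr_gt0.
have E1 : u `^ (p + 1 - 1) = u * u `^ (p - 1).
  by rewrite -[X in X * _]powRr1 ?(ltW u0)// -powRD ?(gt_eqF u0) ?implybT//; congr (_ `^ _); ring.
have E2 : (1 - u) `^ (q + 1 - 1) = (1 - u) * (1 - u) `^ (q - 1).
  by rewrite -[X in X * _]powRr1 ?(ltW v0)// -powRD ?(gt_eqF v0) ?implybT//; congr (_ `^ _); ring.
by rewrite E1 E2; ring.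
Qed.

(* Integrating the derivative of [u ^ p (1 - u) ^ q] separately on the two sides
   of its maximum [p / (p + q)] keeps all integrands nonnegative. *)
Lemma Beta_parts p q : 0 < p -> 0 < q ->
  (p%:E * Beta p (q + 1) = q%:E * Beta (p + 1) q)%E.
Proof.
move=> p0 q0.
pose F (u : R) := u `^ p * (1 - u) `^ q.
pose f1 u := p * beta_integrand p (q + 1) u.
pose f2 u := q * beta_integrand (p + 1) q u.
have f10 u : 0 <= f1 u by rewrite mulr_ge0 ?(ltW p0)// beta_integrand_ge0.
have f20 u : 0 <= f2 u by rewrite mulr_ge0 ?(ltW q0)// beta_integrand_ge0.
have mf1 (D : set R) : measurable D -> measurable_fun D (fun u => (f1 u)%:E).
  move=> mD; apply/measurable_EFinP; apply: measurable_funTS.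
  by apply: measurable_funM => //; exact: measurable_beta_integrand.
have mf2 (D : set R) : measurable D -> measurable_fun D (fun u => (f2 u)%:E).
  move=> mD; apply/measurable_EFinP; apply: measurable_funTS.
  by apply: measurable_funM => //; exact: measurable_beta_integrand.
have dpow (r u : R) : 0 < u -> is_derive u (1 : R) (fun x : R => x `^ r) (r * u `^ (r - 1)).
  move=> u0; apply: DeriveDef; first by apply: derivable_powR; rewrite in_itv/= andbT.
  by rewrite -derive1E powR_derive1// in_itv/= andbT.
have d1m (u : R) : is_derive u (1 : R) (fun x : R => 1 - x) (0 - 1) by apply: is_deriveB.
have dF (u : R) : 0 < u < 1 -> is_derive u (1 : R) F (f1 u - f2 u).
  move=> /andP[u0 u1]; have v0 : 0 < 1 - u by rewrite subr_gt0.
  have h2 : is_derive u (1 : R) (fun x : R => (1 - x) `^ q) (q * (1 - u) `^ (q - 1) * (0 - 1)).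
    exact: (@is_derive1_comp R (fun x => x `^ q) (fun x => 1 - x) u _ _ (dpow q _ v0) (d1m u)).
  have h := is_deriveM (dpow p _ u0) h2.
  have -> : f1 u - f2 u = u `^ p *: (q * (1 - u) `^ (q - 1) * (0 - 1)) +
      (1 - u) `^ q *: (p * u `^ (p - 1)).
    rewrite /f1 /f2 /beta_integrand /GRing.scale/= !addrK; ring.
  exact: h.
have cpow (r u : R) : 0 < u -> {for u, continuous (fun x : R => x `^ r)}.
  move=> u0; apply/differentiable_continuous/derivable1_diffP.
  by have := dpow r u u0; case.
have c1m (u : R) : {for u, continuous (fun x : R => 1 - x)}.
  by apply: continuousB => //; exact: cst_continuous.
have cpow1 (r u : R) : u < 1 -> {for u, continuous (fun x : R => (1 - x) `^ r)}.
  move=> u1; apply: (@continuous_comp _ _ _ (fun x : R => 1 - x) (fun x => x `^ r)).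
    exact: c1m.
  by apply: cpow; rewrite subr_gt0.
have cb (p' q' u : R) : 0 < u < 1 -> {for u, continuous (beta_integrand p' q')}.
  by move=> /andP[u0 u1]; apply: continuousM; [exact: cpow|exact: cpow1].
have cf1 (u : R) : 0 < u < 1 -> {for u, continuous f1}.
  by move=> h; apply: continuousM; [exact: cst_continuous|exact: cb].
have cf2 (u : R) : 0 < u < 1 -> {for u, continuous f2}.
  by move=> h; apply: continuousM; [exact: cst_continuous|exact: cb].
have f12 (u : R) : 0 < u < 1 -> f1 u - f2 u =
    (p - (p + q) * u) * (u `^ (p - 1) * (1 - u) `^ (q - 1)).
  move=> /andP[u0 u1]; have v0 : 0 < 1 - u by rewrite subr_gt0.
  have E1 : u `^ (p + 1 - 1) = u * u `^ (p - 1).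
    by rewrite -[X in X * _]powRr1 ?(ltW u0)// -powRD ?(gt_eqF u0) ?implybT//; congr (_ `^ _); ring.
  have E2 : (1 - u) `^ (q + 1 - 1) = (1 - u) * (1 - u) `^ (q - 1).
    by rewrite -[X in X * _]powRr1 ?(ltW v0)// -powRD ?(gt_eqF v0) ?implybT//; congr (_ `^ _); ring.
  by rewrite /f1 /f2 /beta_integrand E1 E2; ring.
pose v := p / (p + q).
have pq0 : 0 < p + q by rewrite addr_gt0.
have v0 : 0 < v by rewrite divr_gt0.
have v1 : v < 1 by rewrite ltr_pdivrMr// mul1r ltrDl.
have cF (u : R) : 0 < u < 1 -> {for u, continuous F}.
  by move=> /andP[u0 u1]; apply: continuousM; [exact: cpow|exact: cpow1].
have F0 : F x @[x --> 0^'+] --> (0 : R).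
  have h1 : x `^ p @[x --> 0^'+] --> (0 : R) by exact: powR_cvg0.
  have h2 : (1 - x) `^ q @[x --> 0^'+] --> ((1 - 0) `^ q : R).
    by apply: cvg_at_right_filter; apply: cpow1; exact: ltr01.
  by rewrite -[X in _ --> X](mul0r ((1 - 0) `^ q)); exact: cvgM h1 h2.
have F1 : F x @[x --> 1^'-] --> (0 : R).
  have h1 : x `^ p @[x --> 1^'-] --> (1 `^ p : R).
    by apply: cvg_at_left_filter; apply: cpow; exact: ltr01.
  have h2 : (1 - x) `^ q @[x --> 1^'-] --> (0 : R).
    apply/cvg_at_leftP => u [ult ucvg].
    have /cvg_at_rightP := powR_cvg0 q0; apply; split; first by move=> n; rewrite subr_gt0.
    by rewrite -[X in _ --> X](subrr (1 : R)); apply: cvgB => //; exact: cvg_cst.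
  by rewrite -[X in _ --> X](mulr0 (1 `^ p)); exact: cvgM h1 h2.
have I1 : (\int[mu]_(u in `]0%R, v[) (f1 u - f2 u)%:E = (F v - 0)%:E)%E.
  apply: (@ge0_FTC2_oo _ _ F) => //.
  - move=> u /andP[u0 uv]; rewrite f12 ?u0 ?(lt_trans uv)//.
    rewrite mulr_ge0 ?mulr_ge0 ?powR_ge0// subr_ge0.
    by move: uv; rewrite /v ltr_pdivlMr// mulrC => /ltW.
  - move=> u /andP[u0 uv]; have u01 : 0 < u < 1 by rewrite u0 (lt_trans uv).
    by apply: continuousB; [exact: cf1|exact: cf2].
  - by move=> u /andP[u0 uv]; apply: dF; rewrite u0 (lt_trans uv).
  - by apply: cvg_at_left_filter; apply: cF; rewrite v0.
have I2 : (\int[mu]_(u in `]v, 1%R[) (f2 u - f1 u)%:E = (- 0 - - F v)%:E)%E.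
  apply: (@ge0_FTC2_oo _ _ (fun x => - F x)) => //.
  - move=> u /andP[vu u1]; have u01 : 0 < u < 1 by rewrite u1 (lt_trans v0).
    rewrite -opprB f12// -mulNr.
    rewrite mulr_ge0 ?mulr_ge0 ?powR_ge0// opprB subr_ge0.
    by move: vu; rewrite /v ltr_pdivrMr// mulrC => /ltW.
  - move=> u /andP[vu u1]; have u01 : 0 < u < 1 by rewrite u1 (lt_trans v0).
    by apply: continuousB; [exact: cf2|exact: cf1].
  - move=> u /andP[vu u1]; rewrite -opprB; apply: is_deriveN; apply: dF.
    by rewrite u1 (lt_trans v0).
  - by apply: cvgN; apply: cvg_at_right_filter; apply: cF; rewrite v0.
  - exact: cvgN.
rewrite subr0 in I1; rewrite oppr0 add0r opprK in I2.
have S1 : (\int[mu]_(u in `]0%R, v[) (f1 u)%:E = \int[mu]_(u in `]0%R, v[) (f2 u)%:E + (F v)%:E)%E.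
  rewrite -I1 -ge0_integralD//; try exact: mf2.
  - apply: eq_integral => u _; rewrite -EFinD; congr EFin; ring.
  - by move=> u _; rewrite lee_fin.
  - move=> u; rewrite /= in_itv/= => /andP[u0 uv]; rewrite lee_fin f12 ?u0 ?(lt_trans uv)//.
    rewrite mulr_ge0 ?mulr_ge0 ?powR_ge0// subr_ge0.
    by move: uv; rewrite /v ltr_pdivlMr// mulrC => /ltW.
  - apply/measurable_EFinP; apply: measurable_funB; apply/measurable_EFinP;
      [exact: mf1|exact: mf2].
have S2 : (\int[mu]_(u in `]v, 1%R[) (f2 u)%:E = \int[mu]_(u in `]v, 1%R[) (f1 u)%:E + (F v)%:E)%E.
  rewrite -I2 -ge0_integralD//; try exact: mf1.
  - apply: eq_integral => u _; rewrite -EFinD; congr EFin; ring.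
  - by move=> u _; rewrite lee_fin.
  - move=> u; rewrite /= in_itv/= => /andP[vu u1]; rewrite lee_fin.
    have u01 : 0 < u < 1 by rewrite u1 (lt_trans v0).
    rewrite -opprB f12// -mulNr mulr_ge0 ?mulr_ge0 ?powR_ge0// opprB subr_ge0.
    by move: vu; rewrite /v ltr_pdivrMr// mulrC => /ltW.
  - apply/measurable_EFinP; apply: measurable_funB; apply/measurable_EFinP;
      [exact: mf2|exact: mf1].
have split (f : R -> R) : (forall u, 0 <= f u) -> (forall D : set R, measurable D -> measurable_fun D (fun u => (f u)%:E)) ->
  (\int[mu]_(u in `]0%R, 1%R[) (f u)%:E =
   \int[mu]_(u in `]0%R, v[) (f u)%:E + \int[mu]_(u in `]v, 1%R[) (f u)%:E)%E.
  move=> f0 mf.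
  rewrite (integral_itv_obnd_cbnd (r := v))//; last exact: mf.
  rewrite -ge0_integral_setU//=.
  - congr (integral _ _ _); apply/seteqP; split => u /=; rewrite !in_itv/=.
      by move=> /andP[u0 u1]; have [uv|vu] := ltP u v; [left; rewrite u0|right; rewrite u1].
    move=> [/andP[u0 uv]|/andP[vu u1]]; first by rewrite u0 (lt_trans uv).
    by rewrite u1 (lt_le_trans v0).
  - by apply: mf; exact: measurableU.
  - by move=> u _; rewrite lee_fin.
  - rewrite disj_set2E; apply/eqP; rewrite -subset0 => u [] /=; rewrite !in_itv/=.
    by move=> /andP[_ uv] /andP[vu _]; move: (lt_le_trans uv vu); rewrite ltxx.
have E1 : (p%:E * Beta p (q + 1) = \int[mu]_(u in `]0%R, 1%R[) (f1 u)%:E)%E.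
  rewrite /Beta -ge0_integralZl_EFin ?(ltW p0)//; last exact: mb.
  by move=> u _; rewrite lee_fin beta_integrand_ge0.
have E2 : (q%:E * Beta (p + 1) q = \int[mu]_(u in `]0%R, 1%R[) (f2 u)%:E)%E.
  rewrite /Beta -ge0_integralZl_EFin ?(ltW q0)//; last exact: mb.
  by move=> u _; rewrite lee_fin beta_integrand_ge0.
(* Left of [v] the integral of [f1] exceeds that of [f2] by [F v], and right of [v] the roles are
   exchanged. After adding, [F v] occurs once in each total, so nothing has to be subtracted. *)
rewrite E1 E2 (split f1 f10 mf1) (split f2 f20 mf2) S1 S2.
by rewrite -addeA; congr (_ + _)%E; rewrite addeC.
Qed.

(** Two quantities are recovered from their sum and their ratio using products and sums only, so
    infinite values are allowed. *)
Let share (p q : R) (x y z : \bar R) : 0 < p -> 0 < q -> (0 <= x)%E -> (0 <= y)%E ->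
  (x + y = z -> p%:E * y = q%:E * x -> x = (p / (p + q))%:E * z)%E.
Proof.
move=> p0 q0 x0 y0 <- h; have pq0 : 0 < p + q by rewrite addr_gt0.
rewrite mulrC EFinM -muleA ge0_muleDr// h -ge0_muleDl ?lee_fin ?(ltW p0) ?(ltW q0)//.
by rewrite -EFinD muleA -EFinM mulVf ?mul1e// gt_eqF.
Qed.

Lemma BetaSl p q : 0 < p -> 0 < q ->
  (Beta (p + 1) q = (p / (p + q))%:E * Beta p q)%E.
Proof.
by move=> p0 q0; apply: (share p0 q0 (Beta_ge0 _ _) (Beta_ge0 _ _) (BetaD p q)); exact: Beta_parts.
Qed.

Lemma BetaSr p q : 0 < p -> 0 < q ->
  (Beta p (q + 1) = (q / (p + q))%:E * Beta p q)%E.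
Proof.
move=> p0 q0; rewrite [p + q]addrC.
apply: (share q0 p0 (Beta_ge0 _ _) (Beta_ge0 (p + 1) q)); first by rewrite addeC BetaD.
by apply/esym; exact: Beta_parts.
Qed.

(** Rising factorial, standing for [Gamma(x + j) / Gamma(x)]. *)
Definition rising (x : R) (j : nat) : R := \prod_(i < j) (x + i%:R).

Lemma rising_gt0 x j : 0 < x -> 0 < rising x j.
Proof. by move=> x0; apply: prodr_gt0 => i _; rewrite ltr_pwDl. Qed.

Lemma risingS x j : rising x j.+1 = rising x j * (x + j%:R).
Proof. by rewrite /rising big_ord_recr. Qed.

(** The quotient of Gamma functions is reached by unit steps, first in the left argument, then in
    the right one. *)
Lemma Beta_rising c q j l : 0 < c -> 0 < q -> (Beta (c + j%:R) (q + l%:R) =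
  (rising c j * rising q l / rising (c + q) (j + l))%:E * Beta c q)%E.
Proof.
move=> c0 q0; elim: l => [|l IH].
  rewrite addr0 addn0 [rising q 0]big_ord0 mulr1; elim: j => [|j IH].
    by rewrite addr0 /rising !big_ord0 divr1 mul1e.
  have -> : c + j.+1%:R = c + j%:R + 1 by rewrite -natr1 addrA.
  have cj : 0 < c + j%:R by rewrite ltr_wpDr.
  rewrite (BetaSl cj q0) IH muleA -EFinM; congr (_%:E * _)%E.
  rewrite !risingS.
  have h1 : rising (c + q) j != 0 by rewrite gt_eqF// rising_gt0// addr_gt0.
  have h2 : c + q + j%:R != 0 by rewrite gt_eqF// ltr_wpDr// addr_gt0.
  have h3 : c + j%:R + q = c + q + j%:R by rewrite addrAC.
  by rewrite h3; field; rewrite h1 h2.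
have -> : q + l.+1%:R = q + l%:R + 1 by rewrite -natr1 addrA.
have cj : 0 < c + j%:R by rewrite ltr_wpDr.
have ql : 0 < q + l%:R by rewrite ltr_wpDr.
rewrite (BetaSr cj ql) IH muleA -EFinM; congr (_%:E * _)%E.
rewrite addnS !risingS natrD.
have h1 : rising (c + q) (j + l) != 0 by rewrite gt_eqF// rising_gt0// addr_gt0.
have h2 : c + q + (j%:R + l%:R) != 0 by rewrite gt_eqF// ltr_wpDr// ?addr_ge0// addr_gt0.
have h3 : c + j%:R + (q + l%:R) != 0.
  by rewrite (_ : _ + _ = c + q + (j%:R + l%:R))//; ring.
by field; rewrite h1 h2.
Qed.

Lemma Beta_scale p q (r : R) : 0 < r ->
  (\int[mu]_(u in `]0%R, r[) (u `^ (p - 1) * (r - u) `^ (q - 1))%:E =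
  (r `^ (p + q - 1))%:E * Beta p q)%E.
Proof.
move=> r0.
pose h (u : R) : \bar R := (u `^ (p - 1) * (r - u) `^ (q - 1))%:E.
have h0 u : (0 <= h u)%E by rewrite lee_fin mulr_ge0 ?powR_ge0.
have mh : measurable_fun setT h.
  apply/measurable_EFinP; apply: measurable_funM => //.
  by apply: (measurableT_comp (measurable_powR _)); exact: measurable_funB.
have cc : continuous (fun _ : R => r) by move=> x; exact: cvg_cst.
have cm : continuous (fun x : R => r * x) by exact: mulrl_continuous.
have incr (x y : R) : 0 <= x -> y <= 1 -> x < y -> r * x < r * y.
  by move=> _ _ xy; rewrite ltr_pM2l.
have := @change_of_variables R (fun x => r * x) (fun=> r) 0 1 h ltr01 cm cc
  (fun x => is_derive_mull r x) (fun _ _ => ltW r0) incr h0 mh.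
rewrite mulr0 mulr1 => ->.
rewrite /Beta -ge0_integralZl_EFin ?powR_ge0//; last 2 first.
- by move=> u _; rewrite lee_fin beta_integrand_ge0.
- exact: mb.
apply: eq_integral => u; rewrite inE/= in_itv/= => /andP[u0 u1].
rewrite /h -!EFinM /beta_integrand; congr EFin.
have -> : r - r * u = r * (1 - u) by ring.
rewrite !powRM ?(ltW r0) ?(ltW u0) ?subr_ge0 ?(ltW u1)//.
have -> : r `^ (p + q - 1) = r `^ (p - 1) * r `^ (q - 1) * r.
  rewrite -[X in _ = _ * X]powRr1 ?(ltW r0)// -!powRD ?(gt_eqF r0) ?implybT//.
  by congr (_ `^ _); ring.
by ring.
Qed.

End beta_integral.

(** * Moments of linear statistics of Dirichlet weights *)

Section dirichlet_moments.
Local Open Scope ereal_scope.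
Context (R : realType).
Notation mu := (@lebesgue_measure R).
Variable c : R.
Hypothesis c0 : (0 < c)%R.
Implicit Types (r : R) (y : nat -> R) (u : seq R) (k m : nat).

Lemma iint_sum k m (F : 'I_m -> seq R -> \bar R) : (forall i s, 0 <= F i s) ->
  (forall i, measurable_at k (F i)) ->
  iint k (fun s => \sum_(i < m) F i s) = \sum_(i < m) iint k (F i).
Proof.
elim: m F => [|m IH] F F0 mF.
  by rewrite big_ord0 -[RHS](iint0 R k); apply: eq_iint => s _; rewrite big_ord0.
rewrite big_ord_recr/= -IH//.
rewrite -iintD//.
- by apply: eq_iint => s _; rewrite big_ord_recr.
- by move=> s; apply: sume_ge0.
- by apply: emeasurable_sum => i; exact: mF.
Qed.

(* Dirichlet density on the simplex of total mass [r], in the first coordinates [u]. *)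
Fixpoint ddens r u : R :=
  if u is x :: u' then (x `^ (c - 1) * (0 < x)%R%:R * ddens (r - x) u')%R
  else (r `^ (c - 1) * (0 < r)%R%:R)%R.

(** The linear statistic in which the last weight is the mass left over from [r]; it recurses like
    [ddens], so that both lose their first coordinate together. *)
Fixpoint dsum r y u : R :=
  if u is x :: u' then (x * y 0%N + dsum (r - x) (fun i => y i.+1) u')%R
  else (r * y 0%N)%R.

(* [dmom k y m / rising (k.+1 * c) m] is the [m]-th moment of [dsum]. *)
Fixpoint dmom k y m : R :=
  if k is k'.+1 then (\sum_(i < m.+1) 'C(m, i)%:R * rising c (m - i) * y 0%N ^+ (m - i) *
                      dmom k' (fun i => y i.+1) i)%R
  else (rising c m * y 0%N ^+ m)%R.

(** The normalising constant [Gamma(c)^(k+1) / Gamma((k+1) c)], as a telescoping product of Beta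
    integrals. *)
Fixpoint dconst k : \bar R :=
  if k is k'.+1 then Beta c (k'.+1%:R * c) * dconst k' else 1.

Lemma ddens_ge0 r u : (0 <= ddens r u)%R.
Proof. by elim: u r => [|x u IH] r /=; rewrite !mulr_ge0 ?powR_ge0. Qed.

Lemma ddens_neq0 r u y : (forall i, 0 <= y i)%R -> ddens r u != 0%R ->
  (0 < r)%R /\ (0 <= dsum r y u)%R.
Proof.
elim: u r y => [|x u IH] r y y0 /=; rewrite mulf_eq0 negb_or.
  move=> /andP[_]; case: ltP => [r0|]; last by rewrite eqxx.
  by rewrite mulr_ge0// ltW.
rewrite mulf_eq0 negb_or -andbA => /and3P[_]; case: ltP => [x0 _|]; last by rewrite eqxx.
move=> /(IH _ _ (fun i => y0 i.+1)) [rx s0]; split; first by rewrite (lt_trans x0)// -subr_gt0.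
by rewrite addr_ge0// mulr_ge0// ltW.
Qed.

Lemma ddens_dsum_ge0 r u y m : (forall i, 0 <= y i)%R -> (0 <= ddens r u * dsum r y u ^+ m)%R.
Proof.
move=> y0; have [->|h] := eqVneq (ddens r u) 0%R; first by rewrite mul0r.
by rewrite mulr_ge0 ?ddens_ge0// exprn_ge0//; have [] := ddens_neq0 y0 h.
Qed.

Let mpos d (X : measurableType d) (f : X -> R) : measurable_fun setT f ->
  measurable_fun setT (fun x => (f x `^ (c - 1) * (0 < f x)%R%:R)%R).
Proof.
move=> mf; apply: measurable_funM; first exact: (measurableT_comp (measurable_powR _)).
rewrite (_ : (fun x => _) = (\1_(`]0%R, +oo[%classic : set R) : R -> R) \o f).
  by apply: measurableT_comp => //; exact: measurable_indic.
by apply/funext => x /=; rewrite indicE mem_setE in_itv/= andbT.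
Qed.

Let mkseqS (f : nat -> R) k : mkseq f k.+1 = f 0%N :: mkseq (fun i => f i.+1) k.
Proof. by rewrite /mkseq/= (iotaDl 1 0) -map_comp. Qed.

(** The remaining mass changes at each step of the recursion, so [r] has to be a measurable function
    and not a constant. *)
Let measurable_ddens_mkseq d (X : measurableType d) k (r : X -> R) (v : nat -> X -> R) :
  measurable_fun setT r -> (forall i, measurable_fun setT (v i)) ->
  measurable_fun setT (fun x => ddens (r x) (mkseq (v ^~ x) k)).
Proof.
elim: k r v => [|k IH] r v mr mv; first exact: mpos.
under eq_fun => x do rewrite mkseqS/=.
apply: measurable_funM; first exact: mpos.
by apply: (IH (fun x => r x - v 0%N x)%R (fun i => v i.+1)) => //; exact: measurable_funB.
Qed.

Let measurable_dsum_mkseq d (X : measurableType d) k (r : X -> R) y (v : nat -> X -> R) :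
  measurable_fun setT r -> (forall i, measurable_fun setT (v i)) ->
  measurable_fun setT (fun x => dsum (r x) y (mkseq (v ^~ x) k)).
Proof.
elim: k r y v => [|k IH] r y v mr mv; first exact: measurable_funM.
under eq_fun => x do rewrite mkseqS/=.
apply: measurable_funD; first exact: measurable_funM.
by apply: (IH (fun x => r x - v 0%N x)%R _ (fun i => v i.+1)) => //; exact: measurable_funB.
Qed.

Let mkseqt k (t : k.-tuple R) : mkseq (fun i => t`_i) k = t.
Proof. by rewrite -[X in mkseq _ X](size_tuple t) mkseq_nth. Qed.

Lemma measurable_ddens k r : measurable_fun setT (fun t : k.-tuple R => ddens r t).
Proof.
have H : measurable_fun setT (fun t : k.-tuple R => ddens r (mkseq (fun i => t`_i) k)).
  apply: (@measurable_ddens_mkseq _ (k.-tuple R) k (fun=> r) (fun i t => t`_i)) => // i.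
  exact: measurable_nth.
by apply: eq_measurable_fun H => t _; rewrite mkseqt.
Qed.

Lemma measurable_dsum k r y : measurable_fun setT (fun t : k.-tuple R => dsum r y t).
Proof.
have H : measurable_fun setT (fun t : k.-tuple R => dsum r y (mkseq (fun i => t`_i) k)).
  apply: (@measurable_dsum_mkseq _ (k.-tuple R) k (fun=> r) y (fun i t => t`_i)) => // i.
  exact: measurable_nth.
by apply: eq_measurable_fun H => t _; rewrite mkseqt.
Qed.

Lemma measurable_ddens_dsum k r y m :
  measurable_at k (fun u => (ddens r u * dsum r y u ^+ m)%:E).
Proof.
apply/measurable_EFinP; apply: measurable_funM; first exact: measurable_ddens.
by apply: measurable_funX; exact: measurable_dsum.
Qed.

Lemma dmom_ge0 k y m : (forall i, 0 <= y i)%R -> (0 <= dmom k y m)%R.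
Proof.
elim: k y m => [|k IH] y m y0 /=.
  by rewrite mulr_ge0 ?exprn_ge0// ltW// rising_gt0.
apply: sumr_ge0 => i _; rewrite !mulr_ge0 ?exprn_ge0//; last exact: IH.
by rewrite ltW// rising_gt0.
Qed.

Lemma dconst_ge0 k : 0 <= dconst k.
Proof. by elim: k => [|k IH] //=; rewrite mule_ge0// Beta_ge0. Qed.

(** Integrate out the first coordinate [x]: the others form a simplex of mass [r - x], the binomial
    theorem separates [x] from them, and what remains in [x] is a Beta integral scaled to
    [[0, r]]. *)
Lemma iint_ddens k r y m : (forall i, 0 <= y i)%R ->
  iint k (fun u => (ddens r u * dsum r y u ^+ m)%:E) =
  (r `^ (k.+1%:R * c + m%:R - 1) * (0 < r)%R%:R * dmom k y m / rising (k.+1%:R * c) m)%:E *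
  dconst k.
Proof.
elim: k r y m => [|k IH] r y m y0.
  rewrite /= mule1 mul1r; congr EFin.
  have [r0|r0] := ltP 0%R r; last by rewrite !mulr0 !mul0r.
  have h : rising c m != 0%R by rewrite gt_eqF// rising_gt0.
  have -> : (r `^ (c + m%:R - 1) = r `^ (c - 1) * r ^+ m)%R.
    by rewrite -(powR_mulrn _ (ltW r0)) -powRD ?(gt_eqF r0) ?implybT// addrAC.
  by rewrite exprMn /=; field.
have kc : (0 < k.+1%:R * c)%R by rewrite mulr_gt0.
have ck : (c + k.+1%:R * c = k.+2%:R * c)%R by rewrite -[in RHS]natr1 mulrDl mul1r addrC.
pose y' i := y i.+1; have y'0 i : (0 <= y' i)%R by exact: y0.
(* After the binomial expansion [A i] gathers what is independent of the first coordinate, [B i] the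
   powers that depend on it. *)
pose A (i : 'I_m.+1) : R := ('C(m, i)%:R * y 0%N ^+ (m - i) * dmom k y' i / rising (k.+1%:R * c) i)%R.
have A0 i : (0 <= A i)%R.
  rewrite /A !mulr_ge0 ?exprn_ge0//; first exact: dmom_ge0.
  by rewrite invr_ge0 ltW// rising_gt0.
pose B (i : 'I_m.+1) (x : R) : R := (x `^ (c + (m - i)%:R - 1) *
  (r - x) `^ (k.+1%:R * c + i%:R - 1))%R.
have B0 i x : (0 <= B i x)%R by rewrite mulr_ge0 ?powR_ge0.
have mB i : measurable_fun setT (B i).
  apply: measurable_funM => //.
  by apply: (measurableT_comp (measurable_powR _)); exact: measurable_funB.
have step x : iint k (fun u => (ddens r (x :: u) * dsum r y (x :: u) ^+ m)%:E) =
    \sum_(i < m.+1) ((A i)%:E * ((B i x)%:E * (\1_(`]0%R, r[%classic : set R) x)%:E)) * dconst k.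
  pose q (i : 'I_m.+1) : R := (x `^ (c - 1) * (0 < x)%R%:R * 'C(m, i)%:R * (x * y 0%N) ^+ (m - i))%R.
  have q0 i : (0 <= q i)%R.
    rewrite /q; have [x0|x0] := ltP 0%R x; last by rewrite !(mulr0, mul0r).
    by rewrite !mulr_ge0 ?powR_ge0 ?exprn_ge0 ?mulr_ge0// ltW.
  transitivity (\sum_(i < m.+1) iint k (fun u => (q i)%:E * (ddens (r - x) u * dsum (r - x) y' u ^+ i)%:E)).
    rewrite -iint_sum; last 2 first.
    - by move=> i s; rewrite mule_ge0 ?lee_fin// ddens_dsum_ge0.
    - move=> i; apply: emeasurable_funM => //; exact: measurable_ddens_dsum.
    apply: eq_iint => s _; under eq_bigr do rewrite -EFinM.
    rewrite sumEFin; congr EFin; rewrite /= exprDn mulr_sumr; apply: eq_bigr => i _.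
    by rewrite /q -mulr_natl; ring.
  apply: eq_bigr => i _; rewrite iintZl//; last 2 first.
  - by move=> s; rewrite lee_fin ddens_dsum_ge0.
  - exact: measurable_ddens_dsum.
  rewrite IH// muleA; congr (_ * _); rewrite -!EFinM; congr EFin.
  rewrite indicE mem_setE in_itv/= subr_gt0 /q /A /B.
  have [x0|x0] := ltP 0%R x; last by rewrite !(mulr0, mul0r).
  have [xr|xr] := ltP x r; last by rewrite !(mulr0, mul0r).
  have -> : (x `^ (c + (m - i)%:R - 1) = x `^ (c - 1) * x ^+ (m - i))%R.
    by rewrite -(powR_mulrn _ (ltW x0)) -powRD ?(gt_eqF x0) ?implybT// addrAC.
  by rewrite exprMn /=; ring.
rewrite [LHS]/=; under eq_integral => x _ do rewrite step.
rewrite ge0_integral_sum//; last 2 first.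
- move=> i; apply: emeasurable_funM => //; apply: emeasurable_funM => //.
  apply: emeasurable_funM; apply/measurable_EFinP; first exact: mB.
  exact: measurable_indic.
- move=> i x _; rewrite mule_ge0 ?dconst_ge0// mule_ge0 ?lee_fin//.
  by rewrite mulr_ge0.
have iB (i : 'I_m.+1) : \int[mu]_x ((B i x)%:E * (\1_(`]0%R, r[%classic : set R) x)%:E) =
    (r `^ (k.+2%:R * c + m%:R - 1) * (0 < r)%R%:R *
      (rising c (m - i) * rising (k.+1%:R * c) i / rising (k.+2%:R * c) m))%:E *
    Beta c (k.+1%:R * c).
  transitivity (\int[mu]_(x in `]0%R, r[) (B i x)%:E).
    by rewrite [RHS]integral_mkcond; apply: eq_integral => x _; rewrite epatch_indic.
  have [r0|r0] := ltP 0%R r; last first.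
    rewrite !(mulr0, mul0r, mul0e) (_ : `]0%R, r[%classic = set0) ?integral_set0//.
    by rewrite -subset0 => x /=; rewrite in_itv/= => /andP[x0 xr]; have := lt_trans x0 xr; rewrite ltNge r0.
  have im : (m - i + i)%N = m by rewrite subnK// -ltnS.
  have kc' := Beta_rising (m - i) i c0 kc.
  rewrite (Beta_scale _ _ r0) kc' im ck muleA -EFinM; congr (_%:E * _).
  have -> : (c + (m - i)%:R + (k.+1%:R * c + i%:R) - 1 = k.+2%:R * c + m%:R - 1)%R.
    by rewrite -ck -[in RHS]im natrD; ring.
  by rewrite mulr1.
transitivity (\sum_(i < m.+1) (A i * (r `^ (k.+2%:R * c + m%:R - 1) * (0 < r)%R%:R *
      (rising c (m - i) * rising (k.+1%:R * c) i / rising (k.+2%:R * c) m)))%:E *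
    (Beta c (k.+1%:R * c) * dconst k)).
  apply: eq_bigr => i _.
  rewrite (_ : (fun x => _) = fun x => ((A i)%:E * dconst k) *
      ((B i x)%:E * (\1_(`]0%R, r[%classic : set R) x)%:E)); last first.
    by apply/funext => x; rewrite muleAC.
  rewrite ge0_integralZl//; last 3 first.
  - apply: emeasurable_funM; apply/measurable_EFinP; first exact: mB.
    exact: measurable_indic.
  - by move=> x _; rewrite -EFinM lee_fin mulr_ge0.
  - by rewrite mule_ge0 ?lee_fin ?dconst_ge0.
  by rewrite iB EFinM muleACA; congr (_ * _); exact: muleC.
rewrite -ge0_sume_distrl; last first.
  have rge0 (x : R) j : (0 < x)%R -> (0 <= rising x j)%R by move=> x0; rewrite ltW// rising_gt0.
  move=> i _; rewrite lee_fin; apply: mulr_ge0 => //; apply: mulr_ge0.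
    by rewrite mulr_ge0 ?powR_ge0.
  by rewrite divr_ge0 ?mulr_ge0 ?rge0// mulr_gt0.
rewrite sumEFin; congr (_%:E * _); rewrite mulr_sumr mulr_suml.
apply: eq_bigr => i _; rewrite /A.
have h : rising (k.+1%:R * c) i != 0%R by rewrite gt_eqF// rising_gt0.
have h' : rising (k.+2%:R * c) m != 0%R by rewrite gt_eqF// rising_gt0// mulr_gt0.
rewrite -/(dmom k y' i); move: (dmom k y' i) => D.
by field; rewrite h h'.
Qed.

Definition wsum k y j : R := (\sum_(i < k.+1) y i ^+ j)%R.

Lemma wsumS k y j : wsum k.+1 y j = (y 0%N ^+ j + wsum k (fun i => y i.+1) j)%R.
Proof. by rewrite /wsum big_ord_recl. Qed.

Lemma wsum0 y j : wsum 0 y j = (y 0%N ^+ j)%R.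
Proof. by rewrite /wsum big_ord1. Qed.

Lemma dmom0 k y : dmom k y 0 = 1%R.
Proof.
elim: k y => [|k IH] y /=; first by rewrite /rising big_ord0 mulr1.
by rewrite big_ord1/= IH /rising big_ord0 !mulr1.
Qed.

(** From [dmom1] to [dmom4], coefficients count permutations by cycle type, with a factor [c] per
    cycle: [sum_m dmom_m t^m / m!] equals [prod_i (1 - y_i t)^(-c) = exp(c sum_j p_j t^j / j)],
    where [p_j] are the power sums. *)
Lemma dmom1 k y : dmom k y 1 = (c * wsum k y 1)%R.
Proof.
elim: k y => [|k IH] y; first by rewrite /= wsum0 risingS /rising big_ord0; ring.
have -> : (dmom k.+1 y 1 = 1%:R * rising c 1 * y 0%N ^+ 1 * dmom k (fun i => y i.+1) 0 + (1%:R * rising c 0 * y 0%N ^+ 0 * dmom k (fun i => y i.+1) 1 + 0))%R.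
  by rewrite [LHS]/= !big_ord_recl big_ord0.
rewrite !wsumS IH dmom0 !risingS /rising !big_ord0.
by ring.
Qed.

Lemma dmom2 k y : dmom k y 2 = (c ^+ 2 * wsum k y 1 ^+ 2 + c * wsum k y 2)%R.
Proof.
elim: k y => [|k IH] y; first by rewrite /= !wsum0 !risingS /rising big_ord0; ring.
have -> : (dmom k.+1 y 2 = 1%:R * rising c 2 * y 0%N ^+ 2 * dmom k (fun i => y i.+1) 0 + (2%:R * rising c 1 * y 0%N ^+ 1 * dmom k (fun i => y i.+1) 1 + (1%:R * rising c 0 * y 0%N ^+ 0 * dmom k (fun i => y i.+1) 2 + 0)))%R.
  by rewrite [LHS]/= !big_ord_recl big_ord0.
rewrite !wsumS IH dmom0 dmom1 !risingS /rising !big_ord0.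
by ring.
Qed.

Lemma dmom3 k y : dmom k y 3 = (c ^+ 3 * wsum k y 1 ^+ 3 +
  3 * c ^+ 2 * wsum k y 1 * wsum k y 2 + 2 * c * wsum k y 3)%R.
Proof.
elim: k y => [|k IH] y; first by rewrite /= !wsum0 !risingS /rising big_ord0; ring.
have -> : (dmom k.+1 y 3 = 1%:R * rising c 3 * y 0%N ^+ 3 * dmom k (fun i => y i.+1) 0 + (3%:R * rising c 2 * y 0%N ^+ 2 * dmom k (fun i => y i.+1) 1 + (3%:R * rising c 1 * y 0%N ^+ 1 * dmom k (fun i => y i.+1) 2 + (1%:R * rising c 0 * y 0%N ^+ 0 * dmom k (fun i => y i.+1) 3 + 0))))%R.
  by rewrite [LHS]/= !big_ord_recl big_ord0.
rewrite !wsumS IH dmom0 dmom1 dmom2 !risingS /rising !big_ord0.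
by ring.
Qed.

Lemma dmom4 k y : dmom k y 4 = (c ^+ 4 * wsum k y 1 ^+ 4 +
  6 * c ^+ 3 * wsum k y 1 ^+ 2 * wsum k y 2 + 3 * c ^+ 2 * wsum k y 2 ^+ 2 +
  8 * c ^+ 2 * wsum k y 1 * wsum k y 3 + 6 * c * wsum k y 4)%R.
Proof.
elim: k y => [|k IH] y; first by rewrite /= !wsum0 !risingS /rising big_ord0; ring.
have -> : (dmom k.+1 y 4 = 1%:R * rising c 4 * y 0%N ^+ 4 * dmom k (fun i => y i.+1) 0 + (4%:R * rising c 3 * y 0%N ^+ 3 * dmom k (fun i => y i.+1) 1 + (6%:R * rising c 2 * y 0%N ^+ 2 * dmom k (fun i => y i.+1) 2 + (4%:R * rising c 1 * y 0%N ^+ 1 * dmom k (fun i => y i.+1) 3 + (1%:R * rising c 0 * y 0%N ^+ 0 * dmom k (fun i => y i.+1) 4 + 0)))))%R.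
  by rewrite [LHS]/= !big_ord_recl big_ord0.
rewrite !wsumS IH dmom0 dmom1 dmom2 dmom3 !risingS /rising !big_ord0.
by ring.
Qed.

(** Cauchy-Schwarz, read off from a sum of squares centred at the mean. *)
Lemma wsum_sqr_le k y j : (wsum k y j ^+ 2 <= k.+1%:R * wsum k y (j * 2))%R.
Proof.
set n : R := k.+1%:R; set p := wsum k y j; have n0 : (0 < n)%R by [].
have : (0 <= \sum_(i < k.+1) (n * y i ^+ j - p) ^+ 2)%R by apply: sumr_ge0 => i _; exact: sqr_ge0.
have -> : (\sum_(i < k.+1) (n * y i ^+ j - p) ^+ 2 = n * (n * wsum k y (j * 2) - p ^+ 2))%R.
  transitivity (\sum_(i < k.+1) (n ^+ 2 * y i ^+ (j * 2) + (- 2 * n * p * y i ^+ j) + p ^+ 2))%R.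
    by apply: eq_bigr => i _; rewrite exprM; ring.
  rewrite !big_split/= -!mulr_sumr sumr_const card_ord -mulr_natl -/n.
  by rewrite -/(wsum k y j) -/p -/(wsum k y (j * 2)); ring.
by rewrite pmulr_rge0// subr_ge0.
Qed.

(* The fourth centred moment is
   [(6 c q4 + 3 c ^ 2 q2 ^ 2) / rising (n c) 4], with [q2] and [q4] the centred power sums. *)
Lemma fourth_moment_le (n p1 p2 p3 p4 : R) : (1 <= n)%R ->
  (0 <= p1)%R -> (0 <= p2)%R -> (0 <= p3)%R -> (0 <= p4)%R ->
  (p1 ^+ 2 <= n * p2)%R -> (p2 ^+ 2 <= n * p4)%R ->
  ((c ^+ 4 * p1 ^+ 4 + 6 * c ^+ 3 * p1 ^+ 2 * p2 + 3 * c ^+ 2 * p2 ^+ 2 +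
    8 * c ^+ 2 * p1 * p3 + 6 * c * p4) / rising (n * c) 4
   + 6 * (p1 / n) ^+ 2 * ((c ^+ 2 * p1 ^+ 2 + c * p2) / rising (n * c) 2) + (p1 / n) ^+ 4
   - 4 * (p1 / n) * ((c ^+ 3 * p1 ^+ 3 + 3 * c ^+ 2 * p1 * p2 + 2 * c * p3) / rising (n * c) 3)
   - 4 * (p1 / n) ^+ 3 * (c * p1 / rising (n * c) 1) <=
  (42 * c + 3 * c ^+ 2) / c ^+ 4 * p4 / n ^+ 3)%R.
Proof.
move=> n1 p10 p20 p30 p40 h1 h2; set s := (n * c)%R; set y := (p1 / n)%R.
have n0 : (0 < n)%R by exact: lt_le_trans n1.
have s0 : (0 < s)%R by rewrite mulr_gt0.
pose q2 : R := (p2 - p1 ^+ 2 / n)%R.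
pose q4 : R := (p4 - 4 * y * p3 + 6 * y ^+ 2 * p2 - 3 * n * y ^+ 4)%R.
have E4 : rising s 4 = (s * (s + 1) * (s + 2) * (s + 3))%R.
  by rewrite /rising !big_ord_recl big_ord0/= /bump/=; ring.
have E3 : rising s 3 = (s * (s + 1) * (s + 2))%R.
  by rewrite /rising !big_ord_recl big_ord0/= /bump/=; ring.
have E2 : rising s 2 = (s * (s + 1))%R.
  by rewrite /rising !big_ord_recl big_ord0/= /bump/=; ring.
have E1 : rising s 1 = s by rewrite /rising big_ord1 addr0.
have -> : ((c ^+ 4 * p1 ^+ 4 + 6 * c ^+ 3 * p1 ^+ 2 * p2 + 3 * c ^+ 2 * p2 ^+ 2 +
    8 * c ^+ 2 * p1 * p3 + 6 * c * p4) / rising s 4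
   + 6 * y ^+ 2 * ((c ^+ 2 * p1 ^+ 2 + c * p2) / rising s 2) + y ^+ 4
   - 4 * y * ((c ^+ 3 * p1 ^+ 3 + 3 * c ^+ 2 * p1 * p2 + 2 * c * p3) / rising s 3)
   - 4 * y ^+ 3 * (c * p1 / rising s 1) = (6 * c * q4 + 3 * c ^+ 2 * q2 ^+ 2) / rising s 4)%R.
  have S1 : (s + 1 != 0)%R by rewrite gt_eqF// addr_gt0.
  have S2 : (s + 2 != 0)%R by rewrite gt_eqF// addr_gt0.
  have S3 : (s + 3 != 0)%R by rewrite gt_eqF// addr_gt0.
  rewrite E4 E3 E2 E1 /q2 /q4 /y; rewrite /s in S1 S2 S3 *; field.
  by rewrite (gt_eqF n0) (gt_eqF c0) S1 S2 S3.
have y0 : (0 <= y)%R by rewrite divr_ge0// ltW.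
have q2p : (0 <= q2 <= p2)%R.
  rewrite /q2 subr_ge0 ler_pdivrMr// mulrC h1/= gerBl.
  by rewrite divr_ge0 ?sqr_ge0// ltW.
have Q2 : (q2 ^+ 2 <= n * p4)%R.
  by apply: le_trans h2; case/andP: q2p => ? ?; rewrite lerXn2r ?nnegrE.
(* The two negative terms are dropped and [y^2 p2 <= p4], whence [7 = 1 + 6]; the constant 42 is
   [6 * 7]. *)
have Q4 : (q4 <= 7 * p4)%R.
  have u1 : (0 <= 4 * y * p3)%R by exact: mulr_ge0 (mulr_ge0 _ y0) p30.
  have u2 : (0 <= 3 * n * y ^+ 4)%R by exact: mulr_ge0 (mulr_ge0 _ (ltW n0)) (exprn_ge0 _ y0).
  have u3 : (y ^+ 2 * p2 <= p4)%R.
    have : (y ^+ 2 <= p2 / n)%R.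
      rewrite /y exprMn exprVn ler_pdivrMr ?exprn_gt0//.
      by rewrite (_ : p2 / n * n ^+ 2 = n * p2)%R//; field; rewrite gt_eqF.
    move=> /(ler_wpM2r p20) /le_trans; apply.
    by rewrite mulrAC ler_pdivrMr// -expr2 mulrC.
  by rewrite /q4; move: (4 * y * p3)%R (3 * n * y ^+ 4)%R u1 u2 => v1 v2 u1 u2;
    rewrite -mulrA; move: (y ^+ 2 * p2)%R u3 => v3 u3; lra.
have r4 : (s ^+ 4 <= rising s 4)%R.
  rewrite E4; move: (s) s0 => x x0; rewrite -subr_ge0.
  rewrite (_ : _ - _ = 6 * x ^+ 3 + 11 * x ^+ 2 + 6 * x)%R; last by ring.
  by rewrite !addr_ge0// mulr_ge0 ?exprn_ge0// ltW.
have r40 : (0 < rising s 4)%R by rewrite rising_gt0.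
rewrite ler_pdivrMr//.
apply: (@le_trans _ _ ((42 * c + 3 * c ^+ 2) * (n * p4))%R).
  have v1 := ler_wpM2l (ltW c0) Q4.
  have v2 := ler_wpM2l (sqr_ge0 c) Q2.
  have v3 : (c * p4 <= c * (n * p4))%R by rewrite ler_wpM2l ?(ltW c0)// ler_peMl.
  have : (6 * c * q4 + 3 * c ^+ 2 * q2 ^+ 2 <= 42 * (c * p4) + 3 * (c ^+ 2 * (n * p4)))%R.
    have -> : (6 * c * q4 + 3 * c ^+ 2 * q2 ^+ 2 = 6 * (c * q4) + 3 * (c ^+ 2 * q2 ^+ 2))%R by ring.
    have v4 : (c * (7 * p4) = 7 * (c * p4))%R by ring.
    by rewrite v4 in v1; lra.
  move=> /le_trans; apply.
  have -> : ((42 * c + 3 * c ^+ 2) * (n * p4) = 42 * (c * (n * p4)) + 3 * (c ^+ 2 * (n * p4)))%R by ring.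
  by lra.
apply: (@le_trans _ _ ((42 * c + 3 * c ^+ 2) / c ^+ 4 * p4 / n ^+ 3 * s ^+ 4)%R).
  rewrite le_eqVlt; apply/orP; left; apply/eqP; rewrite /s; field.
  by rewrite (gt_eqF c0) (gt_eqF n0).
apply: ler_wpM2l r4.
by rewrite !mulr_ge0// ?invr_ge0 ?exprn_ge0 ?(ltW c0) ?(ltW n0)// addr_ge0 ?mulr_ge0 ?sqr_ge0// ltW.
Qed.

Lemma dir_dens_ddens u : dir_dens c u = ddens 1 u.
Proof.
rewrite (dir_densE c (erefl _)).
suff H r : ddens r u = ((\prod_(i < size u) (u`_i `^ (c - 1))) *
  ((r - \sum_(i < size u) u`_i) `^ (c - 1)) *
  ((\prod_(i < size u) \1_(`]0%R, +oo[%classic : set R) u`_i) *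
   \1_(`]-oo, r[%classic : set R) (\sum_(i < size u) u`_i)))%R by rewrite H.
elim: u r => [|x u IH] r /=.
  by rewrite !big_ord0 subr0 !mul1r indicE mem_setE in_itv.
rewrite IH !big_ord_recl/= !indicE !mem_setE !in_itv/= andbT opprD addrA ltrBrDl.
by ring.
Qed.

Lemma dsumE r y u : dsum r y u =
  (\sum_(i < size u) u`_i * y i + (r - \sum_(i < size u) u`_i) * y (size u))%R.
Proof.
elim: u r y => [|x u IH] r y /=; first by rewrite !big_ord0 add0r subr0.
by rewrite IH !big_ord_recl/= opprD addrA addrA.
Qed.

Lemma dir_ext_dsum k y u : size u = k ->
  (\sum_(i < k.+1) dir_ext u i * y i = dsum 1 y u)%R.
Proof.
move=> uk; rewrite dsumE uk big_ord_recr/=; congr (_ + _)%R.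
  by apply: eq_bigr => i _; rewrite /dir_ext/= ltn_ord.
by rewrite /dir_ext/= ltnn.
Qed.

Lemma dir_fourth_le k y (z : R) : (forall i, 0 <= y i)%R ->
  iint k (fun u => (dir_dens c u)%:E) = z%:E ->
  iint k (fun u => ((\sum_(i < k.+1) dir_ext u i * y i - wsum k y 1 / k.+1%:R) ^+ 4 *
    dir_dens c u)%:E) <=
  ((42 * c + 3 * c ^+ 2) / c ^+ 4 * wsum k y 4 / k.+1%:R ^+ 3)%:E *
  iint k (fun u => (dir_dens c u)%:E).
Proof.
move=> y0 iz.
have z0 : (0 <= z)%R by rewrite -lee_fin -iz; apply: iint_ge0 => s; rewrite lee_fin dir_dens_ge0.
(* The case [m = 0], [r = 1]: finiteness of the normalising integral passes to the product of Beta
   integrals. *)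
have zE : dconst k = z%:E.
  rewrite -iz; transitivity (iint k (fun u => (ddens 1 u * dsum 1 y u ^+ 0)%:E)).
    by rewrite iint_ddens// dmom0 powR1 ltr01 /rising big_ord0 !mulr1 divr1 mul1e.
  by apply: eq_iint => s _; rewrite dir_dens_ddens expr0 mulr1.
pose D m := iint k (fun u => (ddens 1 u * dsum 1 y u ^+ m)%:E).
pose e m : R := (dmom k y m / rising (k.+1%:R * c) m)%R.
have DE m : D m = (e m * z)%:E.
  by rewrite /D iint_ddens// zE powR1 ltr01 !mul1r -EFinM.
set q : R := (wsum k y 1 / k.+1%:R)%R.
have q0 : (0 <= q)%R by rewrite divr_ge0//; apply: sumr_ge0 => i _; rewrite exprn_ge0.
pose X := iint k (fun u => ((dsum 1 y u - q) ^+ 4 * ddens 1 u)%:E).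
have -> : iint k (fun u => ((\sum_(i < k.+1) dir_ext u i * y i - q) ^+ 4 *
    dir_dens c u)%:E) = X.
  by apply: eq_iint => u uk; rewrite dir_ext_dsum// dir_dens_ddens.
have mX : measurable_at k (fun u => ((dsum 1 y u - q) ^+ 4 * ddens 1 u)%:E).
  apply/measurable_EFinP; apply: measurable_funM; last exact: measurable_ddens.
  by apply: measurable_funX; apply: measurable_funB => //; exact: measurable_dsum.
have nX u : 0 <= ((dsum 1 y u - q) ^+ 4 * ddens 1 u)%:E.
  by rewrite lee_fin mulr_ge0 ?ddens_ge0// exprn_even_ge0.
have mD m (a : R) : measurable_at k (fun u => a%:E * (ddens 1 u * dsum 1 y u ^+ m)%:E).
  by apply: emeasurable_funM => //; exact: measurable_ddens_dsum.
have nD m (a : R) u : (0 <= a)%R -> 0 <= a%:E * (ddens 1 u * dsum 1 y u ^+ m)%:E.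
  by move=> a0; rewrite mule_ge0 ?lee_fin// ddens_dsum_ge0.
have DZ m (a : R) : (0 <= a)%R ->
    iint k (fun u => a%:E * (ddens 1 u * dsum 1 y u ^+ m)%:E) = (a * (e m * z))%:E.
  move=> a0; rewrite iintZl//; last exact: measurable_ddens_dsum.
    by rewrite -/(D m) DE.
  by move=> u; rewrite lee_fin ddens_dsum_ge0.
have q1 : (0 <= 4 * q)%R by rewrite mulr_ge0.
have q3 : (0 <= 4 * q ^+ 3)%R by rewrite mulr_ge0// exprn_ge0.
have q2 : (0 <= 6 * q ^+ 2)%R by rewrite mulr_ge0// exprn_ge0.
have q4 : (0 <= q ^+ 4)%R by rewrite exprn_ge0.
(* Binomial expansion of the fourth power with the negative terms moved to the left, [iint] being
   additive on nonnegative functions. *)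
have balance : X + ((4 * q * (e 3%N * z))%:E + (4 * q ^+ 3 * (e 1%N * z))%:E) =
    (1 * (e 4%N * z))%:E + ((6 * q ^+ 2 * (e 2%N * z))%:E + (q ^+ 4 * (e 0%N * z))%:E).
  rewrite -!DZ// /X -!iintD//; try by move=> u; rewrite ?adde_ge0// nD.
  - by apply: eq_iint => u _; rewrite -!EFinM -!EFinD; congr EFin; ring.
  - by apply: emeasurable_funD; exact: mD.
  - by apply: emeasurable_funD; exact: mD.
have e0 : e 0%N = 1%R by rewrite /e dmom0 /rising big_ord0 divr1.
have n1 : (1 <= k.+1%:R :> R)%R by rewrite ler1n.
have w0 j : (0 <= wsum k y j)%R by apply: sumr_ge0 => i _; rewrite exprn_ge0.
have := @fourth_moment_le k.+1%:R _ _ _ _ n1 (w0 1%N) (w0 2%N) (w0 3%N) (w0 4%N)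
  (wsum_sqr_le k y 1) (wsum_sqr_le k y 2).
rewrite -dmom4 -dmom3 -dmom2 -dmom1 -/(e 4%N) -/(e 3%N) -/(e 2%N) -/(e 1%N) -/q /= => H.
rewrite iz -EFinM.
(* The right side of [balance] is finite, which rules out an infinite [X] and permits solving for
   it. *)
have -> : X = ((e 4%N + 6 * q ^+ 2 * e 2%N + q ^+ 4 - 4 * q * e 3%N - 4 * q ^+ 3 * e 1%N) * z)%:E.
  move: balance; rewrite -!EFinD e0; case: X => [x| |]//= [hx]; congr EFin.
  by apply: (addIr (4 * q * (e 3%N * z) + 4 * q ^+ 3 * (e 1%N * z))%R); rewrite hx; ring.
by rewrite lee_fin ler_wpM2r.
Qed.

End dirichlet_moments.

(** * Comparison of the spectral and empirical moments *)

Section weights.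
Context (R : realType) (d : measure_display) (T : measurableType d).
Unset Implicit Arguments.
Variables (P : probability T R) (beta tau : R) (a b : nat -> R).
Variables (lam w : forall n : nat, T -> 'I_n -> R) (c : R).
Hypothesis beta0 : 0 < beta.
Hypothesis tau0 : 0 < tau.
Hypothesis c0 : 0 < c.
Hypothesis hab : forall n : nat,
  beta / 2 * (n.-1)%:R < a n /\ beta / 2 * (n.-1)%:R < b n.
Hypothesis ha : (fun n : nat => beta / 2 * n%:R / a n) @ \oo --> tau.
Hypothesis hb : (fun n : nat => b n / n%:R) @ \oo --> +oo.
Hypothesis mlam : forall (n : nat) (i : 'I_n), measurable_fun setT (fun t => lam n t i).
Hypothesis mw : forall (n : nat) (i : 'I_n), measurable_fun setT (fun t => w n t i).
Hypothesis rect : forall (n : nat) (A B : 'I_n -> set R),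
  (forall i, measurable (A i)) -> (forall i, measurable (B i)) ->
  P [set t | forall i : 'I_n, A i (lam n t i) /\ B i (w n t i)] =
  (jac_prob beta (a n) (b n) A * dir_prob c B)%E.

Set Implicit Arguments.

Definition wmom k n t : R := \sum_(i < n) w n t i * clam (lam n) t i ^+ k.

(** Deviation from the conditional mean given the eigenvalues, each weight having mean [1 / n]. *)
Let dev k n t : R := wmom k n t - psum (clam (lam n) t) k / n%:R.

Let mdev k n : measurable_fun setT (dev k n).
Proof.
apply: measurable_funB; last first.
  by apply: measurable_funM => //; apply: measurable_psum => i; exact: measurable_clam.
apply: measurable_sum => i; apply: measurable_funM; first exact: mw.
by apply: measurable_funX; exact: measurable_clam.
Qed.

Let K : R := (42 * c + 3 * c ^+ 2) / c ^+ 4.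

Let K0 : 0 <= K.
Proof. by rewrite divr_ge0// ?exprn_ge0 ?(ltW c0)// addr_ge0// mulr_ge0 ?sqr_ge0// ltW. Qed.

(** [dir_fourth_le] is a bound at fixed eigenvalues; [law_le] averages it over them. *)
Lemma dev_fourth_le k n : (0 < n)%N ->
  (\int[P]_t (dev k n t ^+ 4)%:E <= (K / n%:R ^+ 3 * \int[P]_t psum (clam (lam n) t) (4 * k))%:E)%E.
Proof.
case: n => // n _.
pose q (s : n.+1.-tuple R) j : R := \sum_(i < n.+1) clamp (tnth s i) ^+ j.
pose g (x : n.+1.-tuple R * n.+1.-tuple R) : R :=
  (\sum_(i < n.+1) tnth x.2 i * clamp (tnth x.1 i) ^+ k - q x.1 k / n.+1%:R) ^+ 4.
pose B (s : n.+1.-tuple R) : R := K * q s (4 * k) / n.+1%:R ^+ 3.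
have q0 s j : 0 <= q s j.
  by apply: sumr_ge0 => i _; rewrite exprn_ge0//; have /andP[/ltW] := clamp_itv (tnth s i).
have mc (i : 'I_n.+1) : measurable_fun setT (fun s : n.+1.-tuple R => clamp (tnth s i)).
  by apply: measurableT_comp; [exact: measurable_clamp|exact: measurable_tnth].
have mq j : measurable_fun setT (q ^~ j).
  by apply: measurable_sum => i; apply: measurable_funX; exact: mc.
have g0 x : 0 <= g x by rewrite exprn_even_ge0.
have B0 s : 0 <= B s by exact: divr_ge0 (mulr_ge0 K0 (q0 _ _)) (exprn_ge0 _ _).
have mg : measurable_fun setT g.
  apply: measurable_funX; apply: measurable_funB.
    apply: measurable_sum => i; apply: measurable_funM.
      exact: (measurableT_comp (measurable_tnth i)).
    by apply: measurable_funX; exact: (measurableT_comp (mc i)).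
  by apply: measurable_funM => //; exact: (measurableT_comp (mq k)).
have mB : measurable_fun setT B.
  by apply: measurable_funM => //; apply: measurable_funM.
have [z z0 iz] := dir_norm (rect n.+1).
have main := law_le (mlam n.+1) (mw n.+1) (rect n.+1) g0 B0 mg mB.
have -> : (fun t => (dev k n.+1 t ^+ 4)%:E) = (fun t => (g (rv_pair (lam n.+1) (w n.+1) t))%:E).
  apply/funext => t; congr EFin; rewrite /dev /g /wmom; congr ((_ - _ / _) ^+ 4).
    by apply: eq_bigr => i _; rewrite /= !tnth_mktuple.
  by apply: eq_bigr => i _; rewrite /= !tnth_mktuple.
apply: (le_trans (main _)) => {main}.
  move=> s _; pose y i : R := clamp s`_i ^+ k.
  have y0 i : 0 <= y i by rewrite exprn_ge0//; have /andP[/ltW] := clamp_itv s`_i.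
  have := dir_fourth_le c0 y0 iz.
  have -> : wsum n y 4 = q s (4 * k)%N.
    by apply: eq_bigr => i _; rewrite (tnth_nth 0) /y -exprM mulnC.
  have -> : wsum n y 1 = q s k.
    by apply: eq_bigr => i _; rewrite (tnth_nth 0) /y expr1.
  rewrite -/K; apply: le_trans; rewrite le_eqVlt; apply/orP; left; apply/eqP.
  apply: eq_iint => u _; congr (((_ - _) ^+ 4 * _)%:E).
  by apply: eq_bigr => i _; rewrite /= tnth_mktuple /y (tnth_nth 0).
rewrite (_ : (fun t => _) = (fun t => (K / n.+1%:R ^+ 3)%:E * (psum (clam (lam n.+1) t) (4 * k))%:E)%E); last first.
  apply/funext => t; rewrite -EFinM /B; congr EFin; rewrite mulrAC; congr (_ * _).
  by apply: eq_bigr => i _; rewrite /= tnth_mktuple.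
have ip := @integrable_psum _ _ _ P _ _ (mlam n.+1) (4 * k).
rewrite ge0_integralZl_EFin//.
- by rewrite -[X in (_ * X)%E]fineK// integrable_fin_num.
- by move=> t _; rewrite lee_fin; have /andP[] := psum_bound (4 * k) (clam_itv (lam n.+1) t).
- by have /integrableP[] := ip.
- by rewrite divr_ge0// exprn_ge0.
Qed.

(** The factor [theta^(4k)] in the bound for the mean power sum of order [4 k] cancels the
    rescaling, so the fourth power has mean [O(1 / n^2)] and [ae_cvg0] applies. *)
Lemma wmom_ae : {ae P, forall t, forall k,
  wmom k n t / theta a b n ^+ k - smom a b (fun m => clam (lam m) t) k n
    @[n --> \oo] --> (0 : R)}.
Proof.
apply: ae_forall_nat => k.
have [C C0 HC] := @EP_bound _ _ _ P beta tau a b lam w c beta0 tau0 hab ha hb mlam mw rect (4 * k).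
have : {ae P, forall t, (dev k n t / theta a b n ^+ k) ^+ 4 @[n --> \oo] --> (0 : R)}.
  apply: (ae_cvg0 (C := K * C)) => //.
  - by move=> n; apply: measurable_funX; apply: measurable_funM.
  - by move=> n t; rewrite exprn_even_ge0.
  near=> n; have n0 : (0 < n)%N by near: n; exact: nbhs_infty_gt.
  have n0' : 0 < n%:R :> R by rewrite ltr0n.
  have t0 : 0 < theta a b n by rewrite divr_gt0 ?(a_gt0 beta0 hab) ?(b_gt0 beta0 hab).
  have H := dev_fourth_le k n0.
  have E : EP P lam n (4 * k) <= C * (n%:R * theta a b n ^+ (4 * k)) by near: n.
  have tk : 0 < theta a b n ^+ (4 * k) by rewrite exprn_gt0.
  rewrite (_ : (fun t => _) = (fun t => (theta a b n ^- (4 * k))%:E * (dev k n t ^+ 4)%:E)%E); last first.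
    by apply/funext => t; rewrite -EFinM exprMn mulrC exprVn -exprM mulnC.
  rewrite ge0_integralZl_EFin//; last 3 first.
  - by move=> t _; rewrite lee_fin exprn_even_ge0.
  - by apply/measurable_EFinP; apply: measurable_funX.
  - by rewrite invr_ge0 ltW.
  apply: (@le_trans _ _ ((theta a b n ^- (4 * k))%:E *
      (K / n%:R ^+ 3 * EP P lam n (4 * k))%:E)%E).
    by apply: lee_wpmul2l => //; rewrite lee_fin invr_ge0 ltW.
  rewrite -EFinM lee_fin.
  have K3 : 0 <= theta a b n ^- (4 * k) * (K / n%:R ^+ 3).
    by rewrite mulr_ge0// ?invr_ge0 ?(ltW tk)// divr_ge0// exprn_ge0.
  rewrite mulrA; apply: (le_trans (ler_wpM2l K3 E)).
  rewrite le_eqVlt; apply/orP; left; apply/eqP; move: (_ ^+ (4 * k)) tk => x x0.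
  by field; rewrite !gt_eqF.
apply: filterS => t Ht.
have {}Ht : `|dev k n t / theta a b n ^+ k| @[n --> \oo] --> (0 : R).
  apply/cvgrPdist_lt => e e0.
  have e4 : 0 < e ^+ 4 by rewrite exprn_gt0.
  move/cvgrPdist_lt : Ht => /(_ _ e4); apply: filterS => n.
  rewrite !sub0r !normrN normr_id normrX => h.
  by rewrite -(@ltr_pXn2r _ 4) ?nnegrE// ltW.
apply/norm_cvg0P; apply: cvg_trans Ht; apply: near_eq_cvg.
near=> n; congr (`|_|); rewrite /smom /dev mulrBl; congr (_ - _).
by rewrite invfM mulrA.
Unshelve. all: by end_near. Qed.

End weights.

(** * Moments of the Marchenko-Pastur law *)

Section quadratic_recursion.
Context (R : realFieldType).
Implicit Types (p : {poly R}) (A B : R).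

Let quad A B : {poly R} := 1 + A *: 'X + B *: 'X^2.

Let coef_quadM A B p k : (quad A B * p)`_k =
  p`_k + A * (if k is k'.+1 then p`_k' else 0) + B * (if k is k'.+2 then p`_k' else 0).
Proof.
rewrite /quad (mulrDl _ _ p) (mulrDl _ _ p) mul1r -!scalerAl 2!coefD 2!coefZ coefXM coefXnM.
by case: k => [|[|k]] //=; rewrite ?subSS ?subn0.
Qed.

Let coef_affM A B p k : ((A%:P + B *: 'X) * p)`_k =
  A * p`_k + B * (if k is k'.+1 then p`_k' else 0).
Proof.
rewrite mulrDl -scalerAl coefD coefZ coefXM coefCM.
by case: k.
Qed.

Let deriv_quad A B : (quad A B)^`() = A%:P + (2 * B) *: 'X.
Proof.
rewrite /quad !derivD -[1]/(1%:P) derivC add0r !derivZ derivX derivXn /= expr1.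
by rewrite alg_polyC -scaler_nat scalerA mulrC.
Qed.

(* With [H = 2 tau X M + (1 - tau) X - 1] the linear recursion reads [2 D H' = D' H] for the
   discriminant [D], hence [(H ^ 2 / D)' = 0] and [H ^ 2 = D], which is the quadratic one. *)
Lemma quadratic_recursion (tau : R) (m : nat -> R) : tau != 0 ->
  m 0%N = 1 -> m 1%N = 1 ->
  (forall j, (j%:R + 3) * m j.+2 =
    (2 * j%:R + 3) * (1 + tau) * m j.+1 - j%:R * (1 - tau) ^+ 2 * m j) ->
  forall k, m k.+1 = (1 - tau) * m k + tau * \sum_(p < k.+1) m (k - p)%N * m p.
Proof.
(* Polynomials truncated below degree [N] replace power series. The vanishing of [E] and [U] is
   claimed only for low coefficients, far enough to read coefficient [k.+1] of the quadratic
   relation. *)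
move=> tau0 m0 m1 mlin k; pose N := k.+2.
pose M : {poly R} := \poly_(i < N) m i.
pose H : {poly R} := (2 * tau) *: ('X * M) + (1 - tau) *: 'X - 1.
pose D := quad (- 2 * (1 + tau)) ((1 - tau) ^+ 2).
have H0 : H`_0 = -1 by rewrite !(coefD, coefZ, coefXM, coefX, coefN, coef1)/= !mulr0 !add0r.
have H1 : H`_1 = 1 + tau.
  by rewrite !(coefD, coefZ, coefXM, coefX, coefN, coef1)/= coef_poly/= m0; ring.
have HS j : (j.+1 < N)%N -> H`_j.+2 = 2 * tau * m j.+1.
  move=> jN; rewrite !(coefD, coefZ, coefXM, coefX, coefN, coef1)/= coef_poly jN; ring.
pose E := (D * H^`()) *+ 2 - D^`() * H.
have E0 j : (j < N)%N -> E`_j = 0.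
  move=> jN; rewrite /E coefB coefMn /D deriv_quad coef_quadM coef_affM.
  case: j jN => [|[|j]] jN; rewrite !coef_deriv.
  - by rewrite H0 H1; ring.
  - by rewrite HS// H0 H1 m1; ring.
  - rewrite HS//; case: j jN => [|j] jN.
      have m2 : m 2%N = 1 + tau.
        apply: (@mulfI _ 3%:R); first by rewrite pnatr_eq0.
        by have := mlin 0%N; rewrite m1 add0r => ->; ring.
      by rewrite H1 HS// m1 m2; ring.
    have jN' := ltnW jN; rewrite !HS//; last exact: ltnW.
    have -> : m j.+3 = ((2 * j.+1%:R + 3) * (1 + tau) * m j.+2 -
        j.+1%:R * (1 - tau) ^+ 2 * m j.+1) / (j.+1%:R + 3).
      have h3 : j.+1%:R + 3 != 0 :> R by rewrite -natrD pnatr_eq0.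
      by apply: (canRL (mulfK h3)); rewrite mulrC mlin.
    have h3 : 1 + j%:R + 3 != 0 :> R.
      by rewrite gt_eqF// addr_gt0// ltr_pwDl.
    by field.
(* [U] stands in for [H^2 / D]: the identity below involves no division, and since [D] has constant
   term 1 it determines the coefficients of [U] one after another. *)
pose U := H * H - D.
have UE : D * U^`() - D^`() * U = H * E.
  by rewrite /U /E derivB derivM; ring.
have U0 j : (j <= N)%N -> U`_j = 0.
  elim/ltn_ind: j => -[|j] IH jN.
    by rewrite /U coefB coefM big_ord1 H0 /D /quad !(coefD, coefZ, coefX, coefXn, coef1)/=; ring.
  have : (H * E)`_j = 0.
    rewrite coefM big1// => i _; rewrite E0 ?mulr0//.
    by rewrite (leq_ltn_trans (leq_subr _ _)).
  rewrite -UE coefB /D deriv_quad coef_quadM coef_affM coef_deriv.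
  have Uj : U`_j = 0 by apply: IH => //; exact: ltnW.
  rewrite Uj; case: j IH jN Uj => [|j] IH jN Uj.
    by rewrite !mulr0 !addr0 subr0 mulr1n.
  rewrite !coef_deriv Uj (IH j) ?(ltnW (ltnW jN))//.
  have -> : (if j is k'.+1 then (U^`())`_k' else 0) = 0.
    by case: j IH jN Uj => [//|j] IH jN Uj; rewrite coef_deriv IH ?mul0rn// ltnW// ltnW// ltnW.
  by rewrite !(mulr0, mul0rn, addr0, subr0) => /eqP; rewrite mulrn_eq0/= => /eqP.
(* [Q = 0] is the quadratic relation in generating form; the factor [X] in [U] shifts its
   coefficient [k.+1] to [k.+2]. *)
pose Q := tau *: ('X * (M * M)) + (1 - tau) *: ('X * M) - M + 1.
have UQ : U = (4 * tau) *: ('X * Q).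
  rewrite /U /H /Q /D /quad -!mul_polyC !polyCM !polyCB !polyCD; ring.
have : Q`_k.+1 = 0.
  have : U`_k.+2 = 0 by exact: U0.
  by rewrite UQ coefZ coefXM/= => /eqP; rewrite !mulf_eq0 (negbTE tau0) pnatr_eq0/= => /eqP.
rewrite /Q !coefD coefN !coefZ !coefXM coef1/= addr0 !coef_poly ltnSn (ltnW (ltnSn _)) coefM.
have -> : \sum_(j < k.+1) M`_j * M`_(k - j) = \sum_(p < k.+1) m (k - p)%N * m p.
  apply: eq_bigr => i _; rewrite !coef_poly mulrC.
  by rewrite (leq_trans (ltn_ord i))// ltnS (leq_trans (leq_subr _ _)).
by move=> h; lra.
Qed.

End quadratic_recursion.

Section marchenko_pastur.
Context (R : realType).
Notation mu := (@lebesgue_measure R).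
Variable tau : R.
Hypothesis tau01 : 0 < tau <= 1.
Let r : R := Num.sqrt tau.
Let tau0 : 0 < tau. Proof. by case/andP: tau01. Qed.
Let r0 : 0 < r. Proof. by rewrite sqrtr_gt0. Qed.
Let r2 : r ^+ 2 = tau. Proof. by rewrite sqr_sqrtr// ltW. Qed.
Let r1 : r <= 1.
Proof. by rewrite -(@ler_pXn2r _ 2) ?nnegrE ?(ltW r0)// r2 expr1n; case/andP: tau01. Qed.

Let dD (f g : R -> R) (x a b : R) : is_derive x (1 : R) f a -> is_derive x (1 : R) g b ->
  is_derive x (1 : R) (fun y => f y + g y) (a + b).
Proof. by move=> h1 h2; exact: is_deriveD. Qed.

Let dM (f g : R -> R) (x a b : R) : is_derive x (1 : R) f a -> is_derive x (1 : R) g b ->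
  is_derive x (1 : R) (fun y => f y * g y) (f x * b + g x * a).
Proof. by move=> h1 h2; exact: is_deriveM. Qed.

Let dC (k x : R) : is_derive x (1 : R) (fun _ : R => k) 0.
Proof. exact: is_derive_cst. Qed.

Let dZ (f : R -> R) (k x a : R) : is_derive x (1 : R) f a ->
  is_derive x (1 : R) (fun y => k * f y) (k * a).
Proof. by move=> h; apply: (is_derive_eq (dM (dC k x) h)); rewrite mulr0 addr0. Qed.

Let dX (f : R -> R) (k : nat) (x a : R) : is_derive x (1 : R) f a ->
  is_derive x (1 : R) (fun y => f y ^+ k.+1) (k.+1%:R * f x ^+ k * a).
Proof.
elim: k => [|k IH] h.
  by apply: is_derive_eq; rewrite expr0 !mul1r.
apply: (is_derive_eq (dM h (IH h))).
by rewrite exprS; ring.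
Qed.

Definition mp_arc (t : R) : R := 1 + tau - 2 * r * cos t.
Local Notation X := mp_arc.

Let dN (f : R -> R) (x a : R) : is_derive x (1 : R) f a ->
  is_derive x (1 : R) (fun y => - f y) (- a).
Proof. by move=> h; exact: is_deriveN. Qed.

Let dX1 (t : R) : is_derive t (1 : R) X (2 * r * sin t).
Proof.
have h : is_derive t (1 : R) X (0 + - (2 * r * - sin t)).
  exact: (dD (dC (1 + tau) t) (dN (dZ (2 * r) (is_derive_cos t)))).
by apply: (is_derive_eq h); rewrite add0r mulrN opprK.
Qed.

Let ccst (k : R) : continuous (fun _ : R => k). Proof. by move=> x; exact: cvg_cst. Qed.

Let cM (f g : R -> R) : continuous f -> continuous g -> continuous (fun x => f x * g x).
Proof. by move=> cf cg x; apply: cvgM; [exact: cf|exact: cg]. Qed.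

Let cB (f g : R -> R) : continuous f -> continuous g -> continuous (fun x => f x - g x).
Proof. by move=> cf cg x; apply: cvgB; [exact: cf|exact: cg]. Qed.

Let cX : continuous X.
Proof.
apply: cB; first exact: ccst.
by apply: cM; [exact: ccst|exact: continuous_cos].
Qed.

Let X0 : X 0 = mp_minus tau.
Proof. by rewrite /mp_arc /mp_minus cos0 -/r -r2; ring. Qed.

Let Xpi : X pi = mp_plus tau.
Proof. by rewrite /mp_arc /mp_plus cospi -/r -r2; ring. Qed.

Let Xincr (x y : R) : 0 <= x -> y <= pi -> x < y -> X x < X y.
Proof.
move=> x0 ypi xy; rewrite ltrD2l ltrN2 ltr_pM2l ?mulr_gt0//.
have y0 := le_trans x0 (ltW xy); have xpi := le_trans (ltW xy) ypi.
by rewrite ltr_cos// in_itv/= ?x0 ?xpi ?y0 ?ypi.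
Qed.

Let X_gt0 (t : R) : 0 < t < pi -> 0 < X t.
Proof.
move=> /andP[t0 tpi]; apply: (le_lt_trans _ (Xincr (lexx 0) (ltW tpi) t0)).
by rewrite X0 sqr_ge0.
Qed.

Let Xsin (t : R) : (X t - mp_minus tau) * (mp_plus tau - X t) = (2 * r * sin t) ^+ 2.
Proof.
rewrite -X0 -Xpi /mp_arc cos0 cospi.
by rewrite [RHS]exprMn sin2cos2; ring.
Qed.

Lemma mp_dens_ge0 x : 0 <= mp_dens tau x.
Proof.
rewrite /mp_dens indicE mem_setE in_itv/=.
have [/andP[x0 _]|_] := boolP (_ < x < _); last by rewrite mulr0.
have x0' : 0 < x by apply: (le_lt_trans _ x0); rewrite sqr_ge0.
by rewrite mulr1 divr_ge0// !mulr_ge0// ?pi_ge0// ltW.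
Qed.

Lemma measurable_mp_dens : measurable_fun setT (mp_dens tau).
Proof.
pose f (x : R) := Num.sqrt ((x - mp_minus tau) * (mp_plus tau - x)) *
  ((2 * pi * tau)^-1 * x `^ (-1)) * \1_`]mp_minus tau, mp_plus tau[ x.
have -> : mp_dens tau = f.
  apply/funext => x; rewrite /mp_dens /f indicE mem_setE in_itv/=.
  have [/andP[x0 _]|_] := boolP (_ < x < _); last by rewrite !mulr0.
  by rewrite powR_inv1 ?invfM// ltW// (le_lt_trans _ x0)// sqr_ge0.
apply: measurable_funM; last exact: measurable_indic.
apply: measurable_funM; last exact: measurable_funM.
apply: measurableT_comp; first by apply: continuous_measurable_fun; exact: sqrt_continuous.
by apply: measurable_funM; exact: measurable_funB.
Qed.

(** Under the substitution the square root and the Jacobian both equal [2 r sin t]; their product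
    [4 tau sin^2 t] over [2 pi tau x] leaves the factor [2 / pi]. *)
Lemma mp_integral (g : R -> R) : (forall x, 0 <= g x) -> measurable_fun setT g ->
  (\int[mu]_x (g x * mp_dens tau x)%:E =
   \int[mu]_(t in `]0%R, pi[) (2 / pi * (g (X t) / X t * sin t ^+ 2))%:E)%E.
Proof.
move=> g0 mg.
pose h (x : R) := (g x * mp_dens tau x)%:E.
have h0 x : (0 <= h x)%E by rewrite lee_fin mulr_ge0// mp_dens_ge0.
have mh : measurable_fun setT h.
  by apply/measurable_EFinP; apply: measurable_funM => //; exact: measurable_mp_dens.
have cs : continuous (fun t : R => 2 * r * sin t).
  by apply: cM; [exact: ccst|exact: continuous_sin].
have := @change_of_variables R X (fun t => 2 * r * sin t) 0 pi h (pi_gt0 R) cX cs dX1 _ Xincr h0 mh.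
rewrite X0 Xpi => H.
transitivity (\int[mu]_(x in `]mp_minus tau, mp_plus tau[) h x)%E.
  rewrite [RHS]integral_mkcond; apply: eq_integral => x _; rewrite patchE.
  case: ifPn => // /negbTE; rewrite mem_setE => xD.
  by rewrite /h /mp_dens indicE mem_setE xD !mulr0.
rewrite H; last by move=> t /sin_gt0_pi st; rewrite !mulr_ge0 ?(ltW r0)// ltW.
apply: eq_integral => t; rewrite inE/= in_itv/= => /andP[t0 tpi].
have t01 : 0 < t < pi by rewrite t0.
have Xt := X_gt0 t01; have st := sin_gt0_pi t01.
rewrite /h -EFinM; congr EFin.
rewrite /mp_dens indicE mem_setE in_itv/= Xsin sqrtr_sqr ger0_norm; last first.
  by rewrite !mulr_ge0 ?(ltW r0)// ltW.
rewrite -X0 -Xpi (Xincr (lexx 0) (ltW tpi) t0) (Xincr (ltW t0) (lexx _) tpi)/= -r2.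
have p0 : pi != 0 :> R by rewrite gt_eqF// pi_gt0.
move: (pi) p0 => p p0.
by field; rewrite p0 !gt_eqF.
Qed.

(** Up to [2 / pi] this is the moment of order [k + 1], the factor [1 / x] of the density having
    used one power. *)
Let J k : R := \int[mu]_(t in `[0%R, pi]) (X t ^+ k * sin t ^+ 2).

Let FTC (F f : R -> R) : continuous f -> (forall t, is_derive t (1 : R) F (f t)) ->
  \int[mu]_(t in `[0%R, pi]) f t = F pi - F 0.
Proof.
move=> cf dF; rewrite /Rintegral (@continuous_FTC2 _ f F)//.
- exact: pi_gt0.
- exact: continuous_subspaceT.
- have cF : continuous F.
    by move=> t; apply/differentiable_continuous/derivable1_diffP; have [] := dF t.
  split; first by move=> t _; have [] := dF t.
  + by apply: cvg_at_right_filter; exact: cF.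
  + by apply: cvg_at_left_filter; exact: cF.
- by move=> t _; rewrite derive1E; exact: derive_val.
Qed.

Let cXs k : continuous (fun t => X t ^+ k * sin t ^+ 2).
Proof.
have cpow (f : R -> R) j : continuous f -> continuous (fun t => f t ^+ j).
  move=> cf; elim: j => [|j IH]; first exact: ccst.
  rewrite (_ : (fun t => _) = fun t => f t * f t ^+ j); last by apply/funext => t; rewrite exprS.
  exact: cM.
by apply: cM; apply: cpow => //; exact: continuous_sin.
Qed.

Let iXs k : mu.-integrable `[0%R, pi] (EFin \o (fun t => X t ^+ k * sin t ^+ 2)).
Proof.
apply: continuous_compact_integrable; first exact: segment_compact.
by apply: continuous_subspaceT; exact: cXs.
Qed.

Let iZ k (a : R) : mu.-integrable `[0%R, pi] (EFin \o (fun t => a * (X t ^+ k * sin t ^+ 2))).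
Proof.
apply: continuous_compact_integrable; first exact: segment_compact.
by apply: continuous_subspaceT; apply: cM; [exact: ccst|exact: cXs].
Qed.

Let J0 : J 0%N = pi / 2.
Proof.
have dF (t : R) : is_derive t (1 : R) (fun t : R => 2^-1 * (t - sin t * cos t)) (X t ^+ 0 * sin t ^+ 2).
  apply: (is_derive_eq (dZ _ (dD (is_derive_id t 1) (dN (dM (is_derive_sin t) (is_derive_cos t)))))).
  by have := cos2Dsin2 t; rewrite expr0 mul1r -!expr2; lra.
by rewrite /J (FTC (@cXs 0%N) dF) sinpi sin0; ring.
Qed.

Let J1 : J 1%N = (1 + tau) * J 0%N.
Proof.
pose f (t : R) := (1 + tau) * (X t ^+ 0 * sin t ^+ 2) - 1 * (X t ^+ 1 * sin t ^+ 2).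
have cf : continuous f by apply: cB; apply: cM => //; exact: cXs.
have dF (t : R) : is_derive t (1 : R) (fun t : R => 2 * r / 3 * sin t ^+ 3) (f t).
  apply: (is_derive_eq (dZ _ (dX 2 (is_derive_sin t)))).
  by rewrite /f /mp_arc; field.
have := FTC cf dF; rewrite sinpi sin0 /f.
rewrite (RintegralB _ (iZ 0%N _) (iZ 1%N _))// (RintegralZl _ _ (iXs 0%N))// (RintegralZl _ _ (iXs 1%N))//.
by rewrite -/(J 0%N) -/(J 1%N) mul1r !expr0n/= !mulr0 subr0 => /subr0_eq.
Qed.

(** The antiderivative [2 r X^(k+1) sin^3 t] vanishes at both ends. As [2 r cos t = 1 + tau - X] and
    [4 tau sin^2 t = 2 (1 + tau) X - X^2 - (1 - tau)^2], its derivative is [sin^2 t] times a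
    combination of [X^k], [X^(k+1)] and [X^(k+2)]. *)
Let JS k : (k%:R + 4) * J k.+2 =
  (2 * k%:R + 5) * (1 + tau) * J k.+1 - (k%:R + 1) * (1 - tau) ^+ 2 * J k.
Proof.
pose f (t : R) := (2 * k%:R + 5) * (1 + tau) * (X t ^+ k.+1 * sin t ^+ 2) -
    (k%:R + 1) * (1 - tau) ^+ 2 * (X t ^+ k * sin t ^+ 2) -
    (k%:R + 4) * (X t ^+ k.+2 * sin t ^+ 2).
have cf : continuous f by apply: cB; first apply: cB; apply: cM => //; exact: cXs.
have dF (t : R) : is_derive t (1 : R) (fun t : R => 2 * r * (X t ^+ k.+1 * sin t ^+ 3)) (f t).
  apply: (is_derive_eq (dZ _ (dM (dX k (dX1 t)) (dX 2 (is_derive_sin t))))).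
  have -> : sin t ^+ 3 * (k.+1%:R * X t ^+ k * (2 * r * sin t)) =
     k.+1%:R * X t ^+ k * (2 * r) * (sin t ^+ 2) ^+ 2 by ring.
  rewrite /f !sin2cos2 !(exprS (X t)); move: (X t ^+ k) => y.
  by rewrite /mp_arc -r2 -!natr1; move: (cos t) => c; ring.
have := FTC cf dF; rewrite sinpi sin0 /f.
have i2 : mu.-integrable `[0%R, pi] (EFin \o (fun t =>
    (2 * k%:R + 5) * (1 + tau) * (X t ^+ k.+1 * sin t ^+ 2) -
    (k%:R + 1) * (1 - tau) ^+ 2 * (X t ^+ k * sin t ^+ 2))).
  apply: continuous_compact_integrable; first exact: segment_compact.
  by apply: continuous_subspaceT; apply: cB; apply: cM => //; exact: cXs.
rewrite (RintegralB _ i2 (iZ k.+2 _))// (RintegralB _ (iZ k.+1 _) (iZ k _))//.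
rewrite (RintegralZl _ _ (iXs k.+2))// (RintegralZl _ _ (iXs k.+1))// (RintegralZl _ _ (iXs k))//.
by rewrite -/(J k) -/(J k.+1) -/(J k.+2) !expr0n/= !mulr0 subr0 => /subr0_eq.
Qed.

Lemma mp_moment0 : (\int[mu]_x (mp_dens tau x)%:E = 1)%E.
Proof.
transitivity (\int[mu]_x ((fun=> 1 : R) x * mp_dens tau x)%:E)%E.
  by apply: eq_integral => x _; rewrite mul1r.
rewrite mp_integral//.
(* Minus the tangent of the argument of [1 - r exp(i t)], whose squared modulus is [X t]; unlike the
   half-angle tangent it stays finite up to [t = pi]. *)
pose A (t : R) := r * sin t / (1 - r * cos t).
(* Dividing [4 tau sin^2 t] by [X] leaves [1 + tau + 2 r cos t - (1 - tau)^2 / X], and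
   [(1 - tau) / X] is the derivative of [t + 2 atan (A t)]. *)
pose F (t : R) := (2 * pi * tau)^-1 * ((1 + tau) * t + 2 * r * sin t - (1 - tau) * (t + 2 * atan (A t))).
have den (t : R) : 0 < t < pi -> 0 < 1 - r * cos t.
  move=> /andP[t0 tpi]; rewrite subr_gt0.
  have c1 : cos t < 1.
    by rewrite -cos0 ltr_cos// in_itv/= ?lexx ?pi_ge0// (ltW t0) (ltW tpi).
  have [c0|c0] := leP (cos t) 0; first by rewrite (le_lt_trans _ ltr01)// pmulr_rle0.
  by rewrite (le_lt_trans _ c1)// ler_piMl// ltW.
have dA (t : R) : 1 - r * cos t != 0 ->
    is_derive t (1 : R) A ((r * cos t - tau) / (1 - r * cos t) ^+ 2).
  move=> d0.
  have h : is_derive t (1 : R) (fun t : R => 1 - r * cos t) (0 + - (r * - sin t)).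
    exact: (dD (dC 1 t) (dN (dZ r (is_derive_cos t)))).
  have hV := @is_deriveV R (fun t => 1 - r * cos t) t _ 1 d0 h.
  apply: (is_derive_eq (dM (dZ r (is_derive_sin t)) hV)).
  rewrite /GRing.scale/= -r2.
  have -> : r * sin t * (- (1 - r * cos t) ^- 2 * (0 - r * - sin t)) =
    - (r ^+ 2 * sin t ^+ 2) / (1 - r * cos t) ^+ 2 by ring.
  by rewrite sin2cos2; field.
have dF (t : R) : 0 < t < pi -> is_derive t (1 : R) F (2 / pi * (1 / X t * sin t ^+ 2)).
  move=> t01; have d0 := den t t01; have Xt := X_gt0 t01.
  have d0' : 1 - r * cos t != 0 by rewrite gt_eqF.
  have hat : is_derive t (1 : R) (fun y => atan (A y)) ((1 + A t ^+ 2)^-1 * ((r * cos t - tau) / (1 - r * cos t) ^+ 2)).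
    exact: (@is_derive1_comp R atan A t _ _ (is_derive1_atan _) (dA t d0')).
  apply: (is_derive_eq (dZ _ (dD (dD (dZ (1 + tau) (is_derive_id t 1)) (dZ (2 * r) (is_derive_sin t)))
    (dN (dZ (1 - tau) (dD (is_derive_id t 1) (dZ 2 hat))))))).
  have AX : 1 + A t ^+ 2 = X t / (1 - r * cos t) ^+ 2.
    rewrite /A exprMn exprVn [X in _ + X / _]exprMn sin2cos2 /mp_arc -r2.
    by field.
  have -> : (1 + A t ^+ 2)^-1 * ((r * cos t - tau) / (1 - r * cos t) ^+ 2) = (r * cos t - tau) / X t.
    by rewrite AX; field; rewrite d0' gt_eqF.
  rewrite sin2cos2.
  have Xn : X t != 0 by rewrite gt_eqF.
  have p0 : pi != 0 :> R by rewrite gt_eqF// pi_gt0.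
  have rn : r != 0 by rewrite gt_eqF.
  rewrite -r2 /mp_arc -r2 in Xn *; move: (pi) p0 => p p0.
  by field; rewrite p0 Xn rn.
have cF (t : R) : 1 - r * cos t != 0 -> {for t, continuous F}.
  move=> d0; have h : derivable F t 1.
    have hat : is_derive t (1 : R) (fun y => atan (A y)) ((1 + A t ^+ 2)^-1 * ((r * cos t - tau) / (1 - r * cos t) ^+ 2)).
      exact: (@is_derive1_comp R atan A t _ _ (is_derive1_atan _) (dA t d0)).
    have := dZ (2 * pi * tau)^-1 (dD (dD (dZ (1 + tau) (is_derive_id t 1)) (dZ (2 * r) (is_derive_sin t)))
      (dN (dZ (1 - tau) (dD (is_derive_id t 1) (dZ 2 hat))))).
    by case.
  exact/differentiable_continuous/derivable1_diffP.
have Fpi : F pi = 1.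
  rewrite /F /A sinpi !(mulr0, mul0r) atan0 mulr0 !addr0.
  have p0 : pi != 0 :> R by rewrite gt_eqF// pi_gt0.
  by move: (pi) p0 => p p0; field; rewrite p0 gt_eqF.
have F0 : F 0 = 0 by rewrite /F /A sin0 !(mulr0, mul0r) atan0 mulr0 !addr0 mulr0 subr0 mulr0.
rewrite (@ge0_FTC2_oo _ _ F 0 pi 0 1) ?subr0//.
- exact: pi_gt0.
- move=> t /X_gt0 Xt; apply: mulr_ge0; first by rewrite divr_ge0// pi_ge0.
  by rewrite mulr_ge0 ?sqr_ge0// divr_ge0// ltW.
- move=> t /X_gt0 Xt.
  have cs : continuous (fun x : R => sin x ^+ 2) by apply: cM; exact: continuous_sin.
  have cV : {for t, continuous (fun x => 1 / X x)}.
    by apply: cvgM; [exact: cvg_cst|apply: cvgV; [rewrite gt_eqF|exact: cX]].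
  have cVs : {for t, continuous (fun x => 1 / X x * sin x ^+ 2)} by apply: cvgM => //; exact: cs.
  by apply: cvgM; [exact: cvg_cst|exact: cVs].
(* For [tau = 1] the quotient [A] degenerates at [t = 0], but then its coefficient [1 - tau]
   vanishes. *)
- rewrite -[X in _ --> X]F0; have [r11|r11] := eqVneq r 1; last first.
    apply: cvg_at_right_filter; apply: cF.
    by rewrite cos0 mulr1 subr_eq0 eq_sym.
  have -> : F = (fun t => (2 * pi * tau)^-1 * ((1 + tau) * t + 2 * r * sin t)).
    by apply/funext => t; rewrite /F -r2 r11 expr1n subrr mul0r subr0.
  apply: cvg_at_right_filter; apply: cvgM; first exact: cvg_cst.
  apply: cvgD; apply: cvgM; try exact: cvg_cst; first exact: cvg_id.
  exact: continuous_sin.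
- rewrite -[X in _ --> X]Fpi; apply: cvg_at_left_filter; apply: cF.
  by rewrite cospi mulrN1 opprK gt_eqF// addr_gt0.
Qed.

Lemma mp_momentS k : (\int[mu]_x (x ^+ k.+1 * mp_dens tau x)%:E = (2 / pi * J k)%:E)%E.
Proof.
(* [mp_integral] asks for a function that is nonnegative on the whole line; on the support
   [|x| = x]. *)
transitivity (\int[mu]_x (`|x| ^+ k.+1 * mp_dens tau x)%:E)%E.
  apply: eq_integral => x _; rewrite /mp_dens indicE mem_setE in_itv/=.
  have [/andP[x0 _]|_] := boolP (_ < x < _); last by rewrite !mulr0.
  by rewrite ger0_norm// ltW// (le_lt_trans _ x0)// sqr_ge0.
have mg : measurable_fun setT (fun x : R => `|x| ^+ k.+1).
  by apply: measurable_funX; apply: continuous_measurable_fun; exact: norm_continuous.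
rewrite (mp_integral (fun x => exprn_ge0 _ (normr_ge0 x)) mg).
have p0 : 0 <= 2 / pi :> R by rewrite divr_ge0// pi_ge0.
rewrite -(@integral_itv_bndoo _ _ _ _ true false); last first.
  apply: (@eq_measurable_fun _ _ _ _ _ (fun t : R => (2 / pi * (X t ^+ k * sin t ^+ 2))%:E)).
    move=> t; rewrite inE/= in_itv/= => /X_gt0 Xt; congr (_ * (_ * _))%:E.
    by rewrite gtr0_norm// exprSr mulfK// gt_eqF.
  apply/measurable_EFinP; apply: measurable_funM => //; apply: measurable_funTS.
  by apply: continuous_measurable_fun; exact: cXs.
transitivity (\int[mu]_(t in `[0%R, pi]) (2 / pi * (X t ^+ k * sin t ^+ 2))%:E)%E.
  apply: eq_integral => t; rewrite inE/= in_itv/= => /andP[t0 tpi].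
  have [->|s0] := eqVneq (sin t) 0; first by rewrite !expr0n/= !mulr0.
  have Xt : 0 < X t.
    apply: X_gt0; rewrite !lt_neqAle t0 tpi !andbT; apply/andP; split; apply: contra_neq s0.
      by move=> <-; rewrite sin0.
    by move=> ->; rewrite sinpi.
  by congr (_ * (_ * _))%:E; rewrite gtr0_norm// exprSr mulfK// gt_eqF.
rewrite /J -(RintegralZl _ _ (iXs k))//.
by rewrite /Rintegral fineK//; exact: integrable_fin_num (iZ _ _).
Qed.

Lemma mp_int_recursion : let m k := mp_int tau (fun x => x ^+ k) in
  m 0%N = 1 /\
  forall k, m k.+1 = (1 - tau) * m k + tau * \sum_(p < k.+1) m (k - p)%N * m p.
Proof.
move=> m.
have m0 : m 0%N = 1.
  rewrite /m /mp_int /Rintegral (_ : (fun x => _) = EFin \o mp_dens tau) ?mp_moment0//.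
  by apply/funext => x; rewrite expr0 mul1r.
have mS k : m k.+1 = 2 / pi * J k by rewrite /m /mp_int /Rintegral mp_momentS.
have p0 : pi != 0 :> R by rewrite gt_eqF// pi_gt0.
have m1 : m 1%N = 1 by rewrite mS J0; move: (pi) p0 => p p0; field.
split => //; apply: quadratic_recursion => //; first by rewrite gt_eqF.
(* Moments are shifted by one against [J]: the recursion at [j + 1] is [JS] at [j], and at 0 it is
   [J1]. *)
case=> [|j]; rewrite !mS; first by rewrite J1; ring.
have j1 : j.+1%:R = j%:R + 1 :> R by rewrite natr1.
rewrite mulrCA (_ : j.+1%:R + 3 = j%:R + 4); last by rewrite j1; ring.
by rewrite JS j1; ring.
Qed.

End marchenko_pastur.

(** * From moments to weak convergence *)

Section bernstein.
Context (R : realType).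
Implicit Types (g h : nat -> R) (x : R).

(* [bern n g x] is the sum of [g k * 'C(n, k) * x ^ k * (1 - x) ^ (n - k)], computed by
   Pascal's rule. *)
Fixpoint bern n g x : R :=
  if n is n'.+1 then (1 - x) * bern n' g x + x * bern n' (fun k => g k.+1) x else g 0%N.

Lemma bern_poly n g : exists p : {poly R}, forall x, bern n g x = p.[x].
Proof.
elim: n g => [|n IH] g; first by exists (g 0%N)%:P => x; rewrite hornerC.
have [p Hp] := IH g; have [q Hq] := IH (fun k => g k.+1).
by exists ((1 - 'X) * p + 'X * q) => x; rewrite /= Hp Hq !hornerE.
Qed.

Lemma bern_le n g h x : 0 <= x <= 1 -> (forall k, (k <= n)%N -> g k <= h k) ->
  bern n g x <= bern n h x.
Proof.
move=> /andP[x0 x1]; elim: n g h => [|n IH] g h gh /=; first exact: gh.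
apply: lerD; apply: ler_wpM2l; rewrite ?subr_ge0//; apply: IH => k kn; apply: gh => //.
exact: ltnW.
Qed.

(** The binomial law has mean [n x] and variance [n x (1 - x)]. The centre [c] is left free because
    Pascal's rule shifts it to [c - 1]. *)
Lemma bern_quad n (a b c x : R) :
  bern n (fun k => a + b * (k%:R - c) ^+ 2) x =
  a + b * ((n%:R * x - c) ^+ 2 + n%:R * (x * (1 - x))).
Proof.
elim: n c => [|n IH] c /=; first by ring.
rewrite IH (_ : (fun k : nat => _) = (fun k : nat => a + b * (k%:R - (c - 1)) ^+ 2)); last first.
  by apply/funext => k; rewrite -natr1; ring.
by rewrite IH -natr1; ring.
Qed.

Lemma unif_continuous_itv (f : R -> R) (e : R) : continuous f -> 0 < e ->
  exists2 d : R, 0 < d &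
    forall x y, 0 <= x <= 1 -> `|x - y| < d -> `|f x - f y| < e.
Proof.
move=> cf e0.
pose P (d x : R) := forall y, `|x - y| < d -> `|f x - f y| < e.
have /compact_near_coveringP/(_ R (0^'+) P) := @segment_compact R 0 1.
have H x : `[0, 1]%classic x -> \forall x' \near x & d \near 0^'+, P d x'.
  move=> _; have e2 : 0 < e / 2 by rewrite divr_gt0.
  have /cvgrPdist_lt/(_ _ e2)[r /= r0 Hr] := cf x.
  exists (ball x (r / 2), [set d : R | d < r / 2]).
    split => /=; first by apply: nbhsx_ballx; rewrite divr_gt0.
    by apply: nbhs_right_lt; rewrite divr_gt0.
  move=> [x' d] /= [xx' dr] y x'y.
  rewrite -ball_normE /= in xx'.
  have h1 : `|f x - f x'| < e / 2.
    by apply: Hr => /=; rewrite (lt_trans xx')// ltr_pdivrMr// ltr_pMr// ltr1n.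
  have h2 : `|f x - f y| < e / 2.
    apply: Hr => /=; rewrite (_ : x - y = (x - x') + (x' - y)); last by ring.
    by rewrite (le_lt_trans (ler_normD _ _))// [r]splitr ltrD// (lt_trans x'y).
  rewrite (_ : f x' - f y = (f x - f y) - (f x - f x')); last by ring.
  by rewrite (le_lt_trans (ler_normB _ _))// [e]splitr ltrD.
move=> /(_ _ H) [d /= d0 Hd].
exists (d / 2); first by rewrite divr_gt0.
move=> x y x01 xy; apply: (Hd (d / 2)) => //=; rewrite ?divr_gt0//.
by rewrite sub0r normrN gtr0_norm ?divr_gt0// ltr_pdivrMr// ltr_pMr// ltr1n.
Qed.

(** Either [k / N] is within [d] of [x], or [2 M <= K (x - k / N)^2]. The grid values thus lie
    between two parabolas centred at [x], whose Bernstein averages are explicit; their variance term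
    is at most [K / N <= e / 2]. *)
Lemma weierstrass01 (f : R -> R) (M e : R) : continuous f -> (forall x, `|f x| <= M) -> 0 < e ->
  exists p : {poly R}, forall x, 0 <= x <= 1 -> `|f x - p.[x]| <= e.
Proof.
move=> cf fM e0; have M0 : 0 <= M by exact: le_trans (fM 0).
have e2 : 0 < e / 2 by rewrite divr_gt0.
have [d d0 Hd] := unif_continuous_itv cf e2.
pose K : R := 2 * M / d ^+ 2.
have K0 : 0 <= K by exact: divr_ge0 (mulr_ge0 _ M0) (sqr_ge0 d).
have [n /= Kn] : exists n : nat, K / n.+1%:R <= e / 2.
  exists (Num.truncn (K / (e / 2))); rewrite ler_pdivrMr// mulrC -ler_pdivrMr//.
  by rewrite ltW// truncnS_gt.
pose N : R := n.+1%:R; have N0 : 0 < N by [].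
have [p Hp] := bern_poly n.+1 (fun k => f (k%:R / N)).
exists p => x x01; rewrite -Hp; have [x0 x1] := andP x01.
have close k : `|f x - f (k%:R / N)| <= e / 2 + K / N ^+ 2 * (k%:R - N * x) ^+ 2.
  have E : K / N ^+ 2 * (k%:R - N * x) ^+ 2 = K * (x - k%:R / N) ^+ 2.
    by field; rewrite gt_eqF.
  rewrite E; have [lt|ge] := ltP `|x - k%:R / N| d.
    by rewrite (le_trans (ltW (Hd _ _ x01 lt)))// lerDl mulr_ge0// sqr_ge0.
  apply: (@le_trans _ _ (K * (x - k%:R / N) ^+ 2)); last by rewrite lerDr ltW.
  apply: (@le_trans _ _ (2 * M)).
    by have := ler_normB (f x) (f (k%:R / N)); have := fM x; have := fM (k%:R / N); lra.
  rewrite /K mulrAC ler_pdivlMr ?exprn_gt0//; apply: ler_wpM2l; first by rewrite mulr_ge0.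
  by rewrite -[leRHS]real_normK ?num_real// lerXn2r ?nnegrE// ltW.
have tot : K / N ^+ 2 * ((N * x - N * x) ^+ 2 + N * (x * (1 - x))) <= e / 2.
  have -> : K / N ^+ 2 * ((N * x - N * x) ^+ 2 + N * (x * (1 - x))) = K / N * (x * (1 - x)).
    by field; rewrite gt_eqF.
  apply: le_trans Kn; apply: ler_piMr; first exact: divr_ge0 K0 (ltW N0).
  by rewrite mulr_ile1 ?subr_ge0// gerBl.
rewrite ler_distlC; apply/andP; split.
  apply: (@le_trans _ _ (bern n.+1 (fun k => (f x - e / 2) + - (K / N ^+ 2) * (k%:R - N * x) ^+ 2) x)).
    by rewrite bern_quad -/N mulNr; move: (K / N ^+ 2 * _) tot => z tot; lra.
  apply: bern_le => // k _; have := close k; rewrite ler_norml => /andP[_].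
  by rewrite mulNr; move: (K / N ^+ 2 * _) => z; lra.
apply: (@le_trans _ _ (bern n.+1 (fun k => (f x + e / 2) + K / N ^+ 2 * (k%:R - N * x) ^+ 2) x)).
  apply: bern_le => // k _; have := close k; rewrite ler_norml => /andP[+ _].
  by move: (K / N ^+ 2 * _) => z; lra.
by rewrite bern_quad -/N; move: (K / N ^+ 2 * _) tot => z tot; lra.
Qed.

Lemma weierstrass (f : R -> R) (A M e : R) : 0 < A -> continuous f ->
  (forall x, `|f x| <= M) -> 0 < e ->
  exists p : {poly R}, forall x, 0 <= x <= A -> `|f x - p.[x]| <= e.
Proof.
move=> A0 cf fM e0.
have cg : continuous (fun x => f (A * x)).
  move=> x; apply: (@continuous_comp _ _ _ (fun x => A * x) f); last exact: cf.
  exact: mulrl_continuous.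
have [p Hp] := weierstrass01 cg (fun x => fM (A * x)) e0.
exists (p \Po (A^-1 *: 'X)) => x /andP[x0 xA].
rewrite horner_comp !hornerE.
have := Hp (A^-1 * x); rewrite mulVKf ?gt_eqF//; apply.
by rewrite mulr_ge0 ?invr_ge0 ?(ltW A0)//= mulrC ler_pdivrMr// mul1r.
Qed.

End bernstein.

Section method_of_moments.
Context (R : realType).
Notation mu := (@lebesgue_measure R).
Variable tau : R.
Hypothesis tau01 : 0 < tau <= 1.

(** [tau <= 1] places the support inside [[0, 4]], the interval used in all bounds below. *)
Let dens_out (x : R) : ~~ (0 <= x <= 4) -> mp_dens tau x = 0.
Proof.
move=> x04; rewrite /mp_dens indicE mem_setE in_itv/=.
have [/andP[x0 x4]|_] := boolP (_ < x < _); last by rewrite mulr0.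
have [tau0 tau1] := andP tau01.
have s1 : Num.sqrt tau <= 1 by rewrite -sqrtr1 ler_sqrt.
move: x04; rewrite (ltW (le_lt_trans _ x0)) ?sqr_ge0//= -ltNge => x4'.
have := lt_trans x4' x4; rewrite ltNge => /negP; case.
rewrite /mp_plus (_ : 4 = 2 ^+ 2 :> R); last by ring.
by rewrite lerXn2r ?nnegrE ?addr_ge0 ?sqrtr_ge0//; lra.
Qed.

Let mdens : measurable_fun setT (mp_dens tau) := measurable_mp_dens tau.

Let idens : mu.-integrable setT (EFin \o mp_dens tau).
Proof.
apply/integrableP; split; first exact/measurable_EFinP.
rewrite (_ : (fun x => _) = EFin \o mp_dens tau); first by rewrite mp_moment0// ltry.
by apply/funext => x /=; rewrite ger0_norm// mp_dens_ge0.
Qed.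

Let intZ (c : R) (g : R -> R) : mu.-integrable setT (EFin \o g) ->
  mu.-integrable setT (EFin \o (fun x => c * g x)).
Proof.
move=> ig; rewrite (_ : EFin \o _ = (fun x => c%:E * (EFin \o g) x)%E); first exact: integrableZl.
by apply/funext => x; rewrite /= EFinM.
Qed.

Let le_dens (g : R -> R) (C x : R) : (forall y : R, 0 <= y <= 4 -> `|g y| <= C) ->
  `|g x * mp_dens tau x| <= C * mp_dens tau x.
Proof.
move=> gC; rewrite normrM (ger0_norm (mp_dens_ge0 tau01 x)).
have [x04|/dens_out ->] := boolP (0 <= x <= 4); last by rewrite !mulr0.
by rewrite ler_wpM2r ?mp_dens_ge0// gC.
Qed.

Let igdens (g : R -> R) (C : R) : measurable_fun setT g ->
  (forall y : R, 0 <= y <= 4 -> `|g y| <= C) ->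
  mu.-integrable setT (EFin \o (fun x => g x * mp_dens tau x)).
Proof.
move=> mg gC.
apply: le_integrable (intZ C idens) => //.
  by apply/measurable_EFinP; exact: measurable_funM.
move=> x _ /=; rewrite lee_fin (le_trans (le_dens _ gC))//.
exact: ler_norm.
Qed.

Lemma mp_int_le (g : R -> R) (C : R) : measurable_fun setT g ->
  (forall y : R, 0 <= y <= 4 -> `|g y| <= C) -> `|mp_int tau g| <= C.
Proof.
move=> mg gC; rewrite /mp_int.
apply: (le_trans (le_normr_Rintegral _ (igdens mg gC))) => //.
have -> : C = \int[mu]_x (C * mp_dens tau x).
  by rewrite RintegralZl// /Rintegral mp_moment0// mulr1.
apply: le_Rintegral => //.
- by have /integrable_abse := igdens mg gC.
- exact: intZ.
- by move=> x _; exact: le_dens.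
Qed.

Let mpow k : measurable_fun setT (fun x : R => x ^+ k).
Proof. exact: measurable_funX. Qed.

Let pow_le k (y : R) : 0 <= y <= 4 -> `|y ^+ k| <= 4 ^+ k.
Proof.
by move=> /andP[y0 y4]; rewrite ger0_norm ?exprn_ge0// lerXn2r ?nnegrE.
Qed.

Lemma mp_int_poly (p : {poly R}) :
  mp_int tau (fun x => p.[x]) = \sum_(i < size p) p`_i * mp_int tau (fun x => x ^+ i).
Proof.
rewrite /mp_int.
transitivity (\int[mu]_x (\sum_(i < size p) p`_i * (x ^+ i * mp_dens tau x))).
  by apply: eq_Rintegral => x _; rewrite horner_coef mulr_suml; apply: eq_bigr => i _; exact/esym/mulrA.
have ip i := igdens (mpow i) (@pow_le i).
elim: (size p) => [|n IH].
  rewrite big_ord0 -[RHS](mul0r (fine (mu setT))) -Rintegral_cst//.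
  by apply: eq_Rintegral => x _; rewrite big_ord0.
rewrite big_ord_recr/= -IH -RintegralZl// -RintegralD//.
- by apply: eq_Rintegral => x _; rewrite big_ord_recr.
- rewrite (_ : _ \o _ = (fun x => \sum_(i < n) (p`_i * (x ^+ i * mp_dens tau x))%:E)%E); last first.
    by apply/funext => x /=; rewrite sumEFin.
  by apply: integrable_sum => // i _; exact: (intZ _ (ip i)).
- exact: (intZ _ (ip n)).
Qed.

Lemma mp_intB (f g : R -> R) (C D : R) :
  measurable_fun setT f -> (forall y : R, 0 <= y <= 4 -> `|f y| <= C) ->
  measurable_fun setT g -> (forall y : R, 0 <= y <= 4 -> `|g y| <= D) ->
  mp_int tau (fun x => f x - g x) = mp_int tau f - mp_int tau g.
Proof.
move=> mf fC mg gD; rewrite /mp_int -RintegralB//; try exact: igdens.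
- by apply: eq_Rintegral => x _; rewrite mulrBl.
- exact: igdens mf fC.
- exact: igdens mg gD.
Qed.

(** The atomic measures may charge points far out, where a polynomial approximation on [[0, 5]] says
    nothing. Beyond 5 the error is dominated by a monomial of high degree, whose limiting moment
    only sees [[0, 4]]; the gap between 4 and 5 makes it small. *)
Lemma weak_cvg_moments (m x : forall n, 'I_n -> R) :
  (forall n i, 0 <= m n i) -> (forall n i, 0 <= x n i) ->
  (forall k, \sum_(i < n) m n i * x n i ^+ k @[n --> \oo] --> mp_int tau (fun y => y ^+ k)) ->
  weak_cvg_MP m x tau.
Proof.
move=> m0 x0 mom f cf [M fM].
have M0 : 0 <= M by exact: le_trans (fM 0).
have mf : measurable_fun setT f by exact: continuous_measurable_fun.
apply/cvgrPdist_le => e e0.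
(* The budget: [h] for replacing [f] by [p] under the limit law, [h] for the convergence of [p], and
   [S n <= L + h <= 3 h] for replacing [p] by [f] under the atomic measure. *)
pose h : R := e / 5; have h0 : 0 < h by rewrite divr_gt0.
have A0 : (0 : R) < 5 by [].
have [p Hp] := weierstrass A0 cf fM h0.
have mp : measurable_fun setT (fun y : R => p.[y]).
  by apply: continuous_measurable_fun; exact: continuous_horner.
pose d := size p; pose C : R := M + \sum_(i < d) `|p`_i|.
have C0 : 0 <= C by rewrite addr_ge0// sumr_ge0.
(* [4 ^+ (d + j) / 5 ^+ j] tends to 0 as [j] grows, [d] being fixed by [p]. *)
have [j Hj] : exists j : nat, C * 4 ^+ d * (4 / 5) ^+ j <= h.
  have q1 : `|4 / 5 : R| < 1 by rewrite ger0_norm; lra.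
  have : C * 4 ^+ d * (4 / 5) ^+ n @[n --> \oo] --> C * 4 ^+ d * 0.
    by apply: cvgM; [exact: cvg_cst|exact: cvg_expr].
  rewrite mulr0 => /cvgrPdist_le/(_ _ h0)[j _ /(_ j (leqnn j))].
  by rewrite sub0r normrN => /(le_trans (ler_norm _)) ?; exists j.
have p_le (y : R) : 1 <= y -> `|p.[y]| <= (\sum_(i < d) `|p`_i|) * y ^+ d.
  move=> y1; rewrite horner_coef (le_trans (ler_norm_sum _ _ _))// mulr_suml.
  apply: ler_sum => i _; rewrite normrM ler_wpM2l// ger0_norm; last by rewrite exprn_ge0// (le_trans _ y1).
  by rewrite ler_weXn2l// ltnW.
have far (y : R) : 0 <= y -> `|f y - p.[y]| <= h + C / 5 ^+ j * y ^+ (d + j).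
  move=> y0; have t0 : 0 <= C / 5 ^+ j * y ^+ (d + j).
    by rewrite mulr_ge0 ?exprn_ge0// divr_ge0// exprn_ge0.
  have [y5|y5] := leP y 5; first by rewrite (le_trans (Hp _ _)) ?y0// lerDl.
  have y1 : 1 <= y by apply: le_trans (ltW y5); lra.
  apply: (@le_trans _ _ (C * y ^+ d)).
    rewrite (le_trans (ler_normB _ _))// mulrDl lerD ?p_le//.
    by rewrite (le_trans (fM y))// ler_peMr// exprn_ege1.
  apply: (@le_trans _ _ (C / 5 ^+ j * y ^+ (d + j))); last by rewrite lerDr ltW.
  rewrite exprD (_ : _ * (_ * _) = C * y ^+ d * (y / 5) ^+ j); last first.
    by rewrite exprMn exprVn; ring.
  by rewrite ler_peMr ?mulr_ge0 ?exprn_ge0// exprn_ege1// ler_pdivlMr// mul1r ltW.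
have cp : \sum_(i < n) m n i * p.[x n i] @[n --> \oo] --> mp_int tau (fun y => p.[y]).
  rewrite mp_int_poly.
  have -> : (fun n => \sum_(i < n) m n i * p.[x n i]) =
      (fun n => \sum_(k < d) p`_k * \sum_(i < n) m n i * x n i ^+ k).
    apply/funext => n; under eq_bigr do rewrite horner_coef mulr_sumr.
    rewrite exchange_big/=; apply: eq_bigr => k _; rewrite mulr_sumr.
    by apply: eq_bigr => i _; rewrite mulrCA.
  by apply: cvg_bigsum => k; apply: cvgM; [exact: cvg_cst|exact: mom].
(* Integral of the majorant given by [far]; being polynomial, it converges by the hypothesis on
   moments. *)
pose S n : R := h * (\sum_(i < n) m n i * x n i ^+ 0) +
    C / 5 ^+ j * (\sum_(i < n) m n i * x n i ^+ (d + j)).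
pose L : R := h * mp_int tau (fun y => y ^+ 0) + C / 5 ^+ j * mp_int tau (fun y => y ^+ (d + j)).
have cS : S n @[n --> \oo] --> L.
  by apply: cvgD; (apply: cvgM; [exact: cvg_cst|exact: mom]).
have lS : L <= 2 * h.
  have b0 := mp_int_le (mpow 0) (@pow_le 0); rewrite expr0 in b0.
  have bj := mp_int_le (mpow (d + j)) (@pow_le (d + j)%N).
  have c5 : 0 <= C / 5 ^+ j by rewrite divr_ge0// exprn_ge0.
  have u1 := ler_wpM2l (ltW h0) (le_trans (ler_norm _) b0).
  have u2 := ler_wpM2l c5 (le_trans (ler_norm _) bj).
  have u3 : C / 5 ^+ j * 4 ^+ (d + j) = C * 4 ^+ d * (4 / 5) ^+ j.
    by rewrite exprD [(4 / 5) ^+ j]exprMn exprVn; ring.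
  by rewrite mulr1 in u1; rewrite u3 in u2; have := lerD u1 u2; rewrite -/L; lra.
have pf : `|mp_int tau f - mp_int tau (fun y => p.[y])| <= h.
  have b1 (y : R) : 0 <= y <= 4 -> `|f y - p.[y]| <= h.
    by move=> /andP[y0 y4]; apply: Hp; rewrite y0 (le_trans y4)//; lra.
  have b2 (y : R) : 0 <= y <= 4 -> `|p.[y]| <= M + h.
    move=> y04; rewrite (_ : p.[y] = f y - (f y - p.[y])); last by ring.
    by rewrite (le_trans (ler_normB _ _))// lerD// b1.
  rewrite -(mp_intB mf (fun y _ => fM y) mp b2); apply: mp_int_le b1.
  exact: measurable_funB.
near=> n.
have n1 : `|mp_int tau (fun y => p.[y]) - \sum_(i < n) m n i * p.[x n i]| <= h.
  by near: n; move/cvgrPdist_le : cp; apply.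
have n2 : `|L - S n| <= h by near: n; move/cvgrPdist_le : cS; apply.
have n3 : `|\sum_(i < n) m n i * p.[x n i] - \sum_(i < n) m n i * f (x n i)| <= S n.
  rewrite /S -sumrB (le_trans (ler_norm_sum _ _ _))// !mulr_sumr -big_split/=.
  apply: ler_sum => i _; rewrite -mulrBr normrM ger0_norm// distrC.
  apply: (le_trans (ler_wpM2l (m0 n i) (far _ (x0 n i)))).
  by rewrite le_eqVlt; apply/orP; left; apply/eqP; rewrite expr0; ring.
move: n2; rewrite ler_distl => /andP[n2 _].
have t1 := ler_distD (\sum_(i < n) m n i * p.[x n i]) (mp_int tau (fun y => p.[y]))
  (\sum_(i < n) m n i * f (x n i)).
have t2 := ler_distD (mp_int tau (fun y => p.[y])) (mp_int tau f)
  (\sum_(i < n) m n i * f (x n i)).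
apply: (le_trans t2); apply: (le_trans (lerD pf t1)).
have e5 : e = 5 * h by rewrite /h; field.
move: lS n1 n2 n3; rewrite e5; move: (L) (S n) => l s' lS n1 n2 n3.
apply: (le_trans (lerD (lexx h) (lerD n1 n3))).
by move: lS n2; lra.
Unshelve. all: by end_near. Qed.

End method_of_moments.

Theorem theorem2p2 (R : realType) (d : measure_display) (T : measurableType d)
    (P : probability T R) (beta tau : R) (a b : nat -> R)
    (lam w : forall n : nat, T -> 'I_n -> R) :
  0 < beta ->
  0 < tau <= 1 ->
  (forall n : nat, beta / 2 * (n.-1)%:R < a n /\ beta / 2 * (n.-1)%:R < b n) ->
  (fun n : nat => beta / 2 * n%:R / a n) @ \oo --> tau ->
  (fun n : nat => b n / n%:R) @ \oo --> +oo ->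
  (forall (n : nat) (i : 'I_n), measurable_fun setT (fun t => lam n t i)) ->
  (forall (n : nat) (i : 'I_n), measurable_fun setT (fun t => w n t i)) ->
  (forall (n : nat) (A B : 'I_n -> set R),
      (forall i, measurable (A i)) -> (forall i, measurable (B i)) ->
      P [set t | forall i : 'I_n, A i (lam n t i) /\ B i (w n t i)] =
      (jac_prob beta (a n) (b n) A * dir_prob (beta / 2) B)%E) ->
  {ae P, forall t,
    weak_cvg_MP (fun n i => w n t i) (fun n i => b n / a n * lam n t i) tau /\
    weak_cvg_MP (fun n _ => n%:R^-1) (fun n i => b n / a n * lam n t i) tau}.
Proof.
move=> beta0 tau01 hab ha hb mlam mw rect.
have tau0 : 0 < tau by case/andP: tau01.
have c0 : 0 < beta / 2 by rewrite divr_gt0.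
have supp := ae_forall_nat (fun n => support_ae (mlam n) (mw n) (rect n)).
have sloop0 := sloop_ae beta0 tau0 hab ha hb mlam mw rect.
have wmom0 := wmom_ae beta0 tau0 c0 hab ha hb mlam mw rect.
have [m0 mS] := mp_int_recursion tau01.
(* On the intersection of three almost sure events the rest is deterministic, and clamped
   eigenvalues coincide with the true ones. *)
apply: filterS3 supp sloop0 wmom0 => t supp sloop0 wmom0.
have clamE n i : clam (lam n) t i = lam n t i by apply: clamp_id; case: (supp n i).
have scale n i k : (b n / a n * lam n t i) ^+ k = clam (lam n) t i ^+ k / theta a b n ^+ k.
  by rewrite clamE exprMn mulrC -exprVn /theta invf_div.
have smomc k := smom_cvg beta0 tau0 hab ha hb m0 mS sloop0 (k := k).
have x0 n i : 0 <= b n / a n * lam n t i.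
  have [/andP[/ltW l0 _] _] := supp n i.
  by rewrite mulr_ge0// divr_ge0// ltW ?(a_gt0 beta0 hab) ?(b_gt0 beta0 hab).
split; apply: weak_cvg_moments => //.
- by move=> n i; have [_ /ltW] := supp n i.
- move=> k.
  (* The spectral moment is the empirical one plus a difference already known to vanish. *)
  rewrite (_ : (fun n => _) = (fun n => (wmom lam w k n t / theta a b n ^+ k -
      smom a b (fun j => clam (lam j) t) k n) + smom a b (fun j => clam (lam j) t) k n)).
    by rewrite -[X in _ --> X]add0r; apply: cvgD; [exact: wmom0|exact: smomc].
  apply/funext => n; rewrite subrK /wmom mulr_suml; apply: eq_bigr => i _.
  by rewrite scale mulrA.
- move=> k; rewrite (_ : (fun n => _) = smom a b (fun j => clam (lam j) t) k); first exact: smomc.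
  apply/funext => n; rewrite /smom /psum mulr_suml; apply: eq_bigr => i _.
  by rewrite scale invfM mulrCA.
Qed.
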